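(* Let $\mathcal G$ be a class of unlabelled graphs having the consecutive neighbourhood representation property, and assume $\mathcal G$ is closed under taking induced subgraphs and under duplication of vertices. Then the FO model checking problem on $\mathcal G$ (given $G\in\mathcal G$ and an FO sentence $\phi$, decide whether $G\models\phi$), parameterized by $|\phi|$, is $AW[*]$-complete.
   Context: A graph $G$ represents consecutive neighbourhoods of order $\ell$ if there are a sequence $S=(v_1,\dots,v_\ell)$ of distinct vertices and a set $R\subseteq V(G)$ with $R\cap S=\emptyset$ such that for every pair $1\le i<j\le\ell$ some $w\in R$ has neighbours in $S$ exactly $v_i,v_{i+1},\dots,v_j$ (other edges are arbitrary). A class $\mathcal G$ has the consecutive neighbourhood representation property if for every integer $\ell>0$ there is an efficiently (polynomial-time) computable graph $G\in\mathcal G$ such that $G$ or its complement represents consecutive neighbourhoods of order $\ell$. Duplication of a vertex $v$ adds a true twin $v'$: a new vertex adjacent to $v$ and exactly to the neighbours of $v$. FO logic of unlabelled graphs uses vertex quantification, equality and adjacency. $AW[*]$ is the parameterized complexity class of Downey and Fellows. *)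

(* Defs.v *)
From mathcomp Require Import all_boot.
Set Implicit Arguments.
Unset Strict Implicit.
Unset Printing Implicit Defensive.

(** * Computation model

    Jones' WHILE language on binary trees.  An assignment is charged the size
    of the value it stores, so the store never outgrows the elapsed time and
    running time agrees with that of Turing machines up to a polynomial, also
    for functions with tree output. *)

Inductive tree := Leaf | Node of tree & tree.

Fixpoint tsize (x : tree) : nat :=
  if x is Node l r then (tsize l + tsize r).+1 else 1.

Inductive expr :=
  | EVar of nat
  | ENil
  | ECons of expr & expr
  | EHd of expr
  | ETl of expr.

Inductive cmd :=
  | Assign of nat & expr
  | Seq of cmd & cmd
  | If of expr & cmd & cmd
  | While of expr & cmd.

Definition store := nat -> tree.

Definition upd (s : store) (x : nat) (v : tree) : store :=
  fun y => if y == x then v else s y.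

Fixpoint eval (e : expr) (s : store) : tree :=
  match e with
  | EVar x => s x
  | ENil => Leaf
  | ECons a b => Node (eval a s) (eval b s)
  | EHd a => if eval a s is Node l _ then l else Leaf
  | ETl a => if eval a s is Node _ r then r else Leaf
  end.

(* [exec c s s' t]: from store [s], [c] halts in store [s'] after time [t].
   [Leaf] is the only false value. *)
Inductive exec : cmd -> store -> store -> nat -> Prop :=
  | ExAssign x e s :
      exec (Assign x e) s (upd s x (eval e s)) (tsize (eval e s)).+1
  | ExSeq c1 c2 s1 s2 s3 t1 t2 :
      exec c1 s1 s2 t1 -> exec c2 s2 s3 t2 ->
      exec (Seq c1 c2) s1 s3 (t1 + t2)
  | ExIfT e c1 c2 s1 s2 t :
      eval e s1 <> Leaf -> exec c1 s1 s2 t -> exec (If e c1 c2) s1 s2 t.+1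
  | ExIfF e c1 c2 s1 s2 t :
      eval e s1 = Leaf -> exec c2 s1 s2 t -> exec (If e c1 c2) s1 s2 t.+1
  | ExWhileT e c s1 s2 s3 t1 t2 :
      eval e s1 <> Leaf -> exec c s1 s2 t1 -> exec (While e c) s2 s3 t2 ->
      exec (While e c) s1 s3 (t1 + t2).+1
  | ExWhileF e c s :
      eval e s = Leaf -> exec (While e c) s s 1.

(* Input and output are both held in variable 0. *)
Definition computes_in (p : cmd) (x y : tree) (t : nat) : Prop :=
  exists s : store, exec p (upd (fun=> Leaf) 0 x) s t /\ s 0 = y.

Definition enc_nat (n : nat) : tree := iter n (Node Leaf) Leaf.

Definition enc_bool (b : bool) : tree := enc_nat b.

Definition enc_seq (T : Type) (enc : T -> tree) (s : seq T) : tree :=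
  foldr (fun x r => Node (enc x) r) Leaf s.

Definition computable (f : nat -> nat) : Prop :=
  exists p : cmd, forall n,
  exists t, computes_in p (enc_nat n) (enc_nat (f n)) t.

(** * Parameterized problems and reductions *)

(* [inst] is the type of legal instances.  An algorithm only has to be correct
   on their encodings, so a problem with restricted inputs is a promise
   problem: legality of the input is not part of the question. *)
Record pproblem := PProblem {
  inst : Type;
  enc : inst -> tree;
  par : inst -> nat;
  yes : inst -> Prop
}.

Definition fpt_reducible (P Q : pproblem) : Prop :=
  exists (p : cmd) (f g : nat -> nat) (c : nat),
    [/\ computable f, computable g
      & forall x : inst P, exists (y : inst Q) (t : nat),
        [/\ computes_in p (enc x) (enc y) t,
            t <= f (par x) * tsize (enc x) ^ c,
            par y <= g (par x)
          & yes x <-> yes y]].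

(** * The class AW[*]

    AW[t] consists of the problems reducible to Parameterized QBFSAT_t, and
    AW[*] is the union of the AW[t]. *)

(* t levels of unbounded alternating conjunctions and disjunctions over
   literals; the literal [(b, x)] is [x] if [b] and its negation otherwise. *)
Fixpoint nform (X : Type) (t : nat) : Type :=
  if t is t'.+1 then seq (nform X t') else (bool * X)%type.

(* [conj] tells whether the outermost level is a conjunction; it is for
   t-normalized formulas.  [T] is the set of variables set to true. *)
Fixpoint nform_sat (X : finType) (T : {set X}) (conj : bool) (t : nat) :
    nform X t -> bool :=
  match t return nform X t -> bool with
  | 0 => fun F => (F.2 \in T) == F.1
  | t'.+1 => fun F =>
      if conj then all (@nform_sat X T false t') F
      else has (@nform_sat X T true t') F
  end.

Fixpoint enc_nform (X : Type) (encX : X -> tree) (t : nat) :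
    nform X t -> tree :=
  match t return nform X t -> tree with
  | 0 => fun F => Node (enc_bool F.1) (encX F.2)
  | t'.+1 => fun F => enc_seq (@enc_nform X encX t') F
  end.

(* [qblocks] lists the pairs (s_i, k_i). *)
Record qbf (t : nat) := QBF {
  qvars : nat;
  qblocks : seq ({set 'I_qvars} * nat);
  qmatrix : nform 'I_qvars t;
  qdisjoint :
    pairwise (fun A B : {set 'I_qvars} => [disjoint A & B]) (map fst qblocks);
  qcover : \bigcup_(A <- map fst qblocks) A = setT
}.

(* [T] collects the variables already set to true; [ex] tells whether the next
   quantifier is existential. *)
Fixpoint qblocks_sat (m : nat) (M : {set 'I_m} -> Prop) (ex : bool)
    (bs : seq ({set 'I_m} * nat)) (T : {set 'I_m}) : Prop :=
  match bs with
  | [::] => M T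
  | (s, k) :: bs' =>
      if ex then
        exists U : {set 'I_m},
          [/\ U \subset s, #|U| = k & qblocks_sat M false bs' (T :|: U)]
      else
        forall U : {set 'I_m},
          U \subset s -> #|U| = k -> qblocks_sat M true bs' (T :|: U)
  end.

Definition qbf_sat (t : nat) (I : qbf t) : Prop :=
  qblocks_sat (fun T => nform_sat T true (qmatrix I)) true (qblocks I) set0.

Definition enc_qbf (t : nat) (I : qbf t) : tree :=
  let encv := fun x : 'I_(qvars I) => enc_nat x in
  Node (enc_seq (fun a : {set 'I_(qvars I)} * nat =>
                   Node (enc_seq encv (enum a.1)) (enc_nat a.2))
                (qblocks I))
       (enc_nform encv (qmatrix I)).

(* The parameter (r, k_1, ..., k_r) as a single number. *)
Definition qbf_par (t : nat) (I : qbf t) : nat :=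
  size (qblocks I) + sumn (map snd (qblocks I)).

Definition QBFSAT (t : nat) : pproblem :=
  PProblem (@enc_qbf t) (@qbf_par t) (@qbf_sat t).

Definition in_AWstar (P : pproblem) : Prop :=
  exists t : nat, 0 < t /\ fpt_reducible P (QBFSAT t).

Definition AWstar_complete (P : pproblem) : Prop :=
  in_AWstar P /\ forall Q : pproblem, in_AWstar Q -> fpt_reducible Q P.

(** * Graphs *)

Record graph := Graph {
  order : nat;
  adj : rel 'I_order;
  adj_sym : symmetric adj;
  adj_irr : irreflexive adj
}.

(* Adjacency matrix, as a list of rows. *)
Definition enc_graph (G : graph) : tree :=
  enc_seq (fun x => enc_seq (fun y => enc_bool (adj x y))
                            (enum 'I_(order G)))
          (enum 'I_(order G)).

Definition isomorphic (G H : graph) : Prop :=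
  exists f : 'I_(order G) -> 'I_(order H),
    bijective f /\ forall x y, adj (f x) (f y) = adj x y.

(* [H] is isomorphic to an induced subgraph of [G]. *)
Definition induced_subgraph (H G : graph) : Prop :=
  exists f : 'I_(order H) -> 'I_(order G),
    injective f /\ forall x y, adj (f x) (f y) = adj x y.

Definition compl_adj (G : graph) : rel 'I_(order G) :=
  fun x y => (x != y) && ~~ adj x y.

Lemma compl_adj_sym (G : graph) : symmetric (@compl_adj G).
Proof. by move=> x y; rewrite /compl_adj eq_sym adj_sym. Qed.

Lemma compl_adj_irr (G : graph) : irreflexive (@compl_adj G).
Proof. by move=> x; rewrite /compl_adj eqxx. Qed.

Definition compl (G : graph) : graph :=
  Graph (@compl_adj_sym G) (@compl_adj_irr G).

(* The twin of [v] is [ord_max]; [dup_proj] sends it to [v] and is otherwise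
   the identity. *)
Definition dup_proj (G : graph) (v : 'I_(order G)) (x : 'I_(order G).+1) :
    'I_(order G) :=
  odflt v (unlift ord_max x).

Definition dup_adj (G : graph) (v : 'I_(order G)) : rel 'I_(order G).+1 :=
  fun x y => (x != y) &&
    ((dup_proj v x == dup_proj v y) || adj (dup_proj v x) (dup_proj v y)).

Lemma dup_adj_sym (G : graph) (v : 'I_(order G)) : symmetric (dup_adj v).
Proof.
by move=> x y; rewrite /dup_adj eq_sym [dup_proj _ _ == _]eq_sym adj_sym.
Qed.

Lemma dup_adj_irr (G : graph) (v : 'I_(order G)) : irreflexive (dup_adj v).
Proof. by move=> x; rewrite /dup_adj eqxx. Qed.

Definition duplicate (G : graph) (v : 'I_(order G)) : graph :=
  Graph (dup_adj_sym v) (dup_adj_irr v).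

Definition closed_isomorphism (C : graph -> Prop) : Prop :=
  forall G H, isomorphic G H -> C G -> C H.

Definition closed_induced_subgraph (C : graph -> Prop) : Prop :=
  forall G H, induced_subgraph H G -> C G -> C H.

Definition closed_duplication (C : graph -> Prop) : Prop :=
  forall G (v : 'I_(order G)), C G -> C (duplicate v).

Definition represents_consecutive (G : graph) (l : nat) : Prop :=
  exists (S : 'I_l -> 'I_(order G)) (R : {set 'I_(order G)}),
    [/\ injective S,
        forall i, S i \notin R
      & forall i j : 'I_l, i < j ->
        exists2 w, w \in R & forall k, adj w (S k) = (i <= k <= j)].

(* A single algorithm, given l in unary, outputs the graph of order l in time
   polynomial in l. *)
Definition consecutive_representation_property (C : graph -> Prop) : Prop :=
  exists (p : cmd) (c : nat), forall l : nat, 0 < l ->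
  exists (G : graph) (t : nat),
    [/\ C G,
        represents_consecutive G l \/ represents_consecutive (compl G) l,
        computes_in p (enc_nat l) (enc_graph G) t
      & t <= c * tsize (enc_nat l) ^ c].

(** * First-order logic of graphs *)

(* Formulas with free variables among n de Bruijn indices; a quantifier binds
   the index 0 of its body. *)
Inductive fo (n : nat) : Type :=
  | FEq of 'I_n & 'I_n
  | FAdj of 'I_n & 'I_n
  | FNot of fo n
  | FAnd of fo n & fo n
  | FOr of fo n & fo n
  | FEx of fo n.+1
  | FAll of fo n.+1.

Definition sentence := fo 0.

Definition env_cons (T : Type) (n : nat) (a : T) (e : 'I_n -> T)
    (i : 'I_n.+1) : T :=
  if unlift ord0 i is Some j then e j else a.

Definition env_nil (T : Type) (i : 'I_0) : T.
Proof. by case: i. Defined.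

Fixpoint fo_holds (G : graph) (n : nat) (phi : fo n) :
    ('I_n -> 'I_(order G)) -> Prop :=
  match phi with
  | FEq i j => fun e => e i = e j
  | FAdj i j => fun e => adj (e i) (e j)
  | FNot a => fun e => ~ fo_holds a e
  | FAnd a b => fun e => fo_holds a e /\ fo_holds b e
  | FOr a b => fun e => fo_holds a e \/ fo_holds b e
  | FEx a => fun e => exists v, fo_holds a (env_cons v e)
  | FAll a => fun e => forall v, fo_holds a (env_cons v e)
  end.

Definition models (G : graph) (phi : sentence) : Prop :=
  fo_holds phi (@env_nil 'I_(order G)).

(* Number of symbols. *)
Fixpoint fo_size (n : nat) (phi : fo n) : nat :=
  match phi with
  | FEq _ _ | FAdj _ _ => 3
  | FNot a => (fo_size a).+1
  | FAnd a b | FOr a b => (fo_size a + fo_size b).+1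
  | FEx a | FAll a => (fo_size a).+1
  end.

Fixpoint enc_fo (n : nat) (phi : fo n) : tree :=
  match phi with
  | FEq i j => Node (enc_nat 0) (Node (enc_nat i) (enc_nat j))
  | FAdj i j => Node (enc_nat 1) (Node (enc_nat i) (enc_nat j))
  | FNot a => Node (enc_nat 2) (enc_fo a)
  | FAnd a b => Node (enc_nat 3) (Node (enc_fo a) (enc_fo b))
  | FOr a b => Node (enc_nat 4) (Node (enc_fo a) (enc_fo b))
  | FEx a => Node (enc_nat 5) (enc_fo a)
  | FAll a => Node (enc_nat 6) (enc_fo a)
  end.

Definition FO_model_checking (C : graph -> Prop) : pproblem :=
  @PProblem ({G : graph | C G} * sentence)
    (fun x => Node (enc_graph (sval x.1)) (enc_fo x.2))
    (fun x => fo_size x.2)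
    (fun x => models (sval x.1) x.2).

(* Main.v *)
(* Membership in AW[*].  Every quantifier of a sentence becomes the choice of one
   out of n + 1 propositional variables, "the value is v" or "there is no value";
   the side that picks the last one loses.  A disjunction becomes an existential
   choice of one of its two sides, so the matrix is a conjunction over the atoms
   of the sentence, and the whole translation takes polynomial time.

   Hardness.  A hidden representation of consecutive neighbourhoods need not be
   found: by Ramsey's theorem for 4-sets, applied to the indices of the sequence,
   one of finitely many explicit patterns occurs, for every size, as an induced
   subgraph of a graph of the class.  It consists of two halves I and J of the
   sequence and one vertex W(a,b) for the interval from the a-th vertex of I to
   the b-th vertex of J.  Closing under twins, vertices are labelled by the size
   of their twin class, which first-order logic can read.  Labels on W(a,a) make
   these vertices the elements of a labelled digraph, and a special label on
   W(a,b) encodes an edge from a to b: it has the same neighbours in I as W(a,a)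
   and the same neighbours in J as W(b,b).  The digraph is the syntax tree of a
   quantified propositional formula together with its variables, and a sentence
   whose size depends only on the parameter quantifies over the variables of the
   blocks one at a time and then evaluates the matrix of fixed depth. *)

From Pilot Require Import Defs.
From mathcomp Require Import all_boot zify.
From Stdlib Require Import Classical ClassicalEpsilon.
Import Pilot.Defs.
Set Implicit Arguments.
Unset Strict Implicit.
Unset Printing Implicit Defensive.

(** * Typed polynomial-time functions *)

(** Colours of 4-sets suffice because two intervals have at most four ends, and the intervals kept
    all run from the left half into the right one: they meet, and only crossing, nesting and a
    common end on either side can occur. Twin classes can be counted only if distinct points of the
    pattern never become twins. This dictates the index ranges, an additional interval that sees one
    half of the sequence only, and multiplicity 3 instead of 0 for squares without an edge. The bits
    of the pattern are a constant of the reduction, so the blow-up is written down without its host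
    graph, and its membership in the class is a fact, not a computation. For membership in AW[*] the
    obstacle is prenexing: moves for one subformula precede those for another, so truth is stated
    relative to a continuation that depends on earlier variables only, and all ranges are kept
    nonempty, since a vacuous move must not decide the game. Running times are delicate because an
    iterated polynomial step may still explode, so each loop comes with a bound on its intermediate
    values. *)

Lemma tsize_gt0 x : 0 < tsize x. Proof. by case: x. Qed.

(** The base is at least 2, so one power of it absorbs constants, sums and products, and no leading
    coefficient is needed. *)
Definition pb X (eX : X -> tree) (q : X -> nat) : Prop :=
  exists c, forall x, q x <= (tsize (eX x)).+1 ^ c.

Section PolyBounds.
Variables (X : Type) (eX : X -> tree).
Implicit Types q : X -> nat.

Lemma pb_le q r : (forall x, q x <= r x) -> pb eX r -> pb eX q.
Proof. by move=> le_qr [c r_le]; exists c => x; apply: leq_trans (r_le x). Qed.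

Lemma pb_const n : pb eX (fun=> n).
Proof. by exists n => x; apply: ltnW; apply: ltn_expl; rewrite ltnS tsize_gt0. Qed.

Lemma pb_size : pb eX (fun x => tsize (eX x)).
Proof. by exists 1 => x; rewrite expn1. Qed.

Lemma pb_mul q r : pb eX q -> pb eX r -> pb eX (fun x => q x * r x).
Proof.
by move=> [a qa] [b rb]; exists (a + b) => x; rewrite expnD; apply: leq_mul.
Qed.

Lemma pb_add q r : pb eX q -> pb eX r -> pb eX (fun x => q x + r x).
Proof.
move=> pq pr; have p1 := pb_const 1.
(* Sums reduce to products, as [q + r] is at most [(q + 1) * (r + 1)]. *)
have [||c h] := pb_mul (q := fun x => (q x).+1) (r := fun x => (r x).+1).
- case: pq => a qa; exists a.+1 => x; rewrite expnS.
  have := qa x; have : 0 < (tsize (eX x)).+1 ^ a by rewrite expn_gt0.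
  have := tsize_gt0 (eX x); nia.
- case: pr => a qa; exists a.+1 => x; rewrite expnS.
  have := qa x; have : 0 < (tsize (eX x)).+1 ^ a by rewrite expn_gt0.
  have := tsize_gt0 (eX x); nia.
by exists c => x; apply: leq_trans (h x); nia.
Qed.

Lemma pb_S q : pb eX q -> pb eX (fun x => (q x).+1).
Proof. by move=> pq; apply: pb_le (pb_add pq (pb_const 1)) => x; rewrite addn1. Qed.

Lemma pb_exp q c : pb eX q -> pb eX (fun x => q x ^ c).
Proof.
move=> [a qa]; exists (a * c) => x; rewrite expnM.
by case: c => // c; rewrite leq_exp2r.
Qed.

End PolyBounds.

Lemma pb_comp X (eX : X -> tree) Y (eY : Y -> tree) (f : X -> Y) q :
  pb eX (fun x => tsize (eY (f x))) -> pb eY q -> pb eX (fun x => q (f x)).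
Proof.
move=> pf [c qc]; apply: pb_le (pb_exp c (pb_S pf)) => x; exact: qc.
Qed.

Ltac pb_tac :=
  repeat first [assumption | exact: pb_size | apply: pb_S | apply: pb_add
               | apply: pb_mul | exact: pb_const].

(** Writing a value costs at least its size, so bounds on time are also bounds on the size of the
    output. Composition of programs rests on this. *)
Lemma exec_size p s s' t : exec p s s' t ->
  forall y, tsize (s' y) <= maxn (tsize (s y)) t.
Proof.
elim=> {p s s' t} //=.
- by move=> x e s y; rewrite /upd; case: ifP => _; lia.
- by move=> c1 c2 s1 s2 s3 t1 t2 _ h1 _ h2 y; have := h1 y; have := h2 y; lia.
- by move=> e c1 c2 s1 s2 t _ _ h y; have := h y; lia.
- by move=> e c1 c2 s1 s2 t _ _ h y; have := h y; lia.
- by move=> e c s1 s2 s3 t1 t2 _ _ h1 _ h2 y; have := h1 y; have := h2 y; lia.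
- by move=> *; lia.
Qed.

(* [f] is computable in polynomial time on encodings.  The program must tolerate
   arbitrary contents of the variables other than 0 and leave those from [k] on
   unchanged, so that programs can be composed without clearing the store. *)
Definition pt X Y (eX : X -> tree) (eY : Y -> tree) (f : X -> Y) : Prop :=
  exists p k T, pb eX T /\ forall x s, s 0 = eX x ->
  exists s' t, [/\ exec p s s' t, s' 0 = eY (f x),
                   forall y, k <= y -> s' y = s y & t <= T x].

Definition eP A B (eA : A -> tree) (eB : B -> tree) (x : A * B) : tree :=
  Node (eA x.1) (eB x.2).
Notation eN := enc_nat.
Notation eB := enc_bool.
Notation eL := enc_seq.

Section Core.
Variables (X Y : Type) (eX : X -> tree) (eY : Y -> tree).

Lemma pt_pb (f : X -> Y) : pt eX eY f -> pb eX (fun x => tsize (eY (f x))).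
Proof.
move=> [p [k [T [pT h]]]]; apply: pb_le (pb_add (pb_size eX) pT) => x.
have [s' [t [ex s'0 _ tT]]] := h x (fun=> eX x) erefl.
by have := exec_size ex 0; rewrite s'0; lia.
Qed.

Lemma pt_ext (f g : X -> Y) : (forall x, f x = g x) -> pt eX eY f -> pt eX eY g.
Proof.
move=> fg [p [k [T [pT h]]]]; exists p, k, T; split=> // x s.
by rewrite -fg; apply: h.
Qed.

(** Programs see only encodings, so a program for plain lists serves any type whose encodings are
    the same trees. This is how types that carry proofs, such as graphs of a class, are reached. *)
Lemma pt_recode (X' Y' : Type) (eX' : X' -> tree) (eY' : Y' -> tree)
    (f : X -> Y) (f' : X' -> Y') (u : X' -> X) :
  (forall x, eX' x = eX (u x)) -> (forall x, eY' (f' x) = eY (f (u x))) ->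
  pt eX eY f -> pt eX' eY' f'.
Proof.
move=> hX hY [p [k [T [[c pT] h]]]]; exists p, k, (fun x => T (u x)); split.
  by exists c => x; rewrite hX.
by move=> x s; rewrite hX hY; apply: h.
Qed.

(** These expressions only descend into variable 0, so their value is a subtree of the input or
    [Leaf] and never larger than the input. *)
Fixpoint projection (e : expr) : bool :=
  match e with
  | EVar x => x == 0
  | EHd a | ETl a => projection a
  | _ => false
  end.

Lemma projection_size e s : projection e -> tsize (eval e s) <= tsize (s 0).
Proof.
elim: e => //= [x /eqP-> //|e IH /IH|e IH /IH]; case: (eval e s) => //= *; lia.
Qed.

Lemma pt_proj (e : expr) (f : X -> Y) : projection e ->
  (forall x s, s 0 = eX x -> eval e s = eY (f x)) -> pt eX eY f.
Proof.
move=> pe h; exists (Assign 0 e), 1, (fun x => (tsize (eX x)).+1).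
split; first exact: pb_S (pb_size _).
move=> x s s0; exists (upd s 0 (eval e s)), (tsize (eval e s)).+1; split.
- exact: ExAssign.
- by rewrite /upd /= (h x).
- by case.
- by have := projection_size s pe; rewrite s0.
Qed.

Lemma pt_const (y : Y) : pt eX eY (fun=> y).
Proof.
have [e he] : exists e, forall s, eval e s = eY y.
  elim: (eY y) => [|l [a ha] r [b hb]]; first by exists ENil.
  by exists (ECons a b) => s; rewrite /= ha hb.
exists (Assign 0 e), 1, (fun=> (tsize (eY y)).+1).
split; first exact: pb_const.
move=> x s s0; exists (upd s 0 (eval e s)), (tsize (eval e s)).+1; split.
- exact: ExAssign.
- by rewrite /upd /= he.
- by case.
- by rewrite he.
Qed.

End Core.

Section Pairing.
Variables (X Y Z : Type) (eX : X -> tree) (eY : Y -> tree) (eZ : Z -> tree).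

Lemma pt_comp (f : X -> Y) (g : Y -> Z) :
  pt eX eY f -> pt eY eZ g -> pt eX eZ (fun x => g (f x)).
Proof.
move=> pf [q [l [U [pU hg]]]]; have sf := pt_pb pf.
case: pf => [p [k [T [pT hf]]]].
exists (Seq p q), (maxn k l), (fun x => T x + U (f x)); split.
  by apply: pb_add => //; apply: pb_comp sf pU.
move=> x s s0; have [s1 [t1 [e1 v1 r1 b1]]] := hf x s s0.
have [s2 [t2 [e2 v2 r2 b2]]] := hg _ _ v1.
exists s2, (t1 + t2); split=> //; first exact: ExSeq e1 e2.
  by move=> y; rewrite geq_max => /andP[ky ly]; rewrite r2 // r1.
exact: leq_add.
Qed.


Lemma updE s x v y : upd s x v y = if y == x then v else s y. Proof. by []. Qed.

Lemma pt_pair (f : X -> Y) (g : X -> Z) :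
  pt eX eY f -> pt eX eZ g -> pt eX (eP eY eZ) (fun x => (f x, g x)).
Proof.
move=> pf pg; have sf := pt_pb pf; have sg := pt_pb pg.
case: pf => [p [k [T [pT hf]]]]; case: pg => [q [l [U [pU hg]]]].
(* Fresh for both programs: [m] keeps the input while the first one runs, [m.+1] its result while
   the second one runs. *)
pose m := (maxn k l).+1.
exists (Seq (Assign m (EVar 0)) (Seq p (Seq (Assign m.+1 (EVar 0))
  (Seq (Assign 0 (EVar m)) (Seq q (Assign 0 (ECons (EVar m.+1) (EVar 0)))))))).
exists m.+2.
exists (fun x => (tsize (eX x)).+1 + (T x + ((tsize (eY (f x))).+1 +
  ((tsize (eX x)).+1 + (U x +
     (tsize (eY (f x)) + tsize (eZ (g x))).+2))))).
split.
  by pb_tac.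
move=> x s s0.
have [|s1 [t1 [e1 v1 r1 b1]]] := hf x (upd s m (eX x)); first by rewrite updE.
have [|s2 [t2 [e2 v2 r2 b2]]] := hg x (upd (upd s1 m.+1 (s1 0)) 0 (eX x)).
  by rewrite updE.
have km : k <= m by rewrite /m; lia.
have lm : l <= m by rewrite /m; lia.
have s1m : s1 m = eX x by rewrite r1 // updE eqxx.
have s2m : s2 m.+1 = eY (f x).
  by rewrite r2 ?(leqW lm) // !updE eqxx v1.
do 2!eexists; split.
- apply: ExSeq (ExAssign _ _ _) _ => /=; rewrite s0.
  apply: ExSeq e1 _; apply: ExSeq (ExAssign _ _ _) _ => /=.
  apply: ExSeq (ExAssign _ _ _) _ => /=.
  rewrite updE ltn_eqF // s1m.
  by apply: ExSeq e2 (ExAssign _ _ _).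
- by rewrite updE /= s2m v2.
- move=> y my; rewrite updE; case: eqP => [y0|_]; first by rewrite y0 in my.
  rewrite r2 ?updE; last by lia.
  rewrite ifN_eq; last by lia.
  rewrite ifN_eq; last by lia.
  by rewrite r1 ?updE ?ifN_eq //; lia.
- move: b1 b2; rewrite /= v1 s2m v2 updE ltn_eqF // s1m s0; lia.
Qed.

End Pairing.

Section Branching.
Variables (X Y : Type) (eX : X -> tree) (eY : Y -> tree).

(* Each branch only has to be computed on the inputs that reach it. *)
Lemma pt_case (b : X -> bool) (f : X -> Y) :
  pt eX eB b ->
  pt (fun x : {x | b x} => eX (sval x)) eY (fun x => f (sval x)) ->
  pt (fun x : {x | ~~ b x} => eX (sval x)) eY (fun x => f (sval x)) ->
  pt eX eY f.
Proof.
move=> [pb [kb [Tb [pTb hb]]]] [p [k [T [[c pT] h]]]] [q [l [U [[d pU] g]]]].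
pose m := (maxn kb (maxn k l)).
exists (Seq (Assign m.+1 (EVar 0)) (Seq pb (If (EVar 0)
  (Seq (Assign 0 (EVar m.+1)) p) (Seq (Assign 0 (EVar m.+1)) q)))), m.+2.
exists (fun x => (tsize (eX x)).+1 + (Tb x + ((tsize (eX x)).+1 +
  ((tsize (eX x)).+1 ^ c + (tsize (eX x)).+1 ^ d)).+1)).
split.
  have := pb_exp c (pb_S (pb_size eX)); have := pb_exp d (pb_S (pb_size eX)).
  by move=> ? ?; pb_tac.
move=> x s s0.
have [|s1 [t1 [e1 v1 r1 b1]]] := hb x (upd s m.+1 (eX x)); first by rewrite updE.
have s1m : s1 m.+1 = eX x by rewrite r1 ?updE ?eqxx // /m; lia.
have frame s2 n : (forall y, n <= y -> s2 y = upd s1 0 (eX x) y) -> n <= m ->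
    forall y, m.+2 <= y -> s2 y = s y.
  move=> r2 nm y my; rewrite r2 ?updE; last by lia.
  rewrite ifN_eq; last by lia.
  by rewrite r1 ?updE ?ifN_eq //; move: my; rewrite /m; lia.
case bx: (b x).
- have [|s2 [t2 [e2 v2 r2 b2]]] := h (exist _ x bx) (upd s1 0 (eX x)).
    by rewrite updE.
  exists s2; eexists; split.
  + apply: ExSeq (ExAssign _ _ _) _ => /=; rewrite s0.
    apply: ExSeq e1 _; apply: ExIfT => /=; first by rewrite v1 bx.
    by apply: ExSeq (ExAssign _ _ _) _; rewrite /= s1m; apply: e2.
  + exact: v2.
  + by apply: frame r2 _; rewrite /m; lia.
  + move: b1 b2 (pT (exist _ x bx)); rewrite /= s1m s0 /=; lia.
- have nbx : ~~ b x by rewrite bx.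
  have [|s2 [t2 [e2 v2 r2 b2]]] := g (exist _ x nbx) (upd s1 0 (eX x)).
    by rewrite updE.
  exists s2; eexists; split.
  + apply: ExSeq (ExAssign _ _ _) _ => /=; rewrite s0.
    apply: ExSeq e1 _; apply: ExIfF => /=; first by rewrite v1 bx.
    by apply: ExSeq (ExAssign _ _ _) _; rewrite /= s1m; apply: e2.
  + exact: v2.
  + by apply: frame r2 _; rewrite /m; lia.
  + move: b1 b2 (pU (exist _ x nbx)); rewrite /= s1m s0 /=; lia.
Qed.

Lemma pt_restrict (P : X -> bool) (f : X -> Y) :
  pt eX eY f -> pt (fun x : {x | P x} => eX (sval x)) eY (fun x => f (sval x)).
Proof. by apply: pt_recode. Qed.

Lemma pt_if (b : X -> bool) (f g : X -> Y) :
  pt eX eB b -> pt eX eY f -> pt eX eY g ->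
  pt eX eY (fun x => if b x then f x else g x).
Proof.
move=> hb hf hg; apply: (pt_case hb).
- by apply: pt_ext (pt_restrict _ hf) => -[x /= ->].
- by apply: pt_ext (pt_restrict _ hg) => -[x /= /negbTE ->].
Qed.

End Branching.

(** Turns a bound in the size of intermediate values into one in the size of the input, provided
    that [S] bounds these values. *)
Lemma pb_index X (eX : X -> tree) Z (eZ : Z -> tree) (q : Z -> nat)
    (S : X -> nat) : pb eX S -> pb eZ q ->
  exists2 Q, pb eX Q & forall x z, tsize (eZ z) <= S x -> q z <= Q x.
Proof.
move=> pS [c qc]; exists (fun x => (S x).+1 ^ c); first exact: pb_exp (pb_S pS).
move=> x z zS; apply: leq_trans (qc z) _.
by case: c {qc} => // c; rewrite leq_exp2r.
Qed.

(** * Loops with bounded intermediate values *)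

Section While.
Variables (X Z : Type) (eX : X -> tree) (eZ : Z -> tree).

(** Polynomially many polynomial steps need not take polynomial time, as the state may grow at every
    step; hence the separate bound [S] on the iterates. The number [m] is the exact stopping time,
    because the loop ends at the first state that fails [go]. *)
Lemma pt_while (go : Z -> bool) (step : Z -> Z) (init f : X -> Z)
    (n S : X -> nat) :
  pt eZ eB go -> pt eZ eZ step -> pt eX eZ init ->
  pb eX n -> pb eX S ->
  (forall x i, i <= n x -> tsize (eZ (iter i step (init x))) <= S x) ->
  (forall x, exists2 m, m <= n x & f x = iter m step (init x) /\
     ~~ go (iter m step (init x)) /\ forall i, i < m -> go (iter i step (init x))) ->
  pt eX eZ f.
Proof.
move=> [pg [kg [Tg [pTg hg]]]] [p [k [T [pT h]]]].
move=> [q [l [U [pU hi]]]] pn pS leS hf.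
pose m := (maxn kg (maxn k l)).+1.
(* The state lives in [m]; variable 0 alternates between the state, as input of a program, and the
   value of the test. *)
pose body := Seq (Assign 0 (EVar m)) (Seq p (Seq (Assign m (EVar 0)) pg)).
have [QT pQT hQT] := pb_index pS pT.
have [QG pQG hQG] := pb_index pS pTg.
pose B x := (S x).+1 + (QT x + ((S x).+1 + QG x)).
exists (Seq q (Seq (Assign m (EVar 0)) (Seq pg
   (Seq (While (EVar 0) body) (Assign 0 (EVar m)))))), m.+1.
exists (fun x => U x + ((S x).+1 + (QG x + (n x * (B x).+1 + 1 + (S x).+1)))).
split; first by rewrite /B; pb_tac.
have loop x N : forall z s, s m = eZ z -> s 0 = eB (go z) ->
    (forall i, i <= N -> tsize (eZ (iter i step z)) <= S x) ->
    ~~ go (iter N step z) -> (forall i, i < N -> go (iter i step z)) ->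
    exists s' t, [/\ exec (While (EVar 0) body) s s' t,
      s' m = eZ (iter N step z), forall y, m < y -> s' y = s y
      & t <= N * (B x).+1 + 1].
  elim: N => [|N IH] z s sm s0 sz nog gos.
    exists s, 1; split=> //; apply: ExWhileF => /=.
    by rewrite s0; case: (go z) nog.
  have gz : go z by apply: (gos 0).
  have [|s1 [t1 [e1 v1 r1 b1]]] := h z (upd s 0 (eZ z)); first by rewrite updE.
  have [|s2 [t2 [e2 v2 r2 b2]]] := hg (step z) (upd s1 m (eZ (step z))).
    by rewrite updE.
  have s2m : s2 m = eZ (step z) by rewrite r2 ?updE ?eqxx // /m; lia.
  have [|||s3 [t3 [e3 v3 r3 b3]]] := IH (step z) s2 s2m v2.
  - by move=> i iN; rewrite -iterSr; apply: sz.
  - by rewrite -iterSr.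
  - by move=> i iN; rewrite -iterSr; apply: gos.
  exists s3; eexists; split.
  + apply: ExWhileT e3; first by rewrite /= s0 gz.
    apply: ExSeq (ExAssign _ _ _) _; rewrite /= sm.
    apply: ExSeq e1 _; apply: ExSeq (ExAssign _ _ _) _; rewrite /= v1.
    exact: e2.
  + by rewrite v3 iterSr.
  + move=> y my; rewrite r3 // r2 ?updE; last by move: my; rewrite /m; lia.
    rewrite ifN_eq; last by lia.
    by rewrite r1 ?updE ?ifN_eq //; move: my; rewrite /m; lia.
  + have S0 := sz 0 isT; have S1 := sz 1 isT.
    have := hQT x z S0; have := hQG x _ S1; rewrite /= in S0 S1 *.
    move: b1 b2 b3; rewrite /= /B sm v1; lia.
move=> x s s0; have [N Nn [-> [nog gos]]] := hf x.
have [s1 [t1 [e1 v1 r1 b1]]] := hi x s s0.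
have [|s2 [t2 [e2 v2 r2 b2]]] := hg (init x) (upd s1 m (eZ (init x))).
  by rewrite updE.
have s2m : s2 m = eZ (init x) by rewrite r2 ?updE ?eqxx // /m; lia.
have [i iN||| s3 [t3 [e3 v3 r3 b3]]] := loop x N _ _ s2m v2 => //.
  by apply: leS; apply: leq_trans Nn.
exists (upd s3 0 (s3 m)); eexists; split.
- apply: ExSeq e1 _; apply: ExSeq (ExAssign _ _ _) _; rewrite /= v1.
  by apply: ExSeq e2 _; apply: ExSeq e3 (ExAssign _ _ _).
- by rewrite updE eqxx v3.
- move=> y my; rewrite updE ifN_eq; last by lia.
  rewrite r3 // r2 ?updE; last by move: my; rewrite /m; lia.
  rewrite ifN_eq; last by lia.
  by rewrite r1 //; move: my; rewrite /m; lia.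
- have S0 := leS x 0 isT; have SN := leS x N Nn.
  have := hQG x _ S0; rewrite /= in S0 *.
  have : N * (B x).+1 <= n x * (B x).+1 by apply: leq_mul.
  move: b1 b2 b3; rewrite /= v1 v3; lia.
Qed.

End While.

Section Basic.
Variables (X A B : Type) (eX : X -> tree) (eA : A -> tree) (eY : B -> tree).

Lemma pt_id : pt eX eX id.
Proof. by apply: (@pt_proj _ _ _ _ (EVar 0)). Qed.

Lemma pt_fst (f : X -> A * B) :
  pt eX (eP eA eY) f -> pt eX eA (fun x => (f x).1).
Proof.
move=> pf; apply: (pt_comp pf); apply: (@pt_proj _ _ _ _ (EHd (EVar 0))) => //.
by move=> x s /= ->.
Qed.

Lemma pt_snd (f : X -> A * B) :
  pt eX (eP eA eY) f -> pt eX eY (fun x => (f x).2).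
Proof.
move=> pf; apply: (pt_comp pf); apply: (@pt_proj _ _ _ _ (ETl (EVar 0))) => //.
by move=> x s /= ->.
Qed.

Lemma pt_cons (f : X -> A) (g : X -> seq A) :
  pt eX eA f -> pt eX (eL eA) g -> pt eX (eL eA) (fun x => f x :: g x).
Proof. by move=> pf pg; apply: (pt_recode (u := id) _ _ (pt_pair pf pg)). Qed.

Lemma pt_succ (f : X -> nat) : pt eX eN f -> pt eX eN (fun x => (f x).+1).
Proof.
(* [enc_nat n.+1] is the tree that encodes the pair [(false, n)]. *)
move=> pf; pose g x := (false, f x).
have : pt eX (eP eB eN) g by apply: pt_pair => //; apply: pt_const.
by apply: (pt_recode (u := id)).
Qed.

Lemma pt_pred (f : X -> nat) : pt eX eN f -> pt eX eN (fun x => (f x).-1).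
Proof.
move=> pf; apply: (pt_comp pf); apply: (@pt_proj _ _ _ _ (ETl (EVar 0))) => //.
by move=> [|n] s /= ->.
Qed.

Lemma pt_behead (f : X -> seq A) :
  pt eX (eL eA) f -> pt eX (eL eA) (fun x => behead (f x)).
Proof.
move=> pf; apply: (pt_comp pf); apply: (@pt_proj _ _ _ _ (ETl (EVar 0))) => //.
by move=> [|n l] s /= ->.
Qed.

End Basic.

Lemma pt_idE X (eX : X -> tree) : pt eX eX (fun x => x).
Proof. exact: pt_id. Qed.

Ltac pt_var := first
  [simple eapply pt_idE | simple eapply pt_fst; pt_var | simple eapply pt_snd; pt_var].

Section Tests.
Variables (X A : Type) (eX : X -> tree) (eA : A -> tree).

Lemma pt_nonleaf (f : X -> tree) :
  pt eX id f -> pt eX eB (fun x => if f x is Leaf then false else true).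
Proof.
move=> [p [k [T [pT h]]]].
exists (Seq p (If (EVar 0) (Assign 0 (ECons ENil ENil)) (Assign 0 ENil))).
exists k.+1, (fun x => T x + 6); split; first by pb_tac.
move=> x s s0; have [s1 [t1 [e1 v1 r1 b1]]] := h x s s0.
case fx: (f x) => [|l r].
- exists (upd s1 0 Leaf); eexists; split.
  + by apply: ExSeq e1 (ExIfF _ _ (ExAssign _ _ _)); rewrite /= v1 fx.
  + by [].
  + by move=> [//|y] ky; rewrite updE /= r1 //; apply: ltnW.
  + by rewrite /=; lia.
- exists (upd s1 0 (Node Leaf Leaf)); eexists; split.
  + by apply: ExSeq e1 (ExIfT _ _ (ExAssign _ _ _)); rewrite /= v1 fx.
  + by [].
  + by move=> [//|y] ky; rewrite updE /= r1 //; apply: ltnW.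
  + by rewrite /=; lia.
Qed.

Lemma pt_nilp (f : X -> seq A) : pt eX (eL eA) f -> pt eX eB (fun x => nilp (f x)).
Proof.
move=> pf.
have h : pt eX eB (fun x => if eL eA (f x) is Leaf then false else true).
  by apply: pt_nonleaf; apply: (pt_recode (u := id) _ _ pf).
apply: pt_ext (pt_if h (pt_const _ _ false) (pt_const _ _ true)) => x /=.
by case: (f x).
Qed.

Lemma pt_neg (f : X -> bool) : pt eX eB f -> pt eX eB (fun x => ~~ f x).
Proof.
move=> h; apply: pt_ext (pt_if h (pt_const _ _ false) (pt_const _ _ true)) => x.
by case: (f x).
Qed.

Lemma pt_and (f g : X -> bool) :
  pt eX eB f -> pt eX eB g -> pt eX eB (fun x => f x && g x).
Proof.
move=> h h'; apply: pt_ext (pt_if h h' (pt_const _ _ false)) => x.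
by case: (f x).
Qed.

Lemma pt_or (f g : X -> bool) :
  pt eX eB f -> pt eX eB g -> pt eX eB (fun x => f x || g x).
Proof.
move=> h h'; apply: pt_ext (pt_if h (pt_const _ _ true) h') => x.
by case: (f x).
Qed.

Lemma pt_xor (f g : X -> bool) :
  pt eX eB f -> pt eX eB g -> pt eX eB (fun x => f x (+) g x).
Proof.
move=> h h'; apply: pt_ext (pt_if h (pt_neg h') h') => x.
by case: (f x).
Qed.

Lemma pt_eqb (f g : X -> bool) :
  pt eX eB f -> pt eX eB g -> pt eX eB (fun x => f x == g x).
Proof.
move=> h h'; apply: pt_ext (pt_if h h' (pt_neg h')) => x.
by case: (f x); case: (g x).
Qed.

Lemma pt_eqn0 (f : X -> nat) : pt eX eN f -> pt eX eB (fun x => f x == 0).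
Proof.
move=> pf.
have h : pt eX eB (fun x => if eN (f x) is Leaf then false else true).
  by apply: pt_nonleaf; apply: (pt_recode (u := id) _ _ pf).
by apply: pt_ext (pt_neg h) => x; case: (f x).
Qed.

End Tests.

(** * Folds over lists *)

Section Fold.
Variables (X A B : Type) (eX : X -> tree) (eA : A -> tree) (eY : B -> tree).

Lemma enc_seq_size (s : seq A) : size s < tsize (eL eA s).
Proof. by elim: s => //= a s IH; have := tsize_gt0 (eA a); lia. Qed.

Lemma enc_seq_drop i (s : seq A) : tsize (eL eA (drop i s)) <= tsize (eL eA s).
Proof. by elim: s i => [|a s IH] [|i] //=; have := IH i; lia. Qed.

Lemma pt_foldl (l : X -> seq A) (z : X -> B) (g : X -> B -> A -> B)
    (S : X -> nat) :
  pt eX (eL eA) l -> pt eX eY z ->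
  pt (eP (eP eX eY) eA) eY (fun p => g p.1.1 p.1.2 p.2) ->
  pb eX S ->
  (forall x i, tsize (eY (foldl (g x) (z x) (take i (l x)))) <= S x) ->
  pt eX eY (fun x => foldl (g x) (z x) (l x)).
Proof.
move=> pl pz pg pS leS.
(* Taking the head of a list needs a default value; if [A] is empty, so is the list. *)
have [[a0]|noA] := classic (inhabited A); last first.
  by apply: pt_ext pz => x; case: (l x) => // a; case: noA.
pose eZ := eP eX (eP (eL eA) eY).
pose go (q : X * (seq A * B)) := ~~ nilp q.2.1.
pose step (q : X * (seq A * B)) :=
  if go q then (q.1, (behead q.2.1, g q.1 q.2.2 (head a0 q.2.1))) else q.
have pgo : pt eZ eB go.
  by apply/pt_neg/pt_nilp/pt_fst/pt_snd/pt_id.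
have pstep : pt eZ eZ step.
  apply: (pt_case pgo); last first.
    apply: pt_ext (pt_restrict _ (@pt_id _ _)) => -[q /= /negbTE].
    by rewrite /step => ->.
  pose f (q : {x | go x}) := ((sval q).1,
    (behead (sval q).2.1, g (sval q).1 (sval q).2.2 (head a0 (sval q).2.1))).
  apply: (@pt_ext _ _ _ _ f) => [[q /=]|]; first by rewrite /step /f /= => ->.
  have pq := pt_restrict go (@pt_id _ eZ).
  apply: pt_pair (pt_fst pq) _; apply: pt_pair.
    exact: pt_behead (pt_fst (pt_snd pq)).
  have ph : pt (fun q : {x | go x} => eZ (sval q)) (eP (eP eX eY) eA)
      (fun q => ((sval q).1, (sval q).2.2, head a0 (sval q).2.1)).
    apply: pt_pair; first exact: pt_pair (pt_fst pq) (pt_snd (pt_snd pq)).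
    apply: (@pt_proj _ _ _ _ (EHd (EHd (ETl (EVar 0))))) => // -[q goq] s /= ->.
    by case: q goq => ? [[|a s'] b].
  exact: pt_comp ph pg.
pose init x := (x, (l x, z x)).
have pinit : pt eX eZ init by apply: pt_pair (@pt_id _ _) (pt_pair pl pz).
have itE x i : i <= size (l x) -> iter i step (init x) =
    (x, (drop i (l x), foldl (g x) (z x) (take i (l x)))).
  elim: i => [|i IH] il; first by rewrite /= drop0 take0.
  rewrite iterS IH ?(ltnW il) // /step /go /= /nilp size_drop subn_eq0 -ltnNge il.
  rewrite (take_nth a0 il) foldl_rcons -nth0 nth_drop addn0.
  by rewrite -drop1 drop_drop add1n.
have sl := pt_pb pl.
have whole : pt eX eZ (fun x => (x, ([::], foldl (g x) (z x) (l x)))).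
  apply: (@pt_while _ _ _ _ go step init _ (fun x => size (l x))
    (fun x => (tsize (eX x) + (tsize (eL eA (l x)) + S x).+1).+1)) => //.
  - by apply: pb_le sl => x; apply: ltnW (enc_seq_size _).
  - by pb_tac.
  - move=> x i il; rewrite itE //=; have := leS x i.
    by have := enc_seq_drop i (l x); lia.
  - move=> x; exists (size (l x)) => //; rewrite itE // drop_size take_size.
    by split=> //; split=> // i il; rewrite itE ?(ltnW il) // /go /= /nilp size_drop; lia.
exact: pt_snd (pt_snd whole).
Qed.

End Fold.

Lemma enc_seq_cat A (eA : A -> tree) (s t : seq A) :
  tsize (eL eA (s ++ t)) = (tsize (eL eA s)).-1 + tsize (eL eA t).
Proof. by elim: s => //= a s ->; have := tsize_gt0 (eL eA s); lia. Qed.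

Lemma enc_seq_rev A (eA : A -> tree) (s : seq A) : tsize (eL eA (rev s)) = tsize
    (eL eA s).
Proof.
elim: s => // a s IH; rewrite rev_cons -cats1 enc_seq_cat IH /=.
by have := tsize_gt0 (eL eA s); lia.
Qed.

Lemma enc_seq_take A (eA : A -> tree) i (s : seq A) : tsize
    (eL eA (take i s)) <= tsize (eL eA s).
Proof.
rewrite -{2}(cat_take_drop i s) enc_seq_cat.
by have := tsize_gt0 (eL eA (drop i s)); lia.
Qed.

Lemma pt_rev X A (eX : X -> tree) (eA : A -> tree) (f : X -> seq A) :
  pt eX (eL eA) f -> pt eX (eL eA) (fun x => rev (f x)).
Proof.
move=> pf.
have E s (t : seq A) : foldl (fun acc a => a :: acc) s t = catrev t s.
  by elim: t s => //= a t IH s; rewrite IH.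
have : pt eX (eL eA) (fun x => foldl (fun acc a => a :: acc) [::] (f x)).
  apply: (pt_foldl (g := fun _ acc a => a :: acc)
    (S := fun x => tsize (eL eA (f x))) pf (pt_const _ _ [::])).
  - by apply: pt_cons; pt_var.
  - exact: pt_pb.
  - by move=> x i; rewrite E -/(rev _) enc_seq_rev enc_seq_take.
by apply: pt_ext => x; rewrite E.
Qed.

(** Each step adds an amount that depends on the input and the list element but not on the
    accumulator, so the growth sums up to a polynomial. A bound relative to the accumulator would
    allow doubling at every step. *)
Lemma pt_foldr X A B (eX : X -> tree) (eA : A -> tree) (eY : B -> tree)
    (l : X -> seq A) (z : X -> B) (g : X -> A -> B -> B)
    (q : X * A -> nat) :
  pt eX (eL eA) l -> pt eX eY z ->
  pt (eP (eP eX eY) eA) eY (fun p => g p.1.1 p.2 p.1.2) ->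
  pb (eP eX eA) q ->
  (forall x a b, tsize (eY (g x a b)) <= tsize (eY b) + q (x, a)) ->
  pt eX eY (fun x => foldr (g x) (z x) (l x)).
Proof.
move=> pl pz pg pq gq.
have plr := pt_rev pl; have sl := pt_pb pl; have sz := pt_pb pz.
have ps := pb_add (pb_size eX) (pb_S sl).
have [Q pQ hQ] := pb_index ps pq.
have : pt eX eY (fun x => foldl (fun b a => g x a b) (z x) (rev (l x))).
  apply: (pt_foldl (g := fun x b a => g x a b)
    (S := fun x => tsize (eY (z x)) + tsize (eL eA (l x)) * Q x) plr pz pg).
  - by pb_tac.
  - move=> x i; set s := take i _.
    have bs : tsize (eL eA s) <= tsize (eL eA (l x)).
      by rewrite -(enc_seq_rev eA (l x)) enc_seq_take.
    have : size s <= tsize (eL eA (l x)).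
      by apply: leq_trans bs; apply: ltnW (enc_seq_size _ _).
    suff: tsize (eY (foldl (fun b a => g x a b) (z x) s)) <=
          tsize (eY (z x)) + size s * Q x by nia.
    elim: s (z x) bs => [|a s IH] b /= bs; first by lia.
    have := IH (g x a b); have := gq x a b; have := hQ x (x, a).
    by rewrite /eP /=; lia.
by apply: pt_ext => x; rewrite foldl_rev.
Qed.

Lemma pt_map X A B (eX : X -> tree) (eA : A -> tree) (eY : B -> tree)
    (l : X -> seq A) (g : X -> A -> B) :
  pt eX (eL eA) l -> pt (eP eX eA) eY (fun p => g p.1 p.2) ->
  pt eX (eL eY) (fun x => [seq g x a | a <- l x]).
Proof.
move=> pl pg.
have : pt eX (eL eY) (fun x => foldr (fun a s => g x a :: s) [::] (l x)).
  apply: (pt_foldr (g := fun x a s => g x a :: s)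
     (q := fun p => (tsize (eY (g p.1 p.2))).+1) pl (pt_const _ _ [::])).
  - apply: pt_cons; last pt_var.
    by apply: (pt_comp (f := fun p => (p.1.1, p.2)) _ pg); apply: pt_pair; pt_var.
  - exact: pb_S (pt_pb pg).
  - by move=> x a b /=; lia.
by apply: pt_ext => x; elim: (l x) => //= a s ->.
Qed.

Lemma pt_cat X A (eX : X -> tree) (eA : A -> tree) (f g : X -> seq A) :
  pt eX (eL eA) f -> pt eX (eL eA) g -> pt eX (eL eA) (fun x => f x ++ g x).
Proof.
move=> pf pg.
suff: pt eX (eL eA) (fun x => foldr cons (g x) (f x)).
  by apply: pt_ext => x; elim: (f x) => //= a s ->.
apply: (pt_foldr (g := fun _ => cons) (q := fun p => (tsize (eA p.2)).+1) pf pg).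
- by apply: pt_cons; pt_var.
- by apply/pb_S/pt_pb; pt_var.
- by move=> x a b /=; lia.
Qed.

Lemma pt_size X A (eX : X -> tree) (eA : A -> tree) (f : X -> seq A) :
  pt eX (eL eA) f -> pt eX eN (fun x => size (f x)).
Proof.
move=> pf.
have : pt eX eN (fun x => foldr (fun (_ : A) n => n.+1) 0 (f x)).
  apply: (pt_foldr (g := fun _ _ n => n.+1) (q := fun=> 2) pf (pt_const _ _ 0)).
  - by apply: pt_succ; pt_var.
  - exact: pb_const.
  - by move=> x a b /=; lia.
by apply: pt_ext => x; elim: (f x) => //= a s ->.
Qed.

Lemma pt_head X A (eX : X -> tree) (eA : A -> tree) (d : A) (f : X -> seq A) :
  pt eX (eL eA) f -> pt eX eA (fun x => head d (f x)).
Proof.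
move=> pf; apply: (pt_case (pt_nilp pf)).
  apply: pt_ext (pt_const _ _ d) => -[x /=].
  by case: (f x).
have pf' : pt (fun x : {x | ~~ nilp (f x)} => eX (sval x))
    (fun x : {x | ~~ nilp (f x)} => eL eA (f (sval x))) (fun x => x).
  by apply: (pt_recode (u := id) _ _ (pt_restrict (fun x => ~~ nilp (f x)) pf)).
apply: (pt_comp (g := fun x => head d (f (sval x))) pf').
apply: (@pt_proj _ _ _ _ (EHd (EVar 0))) => //.
move=> [x nfx] s /= ->.
by case: (f x) nfx.
Qed.

Lemma pt_all X A (eX : X -> tree) (eA : A -> tree) (l : X -> seq A) (g : X -> A -> bool) :
  pt eX (eL eA) l -> pt (eP eX eA) eB (fun p => g p.1 p.2) ->
  pt eX eB (fun x => all (g x) (l x)).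
Proof.
move=> pl pg.
suff: pt eX eB (fun x => foldr (fun a b => g x a && b) true (l x)).
  by apply: pt_ext => x; elim: (l x) => //= a s ->.
apply: (pt_foldr (z := fun=> true) (g := fun x a b => g x a && b)
     (q := fun=> 2) pl (pt_const _ _ true)).
- apply: pt_and; last pt_var.
  by apply: (pt_comp (f := fun p => (p.1.1, p.2)) _ pg); apply: pt_pair; pt_var.
- exact: pb_const.
- by move=> x a b /=; case: (g x a); case: b.
Qed.

Lemma pt_flatten X A (eX : X -> tree) (eA : A -> tree) (f : X -> seq (seq A)) :
  pt eX (eL (eL eA)) f -> pt eX (eL eA) (fun x => flatten (f x)).
Proof.
move=> pf; apply: (pt_foldr (g := fun _ => cat)
  (q := fun p => tsize (eL eA p.2)) pf (pt_const _ _ [::])).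
- by apply: pt_cat; pt_var.
- by apply: pt_pb; pt_var.
- by move=> x a b /=; rewrite enc_seq_cat; lia.
Qed.

(** * Unary arithmetic: numbers as lists of units *)

Lemma enc_nat_unary n : eN n = eL (fun _ : unit => Leaf) (nseq n tt).
Proof. by elim: n => //= n ->. Qed.

Lemma tsize_nat n : tsize (eN n) = n.*2.+1.
Proof. by elim: n => //= n ->; lia. Qed.

Lemma pt_units X (eX : X -> tree) (f : X -> nat) :
  pt eX eN f -> pt eX (eL (fun _ : unit => Leaf)) (fun x => nseq (f x) tt).
Proof. by apply: (pt_recode (u := id)) => // x; rewrite enc_nat_unary. Qed.

Lemma pt_iter X B (eX : X -> tree) (eY : B -> tree) (n : X -> nat) (z : X -> B)
    (g : X -> B -> B) (q : X -> nat) :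
  pt eX eN n -> pt eX eY z ->
  pt (eP eX eY) eY (fun p => g p.1 p.2) ->
  pb eX q ->
  (forall x b, tsize (eY (g x b)) <= tsize (eY b) + q x) ->
  pt eX eY (fun x => iter (n x) (g x) (z x)).
Proof.
move=> pn pz pg pq gq.
have E (h : B -> B) z0 k : foldr (fun _ : unit => h) z0 (nseq k tt) = iter k h z0.
  by elim: k => //= k ->.
have : pt eX eY (fun x => foldr (fun _ : unit => g x) (z x) (nseq (n x) tt)).
  apply: (pt_foldr (g := fun x _ => g x) (q := fun p => q p.1) (pt_units pn) pz) => //.
  - by apply: (pt_comp _ pg); pt_var.
  - by apply: pb_comp pq; apply: pt_pb (pt_fst (@pt_id _ (eP _ _))).
by apply: pt_ext => x; rewrite E.
Qed.

Lemma pt_addn X (eX : X -> tree) (f g : X -> nat) :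
  pt eX eN f -> pt eX eN g -> pt eX eN (fun x => f x + g x).
Proof.
move=> pf pg.
have : pt eX eN (fun x => iter (f x) succn (g x)).
  apply: (pt_iter (g := fun=> succn) (q := fun=> 2) pf pg).
  - by apply: pt_succ; pt_var.
  - exact: pb_const.
  - by move=> x b /=; lia.
by apply: pt_ext => x; rewrite iter_succn addnC.
Qed.

Lemma pt_muln X (eX : X -> tree) (f g : X -> nat) :
  pt eX eN f -> pt eX eN g -> pt eX eN (fun x => f x * g x).
Proof.
move=> pf pg.
have : pt eX eN (fun x => iter (f x) (addn (g x)) 0).
  apply: (pt_iter (g := fun x => addn (g x)) (q := fun x => tsize (eN (g x))) pf (pt_const _ _ 0)).
  - apply: pt_addn; last pt_var.
    by apply: (pt_comp _ pg); pt_var.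
  - exact: pt_pb.
  - by move=> x b; rewrite !tsize_nat; lia.
by apply: pt_ext => x; rewrite iter_addn_0 mulnC.
Qed.

Lemma pt_exp X (eX : X -> tree) (f : X -> nat) c : pt eX eN f -> pt eX eN
    (fun x => f x ^ c).
Proof.
move=> pf; elim: c => [|c IH]; first exact: pt_const.
by apply: pt_ext (pt_muln pf IH) => x; rewrite expnS.
Qed.

Lemma pt_subn X (eX : X -> tree) (f g : X -> nat) :
  pt eX eN f -> pt eX eN g -> pt eX eN (fun x => f x - g x).
Proof.
move=> pf pg.
have : pt eX eN (fun x => iter (g x) predn (f x)).
  apply: (pt_iter (g := fun=> predn) (q := fun=> 2) pg pf).
  - by apply: pt_pred; pt_var.
  - exact: pb_const.
  - by move=> x b /=; rewrite !tsize_nat; lia.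
by apply: pt_ext => x; rewrite iter_predn.
Qed.

Lemma pt_leq X (eX : X -> tree) (f g : X -> nat) :
  pt eX eN f -> pt eX eN g -> pt eX eB (fun x => f x <= g x).
Proof. by move=> pf pg; apply: pt_eqn0 (pt_subn pf pg). Qed.

Lemma pt_eqn X (eX : X -> tree) (f g : X -> nat) :
  pt eX eN f -> pt eX eN g -> pt eX eB (fun x => f x == g x).
Proof.
move=> pf pg; apply: pt_ext (pt_and (pt_leq pf pg) (pt_leq pg pf)) => x.
by rewrite eqn_leq.
Qed.

Lemma pt_iota X (eX : X -> tree) (f g : X -> nat) :
  pt eX eN f -> pt eX eN g -> pt eX (eL eN) (fun x => iota (f x) (g x)).
Proof.
move=> pf pg.
have E m n : iota m n = foldl (fun s (_ : unit) => m :: map succn s) [::] (nseq n tt).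
  have nseqS k : nseq k.+1 tt = rcons (nseq k tt) tt by elim: k => //= k <-.
  elim: n => // n IH; rewrite nseqS foldl_rcons -IH /= -[m.+1]addn1 [m + 1]addnC.
  by rewrite iotaDl; congr (_ :: _); apply: eq_map.
have sf := pt_pb pf; have sg := pt_pb pg.
have : pt eX (eL eN) (fun x => foldl (fun s (_ : unit) => f x :: map succn s)
          [::] (nseq (g x) tt)).
  apply: (pt_foldl (g := fun x s _ => f x :: map succn s)
   (S := fun x => (tsize (eN (g x)) * (tsize (eN (f x)) + tsize (eN (g x))).+2).+1)
   (pt_units pg) (pt_const _ _ [::])).
  - have h := @pt_id _ (eP (eP eX (eL eN)) (fun _ : unit => Leaf)).
    apply: pt_cons (pt_comp (pt_fst (pt_fst h)) pf) _.
    apply: pt_map (pt_snd (pt_fst h)) _.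
    by apply: pt_succ; pt_var.
  - by pb_tac.
  - move=> x i.
    have [j jle ->] : exists2 j, j <= g x & take i (nseq (g x) tt) = nseq j tt.
      exists (minn i (g x)); first exact: geq_minr.
      apply: (@eq_from_nth _ tt) => [|k _]; last by case: (nth _ _ _); case: (nth _ _ _).
      by rewrite size_take !size_nseq /minn; case: ltnP.
    rewrite -E !tsize_nat.
    have bnd m : tsize (eL eN (iota m j)) <= (j * (m + j).*2.+2).+1.
      elim: j m {jle} => //= j IH m; rewrite tsize_nat addnS -addSn.
      by have := IH m.+1; rewrite mulSn; move: (j * _); lia.
    by apply: leq_trans (bnd (f x)) _; rewrite ltnS; apply: leq_mul; lia.
by apply: pt_ext => x; rewrite -E.
Qed.

Lemma pt_drop X A (eX : X -> tree) (eA : A -> tree) (f : X -> nat) (l : X -> seq A) :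
  pt eX eN f -> pt eX (eL eA) l -> pt eX (eL eA) (fun x => drop (f x) (l x)).
Proof.
move=> pf pl.
have : pt eX (eL eA) (fun x => iter (f x) behead (l x)).
  apply: (pt_iter (g := fun=> behead) (q := fun=> 0) pf pl).
  - by apply: pt_behead; pt_var.
  - exact: pb_const.
  - by move=> x [|a b] /=; lia.
apply: pt_ext => x; elim: (f x) (l x) => [|n IH] s; first by rewrite drop0.
by rewrite iterSr IH -drop1 drop_drop addn1.
Qed.

Lemma pt_nth X A (eX : X -> tree) (eA : A -> tree) (d : A) (f : X -> nat)
    (l : X -> seq A) :
  pt eX eN f -> pt eX (eL eA) l -> pt eX eA (fun x => nth d (l x) (f x)).
Proof.
move=> pf pl; apply: pt_ext (pt_head d (pt_drop pf pl)) => x.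
by rewrite -nth0 nth_drop addn0.
Qed.

Lemma pt_eqseqn X (eX : X -> tree) (f g : X -> seq nat) :
  pt eX (eL eN) f -> pt eX (eL eN) g -> pt eX eB (fun x => f x == g x).
Proof.
move=> pf pg.
have h : pt eX eB (fun x => (size (f x) == size (g x)) &&
  all (fun i => nth 0 (f x) i == nth 0 (g x) i) (iota 0 (size (f x)))).
  apply: pt_and; first by apply: pt_eqn; apply: pt_size; eassumption.
  apply: (pt_all (g := fun x i => nth 0 (f x) i == nth 0 (g x) i)).
    exact: pt_iota (pt_const _ _ 0) (pt_size pf).
  have h := @pt_id _ (eP eX eN).
  by apply: pt_eqn; apply: pt_nth (pt_snd h) (pt_comp (pt_fst h) _).
apply: pt_ext h => x; apply/andP/eqP => [[/eqP sz /allP h]|->].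
  apply: (@eq_from_nth _ 0) => // i isz; apply/eqP/h.
  by rewrite mem_iota.
by split=> //; apply/allP.
Qed.

(** A hook that [pt_step] tries ahead of its structural rules; it is redefined whenever derived
    rules become available. *)
Ltac pt_user := fail.

Ltac pt_step := cbv beta; first
  [ pt_var
  | simple eapply pt_const
  | match goal with H : pt ?e _ ?f |- pt ?e _ ?f => exact H end
  | match goal with H : pt _ _ ?f |- pt _ _ (fun x => ?f (@?u x)) =>
      simple eapply (pt_comp (f := u) (g := f)); [|exact H] end
  | pt_user
  | simple eapply pt_pair | simple eapply pt_cons | simple eapply pt_succ
  | simple eapply pt_if | simple eapply pt_and | simple eapply pt_or
  | simple eapply pt_neg | simple eapply pt_xor
  | simple eapply pt_eqn | simple eapply pt_eqseqn | simple eapply pt_eqb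
  | simple eapply pt_leq | simple eapply pt_addn | simple eapply pt_muln
  | simple eapply pt_nilp | simple eapply pt_cat | simple eapply pt_flatten
  | simple eapply pt_map | simple eapply pt_iota | simple eapply pt_size
  | simple eapply pt_nth | simple eapply pt_all | simple eapply pt_behead
  | simple eapply pt_pred | simple eapply pt_fst | simple eapply pt_snd ].
Ltac pt_tac := repeat pt_step.

(** * Ramsey's theorem *)

Section Ramsey.
Variable T : eqType.

(* [c] is the colour of the sets whose least element is [x]. *)
Fixpoint prehomogeneous (K : Type) r (f : seq T -> K) (h : seq (T * K)) : Prop :=
  if h is (x, c) :: h' then
    (forall s, subseq s (map fst h') -> size s = r -> f (x :: s) = c) /\
    prehomogeneous r f h'
  else True.

Definition homogeneous (K : Type) r (f : seq T -> K) (h : seq T) : Prop :=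
  exists c, forall s, subseq s h -> size s = r -> f s = c.

(** The colour of a set is the label of its least element, so keeping a single label makes all sets
    agree. *)
Lemma homogeneous_filter (K : eqType) r (f : seq T -> K) h c :
  prehomogeneous r f h ->
  forall s, subseq s (map fst [seq p <- h | p.2 == c]) -> size s = r.+1 -> f s = c.
Proof.
elim: h => [_ [|//] //|[x d] h IH /= [hx /IH{}IH] s].
case: eqP => [dc /=|_]; last exact: IH.
case: s => // y s; case: eqP => [-> sub [sz]|_]; last exact: IH.
rewrite -dc; apply: hx => //; apply: subseq_trans sub _; apply: map_subseq; exact: filter_subseq.
Qed.

(** Induction on [r]: a first element [x] turns a colouring of sets of size [r.+1] into one of sets
    of size [r], and repeating this inside the homogeneous list found gives a prehomogeneous list.
    Subsequences play the role of subsets, which preserves the order of the indices. *)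
Lemma ramsey (K : finType) r n : exists N, forall (f : seq T -> K) (l : seq T),
  N <= size l -> exists h, [/\ subseq h l, size h = n & homogeneous r f h].
Proof.
elim: r n => [|r IH] n.
  exists n => f l nl; exists (take n l); split; first exact: take_subseq.
    by rewrite size_take; case: ltnP => // ?; apply/eqP; rewrite eqn_leq nl andbT.
  by exists (f [::]) => s _ /eqP; case: s.
have [pre hpre] : exists pre : nat -> nat, forall m (f : seq T -> K) l,
    pre m <= size l -> exists h : seq (T * K),
    [/\ subseq (map fst h) l, size h = m & prehomogeneous r f h].
  suff h m : exists N, forall (f : seq T -> K) l,
    N <= size l -> exists h : seq (T * K),
    [/\ subseq (map fst h) l, size h = m & prehomogeneous r f h].
    exists (fun m => proj1_sig (ClassicalEpsilon.constructive_indefinite_description _ (h m))).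
    by move=> m; apply: (proj2_sig (ClassicalEpsilon.constructive_indefinite_description _ (h m))).
  elim: m => [|m [N hN]].
    by exists 0 => f l _; exists [::]; split=> //; apply: sub0seq.
  have [M hM] := IH N; exists M.+1 => f [//|x l] /= Ml.
  have [h0 [sub0 sz0 [c hc]]] := hM (fun s => f (x :: s)) l Ml.
  have [|h [sub sz ph]] := hN f h0; first by rewrite sz0.
  exists ((x, c) :: h); split=> /=; rewrite ?eqxx ?sz //.
    exact: subseq_trans sub sub0.
  by split=> // s ss; apply: hc; apply: subseq_trans ss sub.
exists (pre (#|K| * n).+1) => f l /(hpre _ f)[h [sub sz ph]].
(* Pigeonhole: if every colour labelled fewer than [n] entries, there would be at most [#|K| * n] of
   them. *)
have [c nc] : exists c : K, n <= count (fun p => p.2 == c) h.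
  apply/existsP; apply: contraT; rewrite negb_exists => /forallP few.
  have E : \sum_(c : K) count (fun p : T * K => p.2 == c) h = size h.
    elim: h {sub sz ph few} => [|p h IHh] /=; first by rewrite big1.
    rewrite big_split /= IHh (bigD1 p.2) //= eqxx big1 // => i ne.
    by rewrite eq_sym (negbTE ne).
  have : \sum_(c : K) count (fun p : T * K => p.2 == c) h <= \sum_(c : K) n.
    by apply: leq_sum => c _; apply: ltnW; rewrite ltnNge few.
  by rewrite E sz sum_nat_const ltnn.
pose g := map fst [seq p <- h | p.2 == c].
have subg : subseq g l.
  apply: subseq_trans sub; apply: map_subseq; exact: filter_subseq.
exists (take n g); split.
- exact: subseq_trans (take_subseq _ _) subg.
- by rewrite size_take size_map size_filter; case: ltngtP nc.
- exists c => s ss; apply: homogeneous_filter ph _ _.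
  exact: subseq_trans ss (take_subseq _ _).
Qed.

End Ramsey.

(** * Canonical patterns *)

(* [(0, (i, 0))] and [(1, (i, 0))] are the i-th vertex of the left and of the
   right half of the sequence; [(2, (a, b))] is the vertex whose neighbourhood
   starts at the a-th vertex of the left half and ends just before the b-th
   vertex of the right half. *)
Definition desc : Type := nat * (nat * nat).

Definition valid N (x : desc) : bool :=
  (x.1 < 2) && (x.2.1 < N) && (x.2.2 == 0)
  || (x.1 == 2) && (x.2.1 < N) && (x.2.2 < N).

Definition interval_mem (k i a b : nat) : bool := if k == 0 then a <= i else i < b.

(** As every interval crosses from the left half to the right one, four relative positions remain:
    bit 5 is a common left end, bit 3 a common right end, bit 2 crossing and bit 4 nesting. *)
Definition interval_adj (tau : seq bool) (a b a' b' : nat) : bool :=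
  if a == a' then nth false tau 5
  else if b == b' then nth false tau 3
  else if (a < a') == (b < b') then nth false tau 2 else nth false tau 4.

Definition pattern_core (tau : seq bool) (x y : desc) : bool :=
  if x.1 == 2 then
    if y.1 == 2 then interval_adj tau x.2.1 x.2.2 y.2.1 y.2.2
    else interval_mem y.1 y.2.1 x.2.1 x.2.2
  else if y.1 == 2 then interval_mem x.1 x.2.1 y.2.1 y.2.2
  else nth false tau 1.

(* Bit 0 of [tau] tells whether the pattern occurs in the complement, bit 1
   whether the sequence is a clique; bits 2 to 5 give the adjacency of two
   interval vertices according to the order type of their endpoints. *)
Definition pattern_adj (tau : seq bool) (x y : desc) : bool :=
  nth false tau 0 (+) pattern_core tau x y.

Definition has_pattern (tau : seq bool) (N : nat) (G : graph) : Prop :=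
  exists emb : desc -> 'I_(order G), forall x y, valid N x -> valid N y -> x != y ->
  emb x != emb y /\ adj (emb x) (emb y) = pattern_adj tau x y.

Lemma sorted_nth_lt h i j : sorted ltn h -> i < j -> j < size h ->
  nth 0 h i < nth 0 h j.
Proof.
move=> srt ij jh; apply: (sorted_ltn_nth ltn_trans) => //; rewrite inE //.
exact: ltn_trans ij jh.
Qed.

Lemma sorted_nth4_subseq h i1 i2 i3 i4 : i1 < i2 -> i2 < i3 -> i3 < i4 ->
  i4 < size h -> subseq [:: nth 0 h i1; nth 0 h i2; nth 0 h i3; nth 0 h i4] h.
Proof.
move=> h12 h23 h34 h4.
have -> : [:: nth 0 h i1; nth 0 h i2; nth 0 h i3; nth 0 h i4] =
    map (nth 0 h) [:: i1; i2; i3; i4] by [].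
rewrite -{2}(mkseq_nth 0 h); apply: map_subseq.
suff -> : [:: i1; i2; i3; i4] = filter [in [:: i1; i2; i3; i4]] (iota 0 (size h)).
  exact: filter_subseq.
apply: (irr_sorted_eq ltn_trans ltnn).
- by rewrite /= h12 h23 h34.
- by apply: sorted_filter (iota_ltn_sorted _ _); apply: ltn_trans.
- move=> x; rewrite mem_filter /= mem_iota /= !inE.
  by case: (boolP [|| _, _, _ | _]) => //= /or4P[] /eqP->; lia.
Qed.

(** [h] is a homogeneous list of indices. Odd positions carry sequence vertices and even ones the
    ends of intervals, so an end never falls on a vertex of the pattern. Gaps and the last four
    positions supply the padding for configurations with fewer than four indices. *)
Lemma consecutive_pattern (H : graph) (N l : nat) (S : 'I_l.+1 -> 'I_(order H))
    (R : {set 'I_(order H)}) (h : seq nat)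
    (col : bool * bool * bool * bool * bool) :
  injective S -> (forall i, S i \notin R) ->
  forall W : nat -> nat -> 'I_(order H),
  (forall p q, p < q -> q <= l -> W p q \in R /\
     forall k : 'I_l.+1, adj (W p q) (S k) = (p <= k <= q)) ->
  sorted ltn h -> size h = 4 * N + 4 -> (forall p, p \in h -> p <= l) ->
  (forall p q r s, subseq [:: p; q; r; s] h ->
    (adj (S (inord p)) (S (inord q)), adj (W p r) (W q s), adj (W p r) (W q r),
     adj (W p s) (W q r), adj (W p r) (W p s)) = col) ->
  exists emb : desc -> 'I_(order H), forall x y, valid N x -> valid N y -> x != y ->
    emb x != emb y /\ adj (emb x) (emb y) =
    pattern_core [:: false; col.1.1.1.1; col.1.1.1.2; col.1.1.2; col.1.2; col.2] x y.
Proof.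
move=> injS SR W hW srt szh hl hcol.
pose pos i := nth 0 h i.
have pos_lt i j : i < j -> j < 4 * N + 4 -> pos i < pos j.
  by move=> ij jn; apply: sorted_nth_lt => //; rewrite szh.
have pos_l i : i < 4 * N + 4 -> pos i <= l by move=> il; apply/hl/mem_nth; rewrite szh.
have pos_leE i j : i < 4 * N + 4 -> j < 4 * N + 4 -> (pos i <= pos j) = (i <= j).
  move=> iN jN; case: (ltngtP i j) => [ij|ij|->]; last by rewrite leqnn.
    by rewrite ltnW // pos_lt.
  by rewrite leqNgt pos_lt.
have pos_inj i j : i < 4 * N + 4 -> j < 4 * N + 4 -> pos i = pos j -> i = j.
  move=> iN jN e; apply/eqP; rewrite eqn_leq -(pos_leE i j) // -(pos_leE j i) //.
  by rewrite e leqnn.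
have bits i1 i2 i3 i4 : i1 < i2 -> i2 < i3 -> i3 < i4 -> i4 < 4 * N + 4 -> _ :=
  fun h12 h23 h34 h4 => hcol _ _ _ _
    (sorted_nth4_subseq h12 h23 h34 (eq_ind_r (fun n => i4 < n) h4 szh)).
pose P i := S (inord (pos i)).
pose Q i j := W (pos i) (pos j).
have Pinj i j : i < 4 * N + 4 -> j < 4 * N + 4 -> i != j -> P i != P j.
  move=> iN jN; apply: contraNneq => /injS /(congr1 val) /=.
  by rewrite !inordK ?ltnS ?pos_l // => /pos_inj->.
have QR i j : i < j -> j < 4 * N + 4 -> Q i j \in R.
  by move=> ij jN; case: (hW (pos i) (pos j)) => //; [apply: pos_lt | apply: pos_l].
have QP i j k : i < j -> j < 4 * N + 4 -> k < 4 * N + 4 ->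
    adj (Q i j) (P k) = (i <= k <= j).
  move=> ij jN kN; case: (hW (pos i) (pos j)); [exact: pos_lt|exact: pos_l|move=> _ ->].
  by rewrite inordK ?ltnS ?pos_l // !pos_leE //; lia.
have Qinj i j i' j' : i < j -> j < 4 * N + 4 -> i' < j' -> j' < 4 * N + 4 ->
    Q i j = Q i' j' -> i = i' /\ j = j'.
  move=> ij jN ij' jN' e.
  have E k : k < 4 * N + 4 -> (i <= k <= j) = (i' <= k <= j').
    by move=> kN; rewrite -!QP // e.
  have := E i; have := E j; have := E i'; have := E j'; lia.
(* With these positions [2 * a <= 2 * i + 1] means [a <= i] in the left half, and
   [2 * N + 1 + 2 * i <= 2 * N + 2 * b] means [i < b] in the right half. *)
pose emb (x : desc) := if x.1 == 2 then Q (2 * x.2.1) (2 * N + 2 * x.2.2)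
  else if x.1 == 0 then P (2 * x.2.1 + 1) else P (2 * N + 1 + 2 * x.2.1).
have emb_adj x y : valid N x -> valid N y -> x != y -> emb x != emb y /\
    adj (emb x) (emb y) =
    pattern_core [:: false; col.1.1.1.1; col.1.1.1.2; col.1.1.2; col.1.2; col.2] x y.
  have SS i j : i < j -> j < 4 * N + 2 -> adj (P i) (P j) = col.1.1.1.1.
    by move=> ij jN; rewrite -(bits i j j.+1 j.+2) //; lia.
  have SS' i j : i != j -> i < 4 * N + 2 -> j < 4 * N + 2 ->
      adj (P i) (P j) = col.1.1.1.1.
    by rewrite neq_ltn => /orP[] ij iN jN; [|rewrite adj_sym]; apply: SS.
  have WW a b a' b' : a < a' -> a' < N -> b < N -> b' < N ->
     adj (Q (2 * a) (2 * N + 2 * b)) (Q (2 * a') (2 * N + 2 * b')) =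
     if b == b' then col.1.1.2 else if b < b' then col.1.1.1.2 else col.1.2.
    move=> aa aN bN bN'; case: (ltngtP b b') => [bb|bb|<-].
    - by rewrite -(bits (2 * a) (2 * a') (2 * N + 2 * b) (2 * N + 2 * b')) //; lia.
    - by rewrite -(bits (2 * a) (2 * a') (2 * N + 2 * b') (2 * N + 2 * b)) //; lia.
    - by rewrite -(bits (2 * a) (2 * a') (2 * N + 2 * b) (2 * N + 2 * b).+1) //; lia.
  have WW' a b b' : a < N -> b < b' -> b' < N ->
     adj (Q (2 * a) (2 * N + 2 * b)) (Q (2 * a) (2 * N + 2 * b')) = col.2.
    move=> aN bb bN.
    by rewrite -(bits (2 * a) (2 * a).+1 (2 * N + 2 * b) (2 * N + 2 * b')) //; lia.
  have PQ i j k : i < j -> j < 4 * N + 4 -> k < 4 * N + 4 -> P k != Q i j.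
    by move=> ij jN kN; apply: contraTneq (QR _ _ ij jN) => <-; apply: SR.
  case: x y => [k [a b]] [k' [a' b']]; rewrite /valid /= => vx vy.
  rewrite !xpair_eqE /emb /pattern_core /interval_mem /interval_adj /=.
  have [k2|k2] := eqVneq k 2; have [k2'|k2'] := eqVneq k' 2 => /=.
  - subst k k'; rewrite /= in vx vy *.
    have [vx1 vx2] : a < N /\ b < N by lia.
    have [vy1 vy2] : a' < N /\ b' < N by lia.
    move=> ne; split.
      apply/eqP => /Qinj e; move: ne.
      by case: e; lia.
    have [aa|aa] := eqVneq a a'.
      subst a'; rewrite eqxx /= in ne.
      by move: ne; rewrite neq_ltn => /orP[] bb; [|rewrite adj_sym]; apply: WW'.
    move: (aa); rewrite neq_ltn => /orP[] lt; last rewrite adj_sym; rewrite WW //.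
      by rewrite lt; case: (ltngtP b b').
    by rewrite [a < a']ltnNge (ltnW lt) /=; case: (ltngtP b b').
  - move=> _; subst k; split.
      by rewrite eq_sym; case: ifP => _; apply: PQ; lia.
    by case: ifP => k0; rewrite QP //; lia.
  - move=> _; subst k'; split.
      by case: ifP => _; apply: PQ; lia.
    by rewrite adj_sym; case: ifP => k0; rewrite QP //; lia.
  - move=> ne; have : (k == 0, a) != (k' == 0, a') by rewrite xpair_eqE; lia.
    rewrite xpair_eqE => ne'; split.
      by do 2!case: ifP => ?; apply: Pinj; lia.
    by do 2!case: ifP => ?; apply: SS'; lia.
by exists emb.
Qed.

Lemma has_pattern_le tau N N' G : N' <= N -> has_pattern tau N G -> has_pattern tau N' G.
Proof.
move=> le [emb h]; exists emb => x y vx vy; apply: h.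
  by move: vx; rewrite /valid; lia.
by move: vy; rewrite /valid; lia.
Qed.

Lemma consecutive_has_pattern (G : graph) (b : bool) (N l : nat) :
  let H := if b then compl G else G in
  (forall (f : seq nat -> bool * bool * bool * bool * bool) s, l < size s ->
     exists h, [/\ subseq h s, size h = 4 * N + 4 & homogeneous 4 f h]) ->
  represents_consecutive H l.+1 ->
  exists tau : 6.-tuple bool, has_pattern tau N G.
Proof.
move=> H.
(* Complementation flips adjacency between distinct vertices, which bit 0 of the pattern absorbs. *)
have toG (emb : desc -> 'I_(order H)) : exists emb' : desc -> 'I_(order G), forall x y,
    (emb' x == emb' y) = (emb x == emb y) /\
    (emb x != emb y -> adj (emb' x) (emb' y) = b (+) adj (emb x) (emb y)).
  by move: emb; rewrite {}/H; case: b => emb; exists emb => x y; split=> //= ne;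
    rewrite /compl_adj ne negbK.
move=> ram [S [R [injS SR hR]]].
pose W p q : 'I_(order H) := odflt (S ord0)
  [pick w | (w \in R) && [forall k, adj w (S k) == (p <= k <= q)]].
have hW p q : p < q -> q <= l -> W p q \in R /\
    forall k : 'I_l.+1, adj (W p q) (S k) = (p <= k <= q).
  move=> pq ql; rewrite /W; case: pickP => [w /andP[wR /forallP h]|none] /=.
    by split=> // k; apply/eqP.
  have [|w wR hw] := hR (inord p) (inord q); first by rewrite !inordK //; lia.
  have := none w; rewrite wR /= => /forallP[] k; rewrite hw !inordK //; lia.
pose f s := let p := nth 0 s 0 in let q := nth 0 s 1 in
  let r := nth 0 s 2 in let s' := nth 0 s 3 in
  (adj (S (inord p)) (S (inord q)), adj (W p r) (W q s'), adj (W p r) (W q r),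
     adj (W p s') (W q r), adj (W p r) (W p s')).
have [|h [sub sz [col hcol]]] := ram f (iota 0 l.+1); first by rewrite size_iota.
have [|p ph|p q r s ss|emb hemb] := consecutive_pattern (col := col) injS SR hW _ sz.
- by apply: subseq_sorted sub (iota_ltn_sorted _ _); apply: ltn_trans.
- by have := mem_subseq sub ph; rewrite mem_iota.
- by have := hcol _ ss erefl.
exists [tuple b; col.1.1.1.1; col.1.1.1.2; col.1.1.2; col.1.2; col.2].
have [emb' hemb'] := toG emb.
exists emb' => x y vx vy xy; have [eq ad] := hemb' x y.
by have [ne E] := hemb x y vx vy xy; rewrite eq ne ad // E.
Qed.

(** There are finitely many patterns, and smaller sizes sit inside larger ones. If each [tau] failed
    at some size, no pattern could occur at the maximum of these sizes. *)
Lemma class_has_pattern (C : graph -> Prop) :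
  consecutive_representation_property C ->
  exists tau : 6.-tuple bool, forall N, exists2 G, C G & has_pattern tau N G.
Proof.
move=> [p [c hC]]; apply: NNPP => no.
have step N : exists tau : 6.-tuple bool, exists2 G, C G & has_pattern tau N G.
  have [l ram] := @ramsey nat (bool * bool * bool * bool * bool)%type 4 (4 * N + 4).
  have [G [t [CG rep _ _]]] := hC l.+1 isT.
  have [b rep'] : exists b : bool, represents_consecutive (if b then compl G else G) l.+1.
    by case: rep; [exists false | exists true].
  have [|tau pat] := @consecutive_has_pattern G b N l _ rep'; last by exists tau, G.
  by move=> f s ls; apply: ram; apply: ltnW.
have bad (tau : 6.-tuple bool) : exists N, ~ exists2 G, C G & has_pattern tau N G.
  by apply: NNPP => h; apply: no; exists tau => N; apply: NNPP => h'; apply: h; exists N.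
pose bound tau := proj1_sig (constructive_indefinite_description _ (bad tau)).
have [tau [G CG pat]] := step (\max_tau bound tau).
apply: (proj2_sig (constructive_indefinite_description _ (bad tau))).
exists G => //; apply: has_pattern_le pat; exact: (leq_bigmax tau).
Qed.

(** * Blow-ups *)

(** [f] is arbitrary: vertices outside its image disappear, and its fibres become cliques of true
    twins. *)
Definition pull_adj (G : graph) n (f : 'I_n -> 'I_(order G)) : rel 'I_n :=
  fun x y => (x != y) && ((f x == f y) || adj (f x) (f y)).

Lemma pull_adj_sym G n (f : 'I_n -> 'I_(order G)) : symmetric (pull_adj f).
Proof. by move=> x y; rewrite /pull_adj eq_sym [f x == _]eq_sym adj_sym. Qed.

Lemma pull_adj_irr G n (f : 'I_n -> 'I_(order G)) : irreflexive (pull_adj f).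
Proof. by move=> x; rewrite /pull_adj eqxx. Qed.

Definition pull (G : graph) n (f : 'I_n -> 'I_(order G)) : graph :=
  Graph (pull_adj_sym f) (pull_adj_irr f).

(** Induction on the number of pairs that [f] identifies: one vertex of such a pair is sent to a
    fresh twin of the common image. Once [f] is injective it describes an induced subgraph. *)
Lemma closed_pull (C : graph -> Prop) : closed_induced_subgraph C ->
  closed_duplication C -> forall G n (f : 'I_n -> 'I_(order G)), C G -> C (pull f).
Proof.
move=> hind hdup G n f CG.
pose clash G (f : 'I_n -> 'I_(order G)) :=
  [set p : 'I_n * 'I_n | (p.1 != p.2) && (f p.1 == f p.2)].
suff H d : forall G (f : 'I_n -> 'I_(order G)), C G -> #|clash G f| <= d ->
    exists G' (f' : 'I_n -> 'I_(order G')), [/\ C G', injective f' &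
      forall x y, adj (f' x) (f' y) = pull_adj f x y].
  have [G' [f' [CG' inj' E]]] := H _ G f CG (leqnn _).
  by apply: hind CG'; exists f'.
elim: d => [|d IH] {CG}G {}f CG hd.
  have inj : injective f.
    move=> x y fxy; apply/eqP; apply: contraT => xy.
    move: hd; rewrite leqn0 cards_eq0 => /eqP/setP/(_ (x, y)).
    by rewrite !inE /= xy fxy eqxx.
  exists G, f; split=> // x y; rewrite /pull_adj.
  by have [->|ne] := eqVneq x y; rewrite ?adj_irr // (inj_eq inj) (negbTE ne).
have [cl0|[[x y]]] := set_0Vmem (clash G f).
  by apply: IH => //; rewrite cl0 cards0.
rewrite inE /= => /andP[xy /eqP fxy].
pose v := f x; pose f' z : 'I_(order (duplicate v)) :=
  if z == y then ord_max else lift ord_max (f z).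
have f'K z : dup_proj v (f' z) = f z.
  by rewrite /f' /dup_proj; case: eqP => [->|_]; rewrite ?unlift_none ?liftK.
have E z w : pull_adj f' z w = pull_adj f z w.
  rewrite /pull_adj /= /dup_adj !f'K; case: (z != w) => //=.
  by case: eqP => //= e; rewrite -(f'K z) e f'K eqxx.
have [||G' [g [CG' injg Eg]]] := IH (duplicate v) f'; first exact: hdup.
  rewrite -ltnS; apply: leq_trans hd; apply: proper_card; apply/properP; split.
    apply/subsetP => -[z w]; rewrite !inE /= => /andP[-> /eqP e].
    by rewrite -(f'K z) e f'K eqxx.
  exists (x, y); rewrite !inE /= xy ?fxy ?eqxx //= /f' eqxx (negbTE xy).
  by rewrite eq_sym eq_liftF.
by exists G', g; split=> // z w; rewrite Eg E.
Qed.

(** * Formulas without scoping constraints *)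

(** Without the scope as an index, formulas can be generated by plain recursion and handled by
    programs. Scoping is checked afterwards by [scoped], and the encodings agree with those of
    [fo]. *)
Inductive rfo :=
  | REq of nat & nat
  | RAdj of nat & nat
  | RNot of rfo
  | RAnd of rfo & rfo
  | ROr of rfo & rfo
  | REx of rfo
  | RAll of rfo.

Fixpoint enc_rfo (r : rfo) : tree :=
  match r with
  | REq i j => Node (enc_nat 0) (Node (enc_nat i) (enc_nat j))
  | RAdj i j => Node (enc_nat 1) (Node (enc_nat i) (enc_nat j))
  | RNot a => Node (enc_nat 2) (enc_rfo a)
  | RAnd a b => Node (enc_nat 3) (Node (enc_rfo a) (enc_rfo b))
  | ROr a b => Node (enc_nat 4) (Node (enc_rfo a) (enc_rfo b))
  | REx a => Node (enc_nat 5) (enc_rfo a)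
  | RAll a => Node (enc_nat 6) (enc_rfo a)
  end.

Fixpoint scoped (n : nat) (r : rfo) : bool :=
  match r with
  | REq i j | RAdj i j => (i < n) && (j < n)
  | RNot a => scoped n a
  | RAnd a b | ROr a b => scoped n a && scoped n b
  | REx a | RAll a => scoped n.+1 a
  end.

Definition scons (V : Type) (v : V) (e : nat -> V) (i : nat) : V :=
  if i is j.+1 then e j else v.

Fixpoint rholds (V : Type) (A : rel V) (r : rfo) (e : nat -> V) : Prop :=
  match r with
  | REq i j => e i = e j
  | RAdj i j => A (e i) (e j)
  | RNot a => ~ rholds A a e
  | RAnd a b => rholds A a e /\ rholds A b e
  | ROr a b => rholds A a e \/ rholds A b e
  | REx a => exists v, rholds A a (scons v e)
  | RAll a => forall v, rholds A a (scons v e)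
  end.

Lemma fo_of_scoped n r : scoped n r -> exists phi : fo n,
  [/\ enc_fo phi = enc_rfo r, fo_size phi <= tsize (enc_rfo r)
    & forall (G : graph) (e : 'I_n -> 'I_(order G)) (e' : nat -> 'I_(order G)),
      (forall i : 'I_n, e i = e' i) -> fo_holds phi e <-> rholds (@adj G) r e'].
Proof.
elim: r n => [i j|i j|a IH|a IHa b IHb|a IHa b IHb|a IH|a IH] n /=.
- case/andP=> hi hj; exists (FEq (Ordinal hi) (Ordinal hj)); split=> // G e e' E.
  by rewrite /= !E.
- case/andP=> hi hj; exists (FAdj (Ordinal hi) (Ordinal hj)); split=> // G e e' E.
  by rewrite /= !E.
- case/IH=> phi [E sz h]; exists (FNot phi); split=> /=; rewrite ?E //; first by lia.
  by move=> G e e' /(h G) ->.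
- case/andP=> /IHa[p [Ep sp hp]] /IHb[q [Eq sq hq]]; exists (FAnd p q).
  split=> /=; rewrite ?Ep ?Eq //; first by lia.
  by move=> G e e' E; rewrite (hp G e e' E) (hq G e e' E).
- case/andP=> /IHa[p [Ep sp hp]] /IHb[q [Eq sq hq]]; exists (FOr p q).
  split=> /=; rewrite ?Ep ?Eq //; first by lia.
  by move=> G e e' E; rewrite (hp G e e' E) (hq G e e' E).
- case/IH=> phi [E sz h]; exists (FEx phi); split=> /=; rewrite ?E //; first by lia.
  move=> G e e' E'; have H v i : env_cons v e i = scons v e' i.
    rewrite /env_cons; case: unliftP => [j|] -> //=; exact: E'.
  by split=> -[v hv]; exists v; move: hv; rewrite (h G _ _ (H v)).
- case/IH=> phi [E sz h]; exists (FAll phi); split=> /=; rewrite ?E //; first by lia.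
  move=> G e e' E'; have H v i : env_cons v e i = scons v e' i.
    rewrite /env_cons; case: unliftP => [j|] -> //=; exact: E'.
  by split=> hv v; have := hv v; rewrite (h G _ _ (H v)).
Qed.

(** * Formulas for twins, multiplicities and edges *)

Definition RTrue := RAll (REq 0 0).
Definition RImp a b := ROr (RNot a) b.
Definition RIff a b := ROr (RAnd a b) (RAnd (RNot a) (RNot b)).
Definition RBigAnd (s : seq nat) (f : nat -> rfo) : rfo :=
  foldr (fun b r => RAnd (f b) r) RTrue s.
(** Only third vertices are asked; the adjacency of the two vertices themselves is left open. In the
    graphs below this holds exactly for copies of the same base vertex. *)
Definition RTwin i j :=
  RAll (ROr (REq 0 i.+1) (ROr (REq 0 j.+1) (RIff (RAdj 0 i.+1) (RAdj 0 j.+1)))).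
(** With [d] witnesses bound, the vertex [i] has index [i + d], and one more under the new
    quantifier. *)
Definition RAtLeastStep i d r :=
  REx (RAnd (RAnd (RTwin 0 (i + d).+1) (RBigAnd (iota 0 d) (fun b => RNot (REq 0 b.+1)))) r).
Definition RAtLeast m i := foldr (RAtLeastStep i) RTrue (iota 0 m).
Definition RExactly m i := RAnd (RAtLeast m i) (RNot (RAtLeast m.+1 i)).
Definition RSame m i j :=
  RAll (RImp (RExactly m 0) (RIff (RAdj 0 i.+1) (RAdj 0 j.+1))).
(* Multiplicity 1 and 2 mark the two halves of the sequence, 4 the edges, and
   multiplicities from 5 on the elements. *)
Definition REdge i j :=
  RAnd (RAnd (RAtLeast 5 i) (RAtLeast 5 j))
    (REx (RAnd (RExactly 4 0) (RAnd (RSame 1 0 i.+1) (RSame 2 0 j.+1)))).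


Section RHolds.
Variables (V : Type) (A : rel V).
Implicit Type e : nat -> V.

Lemma rholds_iff a b e : rholds A (RIff a b) e <-> (rholds A a e <-> rholds A b e).
Proof. by rewrite /RIff /=; have := classic (rholds A a e); tauto. Qed.

Lemma rholds_imp a b e : rholds A (RImp a b) e <-> (rholds A a e -> rholds A b e).
Proof. by rewrite /RImp /=; have := classic (rholds A a e); tauto. Qed.

Lemma rholds_all a e : rholds A (RAll a) e = forall v, rholds A a (scons v e).
Proof. by []. Qed.

Lemma rholds_ex a e : rholds A (REx a) e = exists v, rholds A a (scons v e).
Proof. by []. Qed.

Lemma rholds_and a b e : rholds A (RAnd a b) e = (rholds A a e /\ rholds A b e).
Proof. by []. Qed.

Lemma rholds_or a b e : rholds A (ROr a b) e = (rholds A a e \/ rholds A b e).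
Proof. by []. Qed.

Lemma rholds_not a e : rholds A (RNot a) e = ~ rholds A a e.
Proof. by []. Qed.

Lemma rholds_bigand s f e :
  rholds A (RBigAnd s f) e <-> forall b, b \in s -> rholds A (f b) e.
Proof.
elim: s => [|a s IH]; first by split.
rewrite [rholds _ _ _]/= -/(RBigAnd _ _) IH; split=> [[fa h] b|h].
  by rewrite inE => /predU1P[->|] //; apply: h.
by split=> [|b bs]; apply: h; rewrite inE ?eqxx // bs orbT.
Qed.

End RHolds.

(** * The graph of a labelled digraph *)

Lemma pattern_adj_sym tau : symmetric (pattern_adj tau).
Proof.
move=> [k [a b]] [k' [a' b']]; rewrite /pattern_adj /pattern_core /interval_adj /=.
congr (_ (+) _); case: (k == 2); case: (k' == 2) => //.
rewrite ![a' == _]eq_sym ![b' == _]eq_sym.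
by case: (ltngtP a a') => // _; case: (ltngtP b b').
Qed.

Definition vertex : Type := desc * nat.

Definition vertex_adj (tau : seq bool) (u v : vertex) : bool :=
  (u != v) && ((u.1 == v.1) || pattern_adj tau u.1 v.1).

Definition vertex0 : vertex := ((0, (0, 0)), 0).

Section ListGraph.
Variables (tau : seq bool) (L : seq vertex).

Definition list_adj : rel 'I_(size L) :=
  fun x y => vertex_adj tau (nth vertex0 L x) (nth vertex0 L y).

Lemma list_adj_sym : symmetric list_adj.
Proof.
by move=> x y; rewrite /list_adj /vertex_adj eq_sym [_.1 == _]eq_sym pattern_adj_sym.
Qed.

Lemma list_adj_irr : irreflexive list_adj.
Proof. by move=> x; rewrite /list_adj /vertex_adj eqxx. Qed.

Definition list_graph : graph := Graph list_adj_sym list_adj_irr.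

Lemma enc_list_graph : enc_graph list_graph =
  enc_seq (enc_seq enc_bool) [seq [seq vertex_adj tau u v | v <- L] | u <- L].
Proof.
have E (T : Type) (g : vertex -> T) :
    map g L = [seq g (nth vertex0 L (nat_of_ord x)) | x <- enum 'I_(size L)].
  apply: (@eq_from_nth _ (g vertex0)) => [|i]; rewrite size_map.
    by rewrite size_map size_enum_ord.
  move=> iL; rewrite (nth_map vertex0) // (nth_map (Ordinal iL)) ?size_enum_ord //.
  by rewrite nth_enum_ord.
have enc_map (S T : Type) (h : S -> T) (f : T -> tree) (f' : S -> tree) s :
    (forall x, f (h x) = f' x) -> enc_seq f (map h s) = enc_seq f' s.
  by move=> hf; elim: s => //= x s ->; rewrite hf.
rewrite E /enc_graph; apply/esym/enc_map => x.
by rewrite E; apply: enc_map => y.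
Qed.

(** The list graph is a pull-back along the embedding of the pattern, so it belongs to the class
    although that embedding is never computed. *)
Lemma list_graph_closed (C : graph -> Prop) N G :
  closed_isomorphism C -> closed_induced_subgraph C -> closed_duplication C ->
  C G -> has_pattern tau N G -> uniq L -> (forall u, u \in L -> valid N u.1) ->
  C list_graph.
Proof.
move=> hC hind hdup CG [emb pat] uL vL.
have := closed_pull hind hdup (fun x : 'I_(size L) => emb (nth vertex0 L x).1) CG.
apply: hC; exists id; split=> [|x y]; first by exists id.
rewrite /= /list_adj /vertex_adj /pull_adj nth_uniq //; case: (x != y) => //=.
have vx : valid N (nth vertex0 L x).1 by apply/vL/mem_nth.
have vy : valid N (nth vertex0 L y).1 by apply/vL/mem_nth.
have [->|ne] := eqVneq (nth vertex0 L x).1 (nth vertex0 L y).1; first by rewrite eqxx.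
by have [ne' ->] := pat _ _ vx vy ne; rewrite (negbTE ne').
Qed.

End ListGraph.

(** Up to complement, the corner [(2, (0, 0))] sees exactly the left half and tells the halves
    apart. Squares start at 1 while the halves run from 0 to [N], so for positive [N] each interval
    has at least two neighbours and two non-neighbours in the sequence. *)
Definition bases (N : nat) : seq desc :=
  [seq (0, (i, 0)) | i <- iota 0 N.+1] ++ [seq (1, (i, 0)) | i <- iota 0 N.+1] ++
  (2, (0, 0)) ::
  flatten [seq [seq (2, (a, b)) | b <- iota 1 N] | a <- iota 1 N].

Definition vertices (N : nat) (mu : desc -> nat) : seq vertex :=
  flatten [seq [seq (x, c) | c <- iota 0 (mu x)] | x <- bases N].

Variant base_spec N : desc -> Prop :=
  | BaseLeft i of i <= N : base_spec N (0, (i, 0))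
  | BaseRight i of i <= N : base_spec N (1, (i, 0))
  | BaseCorner : base_spec N (2, (0, 0))
  | BaseSquare a b of 0 < a <= N & 0 < b <= N : base_spec N (2, (a, b)).

Lemma basesP N x : reflect (base_spec N x) (x \in bases N).
Proof.
apply: (iffP idP).
  rewrite /bases mem_cat => /orP[/mapP[i]|]; first by rewrite mem_iota => ? ->; constructor.
  rewrite mem_cat => /orP[/mapP[i]|]; first by rewrite mem_iota => ? ->; constructor.
  rewrite in_cons => /predU1P[->|]; first by constructor.
  case/flatten_mapP=> a; rewrite mem_iota => ha /mapP[b].
  by rewrite mem_iota => hb ->; constructor; lia.
case=> [i iN|i iN||a b ha hb]; rewrite /bases mem_cat.
- by rewrite (map_f (fun i => (0, (i, 0)))) // mem_iota.
- by apply/orP; right; rewrite mem_cat (map_f (fun i => (1, (i, 0)))) // mem_iota.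
- by apply/orP; right; rewrite mem_cat; apply/orP; right; rewrite in_cons eqxx.
- apply/orP; right; rewrite mem_cat; apply/orP; right; rewrite in_cons.
  apply/orP; right.
  apply/flatten_mapP; exists a; first by rewrite mem_iota; lia.
  by apply: map_f; rewrite mem_iota; lia.
Qed.

Lemma uniq_bases N : uniq (bases N).
Proof.
have hL k : uniq [seq ((k, (i, 0)) : desc) | i <- iota 0 N.+1].
  by rewrite map_inj_uniq ?iota_uniq // => i j [].
have disj (s t : seq desc) : uniq s -> uniq t ->
    (forall x, x \in s -> x \notin t) -> uniq (s ++ t).
  move=> us ut st; rewrite cat_uniq us ut andbT; apply/hasPn => x xt.
  by apply: contraL xt => /st.
have W2 (x : desc) a (l : seq nat) : x \in [seq (2, (a, b)) | b <- l] -> x.1 = 2.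
  by case/mapP=> b _ ->.
apply: (disj _ _ (hL 0)); first apply: (disj _ _ (hL 1)).
- rewrite cons_uniq; apply/andP; split.
    by apply/flatten_mapP => -[a]; rewrite mem_iota => ha /mapP[b _ [] a0]; lia.
  by apply: allpairs_uniq_dep => [|a _|[a b] [a' b'] _ _ [-> ->]] //=; exact: iota_uniq.
- move=> x /mapP[i _ ->]; rewrite in_cons; apply/norP; split=> //.
  by apply/flatten_mapP => -[a _ /W2].
- move=> x /mapP[i _ ->]; rewrite mem_cat; apply/norP; split; first by apply/mapP => -[].
  rewrite in_cons; apply/norP; split=> //.
  by apply/flatten_mapP => -[a _ /W2].
Qed.

Lemma base_valid N x : x \in bases N -> valid N.+1 x.
Proof. by case/basesP => *; rewrite /valid /=; lia. Qed.

(** * Absence of twins in the pattern *)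

Section Separation.
Variables (tau : seq bool) (N : nat).
Hypothesis N_gt0 : 0 < N.


(** Two left vertices are separated by an interval that starts at the later one, two right vertices
    by an interval that ends just before the later one, two intervals by the smaller of two
    differing ends, and the two halves by the corner. *)
Lemma bases_separated x y : x \in bases N -> y \in bases N -> x != y ->
  exists z, [/\ z \in bases N, z != x, z != y & pattern_adj tau z x != pattern_adj tau z y].
Proof.
pose sep x y := exists z, [/\ z \in bases N, z != x, z != y &
  pattern_core tau z x != pattern_core tau z y].
suff H : x \in bases N -> y \in bases N -> x != y -> sep x y.
  move=> hx hy xy; have [z [hz zx zy h]] := H hx hy xy; exists z; split=> //.
  by rewrite /pattern_adj; move: h; case: (nth false tau 0); do 2!case: pattern_core.
have symsep u v : sep u v -> sep v u.
  by case=> z [hz zu zv h]; exists z; split=> //; rewrite eq_sym.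
have LL i j : i < j -> j <= N -> sep (0, (i, 0)) (0, (j, 0)).
  move=> ij jN; exists (2, (j, 1)); split=> //; first by apply/basesP; constructor; lia.
  by rewrite /pattern_core /interval_mem /=; lia.
have RR i j : i < j -> j <= N -> sep (1, (i, 0)) (1, (j, 0)).
  move=> ij jN; exists (2, (1, j)); split=> //; first by apply/basesP; constructor; lia.
  by rewrite /pattern_core /interval_mem /=; lia.
have LR i j : sep (0, (i, 0)) (1, (j, 0)).
  exists (2, (0, 0)); split=> //; first by apply/basesP; constructor.
have SW k i w : k < 2 -> base_spec N (2, w) -> sep (k, (i, 0)) (2, w).
  move=> k2 hw; set s := nth false tau 1.
  (* Any two sequence vertices have adjacency [s], so one that meets the interval with adjacency
     [~~ s] separates. Two candidates are given, as one of them may be the vertex itself. *)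
  have [z [hz z2 zne hs]] : exists z, [/\ z \in bases N, z.1 < 2, z != (k, (i, 0)) &
      pattern_core tau z (2, w) = ~~ s].
    have ex2 z z' : z \in bases N -> z' \in bases N -> z.1 < 2 -> z'.1 < 2 -> z != z' ->
        pattern_core tau z (2, w) = ~~ s -> pattern_core tau z' (2, w) = ~~ s ->
        exists z, [/\ z \in bases N, z.1 < 2, z != (k, (i, 0)) &
      pattern_core tau z (2, w) = ~~ s].
      move=> hz hz' z2 z2' ne e e'; have [zk|zk] := eqVneq z (k, (i, 0)).
        by exists z'; split=> //; rewrite -zk eq_sym.
      by exists z.
    have hL j : j <= N -> (0, (j, 0)) \in bases N by move=> ?; apply/basesP; constructor.
    have hR j : j <= N -> (1, (j, 0)) \in bases N by move=> ?; apply/basesP; constructor.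
    by case: s ex2 => ex2; inversion hw; subst;
      [ apply: (ex2 (1, (0, 0)) (1, (N, 0))) | apply: (ex2 (0, (0, 0)) (1, (N, 0)))
      | apply: (ex2 (0, (0, 0)) (0, (N, 0))) | apply: (ex2 (0, (N, 0)) (1, (0, 0))) ];
      rewrite ?xpair_eqE /pattern_core /interval_mem //=; auto; lia.
  exists z; split=> //; first by apply: contraTneq z2 => ->.
  have z2' : (z.1 == 2) = false by lia.
  have k2' : (k == 2) = false by lia.
  by rewrite hs /pattern_core z2' /= k2' -/s; case: (s).
move=> /basesP hx /basesP hy.
have [w2|w2] := eqVneq x.1 2; have [w2'|w2'] := eqVneq y.1 2.
- case: x y w2 w2' hx hy => [_ [a b]] [_ [a' b']] /= -> -> hx hy ne.
  have ha : a <= N by inversion hx; lia.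
  have hb : b <= N by inversion hx; lia.
  have ha' : a' <= N by inversion hy; lia.
  have hb' : b' <= N by inversion hy; lia.
  have [aa|aa] := eqVneq a a'.
    have bb : b != b' by apply: contraNneq ne => ->; rewrite aa.
    exists (1, (minn b b', 0)); split=> //; first by apply/basesP; constructor; lia.
    by rewrite /pattern_core /interval_mem /=; move: bb; rewrite /minn; case: (ltngtP b b'); lia.
  exists (0, (minn a a', 0)); split=> //; first by apply/basesP; constructor; lia.
  by rewrite /pattern_core /interval_mem /=; move: aa; rewrite /minn; case: (ltngtP a a'); lia.
- move=> _; case: y hy w2' => [k [i j]] hy /= k2; case: x w2 hx => [k' w] /= -> hx.
  by apply: symsep; inversion hy; subst => //; apply: SW.
- move=> _; case: x hx w2 => [k [i j]] hx /= k2; case: y w2' hy => [k' w] /= -> hy.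
  by inversion hx; subst => //; apply: SW.
- case: hx w2 => [i iN|i iN||a b _ _] //=; case: hy w2' => [j jN|j jN||a b _ _] //= _ _ ne.
  + have : i != j by apply: contraNneq ne => ->.
    by rewrite neq_ltn => /orP[] ij; [|apply: symsep]; apply: LL.
  + by apply: symsep; apply: LR.
  + have : i != j by apply: contraNneq ne => ->.
    by rewrite neq_ltn => /orP[] ij; [|apply: symsep]; apply: RR.
Qed.

End Separation.

Lemma uniq_vertices N mu : uniq (vertices N mu).
Proof.
apply: allpairs_uniq_dep => [|x _|[x c] [x' c'] _ _ [-> ->]] //=.
  exact: uniq_bases.
exact: iota_uniq.
Qed.

Lemma mem_vertices N mu x c : ((x, c) \in vertices N mu) = (x \in bases N) && (c < mu x).
Proof.
apply/flatten_mapP/andP => [[y hy /mapP[d hd [-> ->]]]|[hx hc]].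
  by split=> //; move: hd; rewrite mem_iota.
by exists x => //; apply: map_f; rewrite mem_iota.
Qed.

Lemma count_vertices N mu x : x \in bases N ->
  count (fun u : vertex => u.1 == x) (vertices N mu) = mu x.
Proof.
move=> hx; rewrite /vertices; have := uniq_bases N.
have -> : mu x = if x \in bases N then mu x else 0 by rewrite hx.
elim: (bases N) => //= y s IH /andP[ys us]; rewrite count_cat IH // inE.
rewrite count_map; have [->|xy] := eqVneq x y.
  rewrite (negbTE ys) addn0 (@eq_count _ _ predT) ?count_predT ?size_iota // => c /=.
  by rewrite eqxx.
by rewrite (@eq_count _ _ pred0) ?count_pred0 // => c /=; rewrite eq_sym (negbTE xy).
Qed.

(** * Twin classes and their sizes in first-order logic *)

Section Multiplicity.
Variables (tau : seq bool) (N : nat) (mu : desc -> nat).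
Hypothesis N_gt0 : 0 < N.
Hypothesis mu_gt0 : forall x, x \in bases N -> 0 < mu x.

Let G := list_graph tau (vertices N mu).
Let V := 'I_(order G).
Implicit Types (u v : V) (e : nat -> V).

Definition base (u : 'I_(order (list_graph tau (vertices N mu)))) : desc :=
  (nth vertex0 (vertices N mu) u).1.

Lemma base_mem u : base u \in bases N.
Proof.
have := mem_nth vertex0 (ltn_ord u); rewrite /base; case: (nth _ _ _) => x c.
by rewrite mem_vertices => /andP[].
Qed.

Lemma base_onto x : x \in bases N -> exists u, base u = x.
Proof.
move=> hx; have h : (x, 0) \in vertices N mu by rewrite mem_vertices hx mu_gt0.
have hi : index (x, 0) (vertices N mu) < size (vertices N mu) by rewrite index_mem.
by exists (Ordinal hi); rewrite /base /= nth_index.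
Qed.

Lemma card_base u : #|[pred v | base v == base u]| = mu (base u).
Proof.
rewrite -(count_vertices mu (base_mem u)) -sum1_card -sum1_count.
by rewrite (big_nth vertex0) big_mkord.
Qed.

Lemma adj_baseE u v : u != v ->
  adj u v = (base u == base v) || pattern_adj tau (base u) (base v).
Proof.
move=> uv; rewrite /= /list_adj /vertex_adj nth_uniq ?uniq_vertices //.
by rewrite uv.
Qed.

(** Copies of one base agree on all other vertices. Conversely, two different bases have a
    separating third one, and a copy of it is present because [mu] is positive. *)
Lemma rholds_twin i j e : rholds (@adj G) (RTwin i j) e <-> base (e i) = base (e j).
Proof.
have E : rholds (@adj G) (RTwin i j) e <->
    forall w : V, w = e i \/ w = e j \/ (adj w (e i) = adj w (e j)).
  have P (a b : bool) : (a /\ b \/ ~ a /\ ~ b) <-> a = b.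
    split=> [|->].
      by case=> [[-> ->//]|[/negP/negbTE-> /negP/negbTE->]].
    by case: b; [left | right].
  by split=> h w; have := h w; rewrite /RTwin /RIff /= P.
rewrite E; split=> [h|ee w]; last first.
  have [->|wi] := eqVneq w (e i); first by left.
  have [->|wj] := eqVneq w (e j); first by right; left.
  by right; right; rewrite !adj_baseE // ee.
apply/eqP; apply: contraT => ne.
have [z [hz zi zj]] := bases_separated tau N_gt0 (base_mem _) (base_mem _) ne.
have [w hw] := base_onto hz; subst z.
case: (h w) => [ew|[ew|]]; first by rewrite ew eqxx in zi.
  by rewrite ew eqxx in zj.
rewrite !adj_baseE; first by rewrite (negbTE zi) (negbTE zj) /= => ->; rewrite eqxx.
  by apply: contraNneq zj => ->.
by apply: contraNneq zi => ->.
Qed.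

Local Opaque RTwin RBigAnd.

(** Generalised over [j] distinct twins already found, held by the lowest indices. *)
Lemma rholds_atleast_aux m j i e (u := e (i + j)) :
  uniq (map e (iota 0 j)) -> (forall k, k < j -> base (e k) = base u) ->
  rholds (@adj G) (foldr (RAtLeastStep i) RTrue (iota j m)) e <->
  j + m <= mu (base u).
Proof.
rewrite {}/u; elim: m j e => [|m IH] j e ue be.
  split=> // _; rewrite addn0 -card_base.
  have sub : {subset map e (iota 0 j) <= [pred v | base v == base (e (i + j))]}.
    by move=> v /mapP[k]; rewrite mem_iota => hk ->; rewrite inE be.
  by have := uniq_leq_size ue (fun v hv => etrans (mem_enum _ v) (sub v hv));
    rewrite size_map size_iota -cardE.
have key v : base v = base (e (i + j)) -> v \notin map e (iota 0 j) ->
    rholds (@adj G) (foldr (RAtLeastStep i) RTrue (iota j.+1 m)) (scons v e) <->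
    j.+1 + m <= mu (base (e (i + j))).
  move=> bv vn; have := IH j.+1 (scons v e); rewrite addnS /= => ->.
  - by [].
  - by rewrite (iotaDl 1 0) -map_comp /comp /= vn.
  - by case=> [//|k] /= kj; rewrite be.
rewrite addnS -addSn /=.
split=> [[v [[/rholds_twin /= bv /rholds_bigand hv] h]]|le].
  apply/(key v) => //; apply/mapP => -[k kj vk].
  by have := hv k kj => /=; rewrite vk.
(* If the [j] values exhausted the twin class, it would have at most [j] members. *)
have [v bv vn] : exists2 v, base v = base (e (i + j)) & v \notin map e (iota 0 j).
  apply: NNPP => no; have: j < mu (base (e (i + j))) by lia.
  rewrite -card_base ltnNge => /negP; apply.
  rewrite cardE; apply: leq_trans (_ : size (map e (iota 0 j)) <= _).
    apply: uniq_leq_size; first exact: enum_uniq.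
    move=> v; rewrite mem_enum inE => /eqP bv; apply: contraT => vn.
    by case: no; exists v.
  by rewrite size_map size_iota.
exists v; split; last exact/key.
split; first by apply/rholds_twin.
apply/rholds_bigand => k hk /= vk; case/negP: vn.
by rewrite vk map_f.
Qed.

Lemma rholds_atleast m i e :
  rholds (@adj G) (RAtLeast m i) e <-> m <= mu (base (e i)).
Proof. by rewrite /RAtLeast rholds_atleast_aux // addn0. Qed.

Local Opaque RAtLeast.

Lemma rholds_exactly m i e :
  rholds (@adj G) (RExactly m i) e <-> mu (base (e i)) = m.
Proof.
rewrite /RExactly /= !rholds_atleast; split=> [[]|->]; last by lia.
by move=> ? /negP; lia.
Qed.

End Multiplicity.

(** 3 is the blank value of the corner and of squares without an edge; 0 would delete base vertices
    that separate others. The diagonal is reserved for labels, so loops cannot be encoded. *)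
Definition multiplicity (T : Type) (x0 : T) (els : seq T) (lab : T -> nat)
    (E : T -> T -> bool) (x : desc) : nat :=
  if x.1 == 0 then 1 else if x.1 == 1 then 2 else if x.2.1 == 0 then 3 else
  if x.2.1 == x.2.2 then lab (nth x0 els x.2.1.-1) else
  if E (nth x0 els x.2.1.-1) (nth x0 els x.2.2.-1) then 4 else 3.

(** * Elements and edges of the digraph *)

Section Elements.
Variables (tau : seq bool) (T : eqType) (x0 : T) (els : seq T).
Variables (lab : T -> nat) (E : rel T).
Hypothesis els_gt0 : 0 < size els.
Hypothesis els_uniq : uniq els.
Hypothesis lab_ge5 : forall x, x \in els -> 5 <= lab x.
Hypothesis E_irr : forall x, x \in els -> E x x = false.

Let N := size els.
Let mu := multiplicity x0 els lab E.
Definition digraph_graph := list_graph tau (vertices N mu).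
Let G := digraph_graph.
Let V := 'I_(order G).
Implicit Types (u v : V) (e : nat -> V).

Lemma multiplicity_gt0 x : x \in bases N -> 0 < mu x.
Proof.
case/basesP => // a b ha hb; rewrite /mu /multiplicity /= ifN; last by lia.
case: ifP => _; last by case: ifP.
by apply: leq_trans (lab_ge5 _) => //; apply: mem_nth; move: ha; rewrite /N; lia.
Qed.

Lemma multiplicity_square x : x \in bases N -> x.1 = 2 -> 3 <= mu x.
Proof.
case/basesP => // a b ha hb _; rewrite /mu /multiplicity /= ifN; last by lia.
case: ifP => _; last by case: ifP.
by apply: leq_trans (lab_ge5 _) => //; apply: mem_nth; move: ha; rewrite /N; lia.
Qed.

Definition is_element (u : V) : bool := 5 <= mu (base u).
Definition element (u : V) : T := nth x0 els (base u).2.1.-1.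

Lemma is_elementP u : reflect (exists2 i, i < N & base u = (2, (i.+1, i.+1)))
    (is_element u).
Proof.
apply: (iffP idP) => [|[i iN bu]]; rewrite /is_element; last first.
  by rewrite bu /mu /multiplicity /= eqxx; apply/lab_ge5/mem_nth.
case/basesP: (base_mem u) => // a b ha hb; rewrite /mu /multiplicity /= ifN; last by lia.
case: eqP => [<-|_]; last by case: ifP.
by move=> _; exists a.-1; [lia | rewrite prednK //; lia].
Qed.

Lemma element_mem u : is_element u -> element u \in els.
Proof. by case/is_elementP => i iN; rewrite /element => ->; apply: mem_nth. Qed.

Lemma element_onto x : x \in els -> exists2 u, is_element u & element u = x.
Proof.
move=> xe; have iN : index x els < N by rewrite index_mem.
have [|u hu] := base_onto tau multiplicity_gt0 (x := (2, ((index x els).+1, (index x els).+1))).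
  by apply/basesP; constructor; lia.
exists u; first by apply/is_elementP; exists (index x els).
by rewrite /element hu /= nth_index.
Qed.

Lemma element_inj u v : is_element u -> is_element v ->
  base u = base v <-> element u = element v.
Proof.
move=> /is_elementP[i iN bu] /is_elementP[j jN bv]; rewrite /element bu bv /=.
split=> [[->] //|/eqP]; rewrite nth_uniq // => /eqP->//.
Qed.

Lemma rholds_label m i e : 5 <= m ->
  rholds (@adj G) (RExactly m i) e <-> is_element (e i) /\ lab (element (e i)) = m.
Proof.
move=> m5; rewrite rholds_exactly //; last exact: multiplicity_gt0.
have lab_mu u : is_element u -> mu (base u) = lab (element u).
  by case/is_elementP => k kN bu; rewrite /element bu /mu /multiplicity /= eqxx.
split=> [h|[el <-]]; last exact: lab_mu.
have el : is_element (e i) by rewrite /is_element -/mu h.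
by rewrite -lab_mu.
Qed.

(** The left half sees an interval only through its left end and the right half only through its
    right end; multiplicities 1 and 2 name the halves. The bounds on [mu w] and [mu w'] make both
    vertices intervals, and the smaller of two differing ends names a sequence vertex on which they
    disagree. *)
Lemma rholds_same m i j e (w := base (e i)) (w' := base (e j)) :
  0 < m <= 2 -> 3 <= mu w -> 3 <= mu w' ->
  rholds (@adj G) (RSame m i j) e <->
  (if m == 1 then w.2.1 == w'.2.1 else w.2.2 == w'.2.2).
Proof.
move=> hm mw mw'.
have w2 u : 3 <= mu (base u) -> (base u).1 = 2 by case/basesP: (base_mem u).
have eN u : (base u).1 = 2 -> (base u).2.1 <= N /\ (base u).2.2 <= N.
  by case/basesP: (base_mem u) => //= *; lia.
have H : rholds (@adj G) (RSame m i j) e <-> forall z, mu (base z) = m ->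
    adj z (e i) = adj z (e j).
  rewrite /RSame rholds_all; split=> h z; have := h z;
    rewrite rholds_imp rholds_exactly //; try exact: multiplicity_gt0;
    rewrite rholds_iff /=.
    by move=> h1 /h1 h2; apply/idP/idP => /h2.
  by move=> h1 /h1 h2; split; rewrite h2.
have adjz z u : mu (base z) = m -> (base u).1 = 2 ->
    adj z u = nth false tau 0 (+) interval_mem (base z).1 (base z).2.1 (base u).2.1 (base u).2.2.
  move=> mz bu; have bz : (base z).1 < 2.
    have [z2|] := eqVneq (base z).1 2; last by case/basesP: (base_mem z).
    by have := multiplicity_square (base_mem z) z2; lia.
  have ne : base z != base u by apply: contraTneq bz => ->; rewrite bu.
  rewrite adj_baseE; last by apply: contraNneq ne => ->.
  rewrite (negbTE ne) /= /pattern_adj /pattern_core bu eqxx ifN //.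
  by apply: contraTneq bz => ->.
have addI (a b c : bool) : a (+) b = a (+) c -> b = c by case: a b c => -[] [].
rewrite H; case: (w2 _ mw) (w2 _ mw') => k2 k2'.
have [h1 h2] := eN _ k2; have [h1' h2'] := eN _ k2'.
have zl k : k <= N -> exists z : V, base z = (0, (k, 0)).
  by move=> kN; apply: (base_onto tau multiplicity_gt0); apply/basesP; constructor.
have zr k : k <= N -> exists z : V, base z = (1, (k, 0)).
  by move=> kN; apply: (base_onto tau multiplicity_gt0); apply/basesP; constructor.
have [m1|m1] := eqVneq m 1.
  split=> [h|/eqP ww z mz]; last first.
    rewrite !adjz //; congr (_ (+) _); rewrite /interval_mem -/w -/w' ww.
    case: eqP => // /eqP bz0; move: mz; rewrite m1 /mu /multiplicity (negbTE bz0).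
    case: ifP => // /negP bz1 mz.
    have z2 : (base z).1 = 2 by case/basesP: (base_mem z) bz0 bz1.
    by have := multiplicity_square (base_mem z) z2; rewrite /mu /multiplicity z2 /= in mz *; lia.
  have kN : minn w.2.1 w'.2.1 <= N by rewrite geq_min h1.
  have [z bz] := zl _ kN.
  have mz : mu (base z) = m by rewrite bz m1.
  have := h z mz; rewrite !adjz // => /addI; rewrite bz /interval_mem /= -/w -/w'; lia.
have m2 : m = 2 by lia.
split=> [h|/eqP ww z mz]; last first.
  rewrite !adjz //; congr (_ (+) _); rewrite /interval_mem -/w -/w' ww.
  by case: eqP => // bz0; move: mz; rewrite m2 /mu /multiplicity bz0.
have [ww|ww] := eqVneq w.2.2 w'.2.2; first by [].
have kN : minn w.2.2 w'.2.2 <= N by rewrite geq_min h2.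
have [z bz] := zr _ kN.
have mz : mu (base z) = m by rewrite bz m2.
have := h z mz; rewrite !adjz // => /addI; rewrite bz /interval_mem /= -/w -/w'; lia.
Qed.

Local Opaque RAtLeast RExactly RSame.

Lemma rholds_edge i j e : rholds (@adj G) (REdge i j) e <->
  [/\ is_element (e i), is_element (e j) & E (element (e i)) (element (e j))].
Proof.
have mu0 := multiplicity_gt0; have m3 u : is_element u -> 3 <= mu (base u).
  by rewrite /is_element; lia.
rewrite /REdge !rholds_and rholds_ex !rholds_atleast //.
rewrite -/(is_element (e i)) -/(is_element (e j)).
split=> [[[ei ej] [w]]|[ei ej Eij]].
  rewrite rholds_and rholds_exactly // rholds_and => -[/= mw].
  have mw3 : 3 <= mu (base w) by rewrite mw.
  rewrite !rholds_same //= ?mw3 ?m3 // => -[/eqP hl /eqP hr].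
  split=> //; move: mw.
  have [w2|w2] := eqVneq (base w).1 2; last by case/basesP: (base_mem w) w2.
  move: ei ej => /is_elementP[a aN ba] /is_elementP[b bN bb].
  rewrite /element /mu /multiplicity w2 /= hl hr ba bb /=.
  case: eqP => [_ e4|_]; last by case: ifP.
  by have := lab_ge5 (mem_nth x0 aN); rewrite e4.
split=> //; have [a aN ba] := is_elementP _ ei; have [b bN bb] := is_elementP _ ej.
have [|w bw] := base_onto tau mu0 (x := (2, (a.+1, b.+1))).
  by apply/basesP; constructor; lia.
have mw : mu (base w) = 4.
  move: Eij; rewrite /element ba bb bw /mu /multiplicity /= eqSS.
  (* A diagonal square would carry its label instead of the edge mark; irreflexivity excludes this
     case. *)
  by case: eqP => [->|_ ->//]; rewrite E_irr // mem_nth.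
have mw3 : 3 <= mu (base w) by rewrite mw.
exists w; rewrite rholds_and rholds_exactly // rholds_and; split=> //.
by rewrite !rholds_same //= ?mw3 ?m3 // bw ba bb /= !eqxx.
Qed.
End Elements.

(** * Quantified formulas as labelled digraphs *)

(* An element is a node of the formula, given by its path to the root, its
   label and, for a literal, its variable; or a variable, with empty path and
   label [9 + i] for the i-th block.  The root has label 5, other inner nodes 6,
   positive literals 7 and negative ones 8. *)
Definition elt : Type := seq nat * (nat * nat).
Definition elt0 : elt := ([::], (0, 0)).
Definition elt_label (x : elt) : nat := x.2.1.
Definition elt_var (x : elt) : nat := x.2.2.

(** Paths grow at the head, so the path of the parent is the tail. Variables share the empty path
    with the root; the tests on labels keep them apart. *)
Definition elt_edge (x y : elt) : bool :=
  if 9 <= elt_label y then (7 <= elt_label x) && (elt_label x <= 8) && (elt_var x == elt_var y)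
  else (elt_label x <= 6) && (y.1 != [::]) && (behead y.1 == x.1).

Definition nform0 (t : nat) : nform nat t :=
  match t with 0 => (false, 0) | _.+1 => [::] end.

Fixpoint nodes (t : nat) : nform nat t -> seq nat -> nat -> seq elt :=
  match t with
  | 0 => fun F p _ => [:: (p, (if F.1 then 7 else 8, F.2))]
  | t'.+1 => fun F p l => (p, (l, 0)) ::
      flatten [seq nodes (nth (nform0 t') F i) (i :: p) 6 | i <- iota 0 (size F)]
  end.

Definition var_elts (bs : seq (seq nat * nat)) : seq elt :=
  flatten [seq [seq ([::], (9 + i, x)) | x <- (nth ([::], 0) bs i).1] | i <- iota 0 (size bs)].

Definition elts t (F : nform nat t) bs : seq elt := nodes F [::] 5 ++ var_elts bs.

Fixpoint nform_holds (P : pred nat) (conj : bool) (t : nat) : nform nat t -> bool :=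
  match t return nform nat t -> bool with
  | 0 => fun F => P F.2 == F.1
  | t'.+1 => fun F =>
      if conj then all (@nform_holds P false t') F
      else has (@nform_holds P true t') F
  end.

Fixpoint nform_vars (t : nat) : nform nat t -> seq nat :=
  match t return nform nat t -> seq nat with
  | 0 => fun F => [:: F.2]
  | t'.+1 => fun F => flatten (map (@nform_vars t') F)
  end.

(** Compared up to twins, as an element is a whole twin class. The chosen variables sit at [o], ..,
    [o + n - 1] outside the innermost quantifier, hence the successor. *)
Definition RChosen o n :=
  RNot (RBigAnd (iota 0 n) (fun b => RNot (RTwin 0 (o + b).+1))).

(** Index 0 is the current node. Up to twins, a literal has a single outgoing edge, to its variable,
    so the existential quantifier there is no real choice. *)
Fixpoint RMatrix (t : nat) (conj : bool) (o n : nat) : rfo :=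
  match t with
  | 0 => REx (RAnd (REdge 1 0)
      (ROr (RAnd (RExactly 7 1) (RChosen o n)) (RAnd (RExactly 8 1) (RNot (RChosen o n)))))
  | t'.+1 =>
      if conj then RAll (RImp (REdge 1 0) (RMatrix t' false o.+1 n))
      else REx (RAnd (REdge 1 0) (RMatrix t' true o.+1 n))
  end.

Definition RRoot t n := REx (RAnd (RExactly 5 0) (RMatrix t true 1 n)).

Definition RGuard lab n :=
  RAnd (RExactly lab 0) (RBigAnd (iota 0 n) (fun b => RNot (RTwin 0 b.+1))).

(** The guard demands a variable of the block that differs from all earlier picks, so [k] picks from
    a block amount to a set of size [k]. *)
Definition RPick (q : bool * nat * nat) (r : rfo) : rfo :=
  if q.1.1 then REx (RAnd (RGuard q.1.2 q.2) r) else RAll (RImp (RGuard q.1.2 q.2) r).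

Definition RPicks t (qs : seq (bool * nat)) : rfo :=
  foldr RPick (RRoot t (size qs)) [seq (nth (false, 0) qs i, i) | i <- iota 0 (size qs)].

Definition picks (bs : seq (seq nat * nat)) : seq (bool * nat) :=
  flatten [seq nseq (nth ([::], 0) bs i).2 (~~ odd i, 9 + i) | i <- iota 0 (size bs)].

(** * Paths as identifiers of nodes *)

Section Nodes.

Lemma nodes_head t (F : nform nat t) p l :
  nodes F p l = head elt0 (nodes F p l) :: behead (nodes F p l).
Proof. by case: t F. Qed.

Lemma nodes_path t (F : nform nat t) p l x : x \in nodes F p l -> exists q, x.1 = q ++ p.
Proof.
elim: t F p l => [|t IH] F p l; first by rewrite inE => /eqP->; exists [::].
rewrite [nodes _ _ _]/= in_cons => /predU1P[->|]; first by exists [::].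
case/flatten_mapP => i _ /IH[q ->]; exists (rcons q i).
by rewrite cat_rcons.
Qed.

Lemma nodes_label t (F : nform nat t) p l x : 5 <= l <= 6 -> x \in nodes F p l ->
  5 <= elt_label x <= 8.
Proof.
move=> hl; elim: t F p l hl => [|t IH] F p l hl.
  by rewrite inE => /eqP->; rewrite /elt_label /=; case: ifP.
rewrite [nodes _ _ _]/= in_cons => /predU1P[->|]; first by rewrite /elt_label /=; lia.
by case/flatten_mapP => i _; apply: IH.
Qed.

Lemma nodes_root_label t (F : nform nat t) p x : x \in nodes F p 6 -> elt_label x != 5.
Proof.
elim: t F p => [|t IH] F p.
  by rewrite inE => /eqP->; rewrite /elt_label /=; case: ifP.
rewrite [nodes _ _ _]/= in_cons => /predU1P[->|] //.
by case/flatten_mapP => i _; apply: IH.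
Qed.

Lemma cat_cons_inj (q q' p : seq nat) i j : q ++ i :: p = q' ++ j :: p -> q = q' /\ i = j.
Proof.
move=> e; have sz : size q = size q' by move/(congr1 size): e; rewrite !size_cat /=; lia.
by move/eqP: e; rewrite eqseq_cat // => /andP[/eqP-> /eqP[]].
Qed.

Lemma uniq_nodes t (F : nform nat t) p l : uniq (nodes F p l).
Proof.
elim: t F p l => [//|t IH] F p l; rewrite [nodes _ _ _]/= cons_uniq; apply/andP; split.
  apply/flatten_mapP => -[i _ /nodes_path[q] /=] /(congr1 size).
  by rewrite size_cat /=; lia.
elim: (iota 0 (size F)) (iota_uniq 0 (size F)) => //= i s IHs /andP[nis us].
rewrite cat_uniq IH IHs // andbT; apply/hasPn => x /flatten_mapP[j js /nodes_path[q hq]].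
apply/negP => /nodes_path[q']; rewrite hq => /cat_cons_inj[_ e].
by rewrite -e js in nis.
Qed.

(** The entry just before [p] in the path names the child whose subtree contains the node. *)
Lemma nodes_child t (F : nform nat t.+1) p l y j q : y \in nodes F p l ->
  y.1 = q ++ j :: p -> j < size F /\ y \in nodes (nth (nform0 t) F j) (j :: p) 6.
Proof.
rewrite [nodes _ _ _]/= in_cons => /predU1P[->|].
  by move/(congr1 size); rewrite size_cat /=; lia.
case/flatten_mapP => i; rewrite mem_iota => hi yi e.
have [q' hq'] := nodes_path yi; rewrite hq' in e; have [_ ij] := cat_cons_inj e.
by subst j; split=> //; case/andP: hi.
Qed.

Lemma nodes_top t (F : nform nat t) p l y : y \in nodes F p l -> y.1 = p ->
  y = head elt0 (nodes F p l).
Proof.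
case: t F => [|t] F; first by rewrite inE => /eqP.
rewrite [nodes _ _ _]/= in_cons => /predU1P[->//|/flatten_mapP[i _ /nodes_path[q ->]]].
by move/(congr1 size); rewrite size_cat /=; lia.
Qed.

End Nodes.

Section Elts.
Variables (t : nat) (F : nform nat t) (bs : seq (seq nat * nat)).

Let els := elts F bs.

Lemma var_eltsP x : reflect (exists i, [/\ i < size bs, x.1 = [::], elt_label x = 9 + i &
   elt_var x \in (nth ([::], 0) bs i).1]) (x \in var_elts bs).
Proof.
apply: (iffP flatten_mapP) => [[i]|[i [hi x1 x2 xv]]].
  by rewrite mem_iota => hi /mapP[v hv ->]; exists i.
exists i; first by rewrite mem_iota.
by apply/mapP; exists (elt_var x) => //; case: x x1 x2 {xv} => [? [? ?]] /= -> <-.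
Qed.

Lemma elts_label x : x \in els -> 5 <= elt_label x.
Proof.
rewrite mem_cat => /orP[h|/var_eltsP[i [_ _ -> _]]]; last by lia.
by have := nodes_label (l := 5) isT h; lia.
Qed.

Lemma elts_node x : x \in els -> elt_label x <= 8 -> x \in nodes F [::] 5.
Proof. by rewrite mem_cat => /orP[//|/var_eltsP[i [_ _ -> _]]]; lia. Qed.

Lemma elts_var x : x \in els -> 9 <= elt_label x -> x \in var_elts bs.
Proof. by rewrite mem_cat => /orP[h|//]; have := nodes_label (l := 5) isT h; lia. Qed.

Lemma elts_gt0 : 0 < size els.
Proof. by rewrite /els /elts size_cat nodes_head. Qed.

Lemma elt_edge_irr x : x \in els -> elt_edge x x = false.
Proof.
move=> _; rewrite /elt_edge; case: ifP => h; first by case: leqP h => //; lia.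
apply/negP => /andP[/andP[_ ne] /eqP e]; case: (x.1) ne e => // a s _ /= /(congr1 size) /=; lia.
Qed.

Hypothesis bs_uniq : uniq (flatten (map fst bs)).

Lemma block_of_var v i j : i < size bs -> j < size bs ->
  v \in (nth ([::], 0) bs i).1 -> v \in (nth ([::], 0) bs j).1 -> i = j.
Proof.
move: bs_uniq; elim: bs i j => //= b s IH [|i] [|j] //=; rewrite cat_uniq ?ltnS.
- move=> /and3P[_ /hasPn h _] _ js vi vj.
  have vs : v \in flatten (map fst s).
    by apply/flatten_mapP; exists (nth ([::], 0) s j) => //; apply: mem_nth.
  by have := h v vs; rewrite /= vi.
- move=> /and3P[_ /hasPn h _] js _ vj vi.
  have vs : v \in flatten (map fst s).
    by apply/flatten_mapP; exists (nth ([::], 0) s i) => //; apply: mem_nth.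
  by have := h v vs; rewrite /= vi.
- by move=> /and3P[_ _ us] hi hj vi vj; congr _.+1; apply: IH vi vj.
Qed.

(** The blocks are disjoint, so a variable determines its block and with it its label. *)
Lemma var_elt_inj x y : x \in els -> y \in els -> 9 <= elt_label x -> 9 <= elt_label y ->
  elt_var x = elt_var y -> x = y.
Proof.
move=> xe ye lx ly e.
have /var_eltsP[i [hi x1 x2 xv]] := elts_var xe lx.
have /var_eltsP[j [hj y1 y2 yv]] := elts_var ye ly.
rewrite -e in yv; have ij := block_of_var hi hj xv yv.
case: x y e x1 x2 y1 y2 {xe ye lx ly xv yv} => [p [l v]] [p' [l' v']].
by rewrite /elt_var /elt_label /= => -> -> -> -> ->; rewrite ij.
Qed.

Lemma elts_uniq : uniq els.
Proof.
rewrite cat_uniq uniq_nodes /=; apply/andP; split.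
  apply/hasPn => x /var_eltsP[i [_ _ xl _]]; apply/negP => h.
  by have := nodes_label (l := 5) isT h; rewrite xl; lia.
have sub s : uniq s -> {subset s <= iota 0 (size bs)} ->
    uniq (flatten [seq [seq (([::], (9 + i, x)) : elt) | x <- (nth ([::], 0) bs i).1] | i <- s]).
  elim: s => //= i s IH /andP[nis us] sub; rewrite cat_uniq IH // ?andbT; last first.
    by move=> j js; apply: sub; rewrite inE js orbT.
  apply/andP; split.
    rewrite map_inj_uniq => [|x y []//]; have : i \in iota 0 (size bs).
      by apply: sub; rewrite inE eqxx.
    rewrite mem_iota add0n => /andP[_]; move: bs_uniq.
    elim: bs i {nis sub} => //= b s' IHs [|i] /=; rewrite cat_uniq => /and3P[] //.
    by move=> _ _ us' /(IHs _ us').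
  apply/hasPn => x /flatten_mapP[j js /mapP[v _ ->]]; apply/mapP => -[v' _ [e _]].
  have ij : j = i by lia.
  by rewrite -ij js in nis.
exact: sub (iota_uniq _ _) _.
Qed.

End Elts.

(** The common ground of the sentence and the propositional formula: variables are picked one at a
    time, and [C] collects the picks of all blocks. *)
Fixpoint pick_game (blk : nat -> seq nat) (M : seq nat -> Prop)
    (qs : seq (bool * nat)) (C : seq nat) : Prop :=
  match qs with
  | [::] => M C
  | (ex, lab) :: qs' =>
      if ex then exists x, [/\ x \in blk lab, x \notin C & pick_game blk M qs' (x :: C)]
      else forall x, x \in blk lab -> x \notin C -> pick_game blk M qs' (x :: C)
  end.

Definition block_of (bs : seq (seq nat * nat)) (lab : nat) : seq nat :=
  (nth ([::], 0) bs (lab - 9)).1.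

(** * Truth of the sentence as a picking game *)

Section Semantics.
Variables (tau : seq bool) (t : nat) (F : nform nat t) (bs : seq (seq nat * nat)).
Hypothesis t_gt0 : 0 < t.
Hypothesis bs_uniq : uniq (flatten (map fst bs)).
Hypothesis F_vars : {subset nform_vars F <= flatten (map fst bs)}.

Let els := elts F bs.
Definition qbf_graph := digraph_graph tau elt0 els elt_label elt_edge.
Let G := qbf_graph.
Let V := 'I_(order G).
Implicit Types (u v : V) (e : nat -> V).

Let is_elt : V -> bool := @is_element tau _ elt0 els elt_label elt_edge.
Let elt_of : V -> elt := @element tau _ elt0 els elt_label elt_edge.

Let gt0 := elts_gt0 F bs.
Let uniq_els := elts_uniq F bs_uniq.
Let ge5 := @elts_label t F bs.
Let irr := @elt_edge_irr t F bs.

Lemma rholds_elt_edge i j e : rholds (@adj G) (REdge i j) e <->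
  [/\ is_elt (e i), is_elt (e j) & elt_edge (elt_of (e i)) (elt_of (e j))].
Proof. exact: (rholds_edge gt0 uniq_els ge5 irr). Qed.

Lemma rholds_elt_label m i e : 5 <= m ->
  rholds (@adj G) (RExactly m i) e <-> is_elt (e i) /\ elt_label (elt_of (e i)) = m.
Proof. exact: (rholds_label gt0 uniq_els ge5). Qed.

Lemma elt_of_mem u : is_elt u -> elt_of u \in els.
Proof. exact: (element_mem gt0 uniq_els ge5). Qed.

Lemma elt_of_onto x : x \in els -> exists2 u, is_elt u & elt_of u = x.
Proof. exact: (element_onto tau elt0 elt_edge gt0 uniq_els ge5). Qed.

Lemma elt_of_inj u v : is_elt u -> is_elt v -> base u = base v <-> elt_of u = elt_of v.
Proof. exact: (element_inj gt0 uniq_els ge5). Qed.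

Lemma rholds_elt_twin i j e : rholds (@adj G) (RTwin i j) e <-> base (e i) = base (e j).
Proof.
by apply: rholds_twin; [exact: gt0 | exact: (multiplicity_gt0 elt0 elt_edge gt0 uniq_els ge5)].
Qed.

Lemma rholds_chosen o n v e : rholds (@adj G) (RChosen o n) (scons v e) <->
  exists2 b, b < n & base v = base (e (o + b)).
Proof.
rewrite /RChosen rholds_not rholds_bigand; split=> [h|[b bn E] h].
  apply: NNPP => no; apply: h => b; rewrite mem_iota rholds_not => bn tw; apply: no.
  by exists b => //; apply/(rholds_elt_twin 0 (o + b).+1 (scons v e)).
have := h b; rewrite mem_iota rholds_not => /(_ bn); apply.
exact/rholds_elt_twin.
Qed.

Local Opaque REdge RExactly RChosen RTwin RBigAnd.

(** Induction over the subformula at path [p]. The completeness hypothesis says that no element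
    outside the subtree has a path ending in [p], so the edges leaving the current node lead exactly
    to the roots of the immediate subformulas. The last hypothesis reads [C] off the chosen
    vertices. *)
Lemma rholds_matrix (C : seq nat) t' (F' : nform nat t') p l conj o n e :
  is_elt (e 0) -> elt_of (e 0) = head elt0 (nodes F' p l) -> 5 <= l <= 6 ->
  {subset nodes F' p l <= els} ->
  (forall y q, y \in els -> elt_label y <= 8 -> y.1 = q ++ p -> y \in nodes F' p l) ->
  {subset nform_vars F' <= flatten (map fst bs)} ->
  (forall v, is_elt v -> 9 <= elt_label (elt_of v) ->
     (elt_var (elt_of v) \in C) <-> exists2 b, b < n & base v = base (e (o + b))) ->
  rholds (@adj G) (RMatrix t' conj o n) e <-> nform_holds [in C] conj F'.
Proof.
elim: t' F' p l conj o e => [|t' IH] F' p l conj o e e0 top hl sub complete vars hC.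
  have lab0 : elt_label (elt_of (e 0)) = if F'.1 then 7 else 8 by rewrite top.
  have var0 : elt_var (elt_of (e 0)) = F'.2 by rewrite top.
  have edge v : is_elt v -> elt_edge (elt_of (e 0)) (elt_of v) =
      (9 <= elt_label (elt_of v)) && (F'.2 == elt_var (elt_of v)).
    move=> ev; rewrite /elt_edge var0 lab0.
    by case: F'.1 => /=; case: ifP.
  rewrite [RMatrix _ _ _ _]/= rholds_ex.
  have inner v : is_elt v -> 9 <= elt_label (elt_of v) -> F'.2 = elt_var (elt_of v) ->
      rholds (@adj G) (ROr (RAnd (RExactly 7 1) (RChosen o n))
         (RAnd (RExactly 8 1) (RNot (RChosen o n)))) (scons v e) <->
      nform_holds [in C] conj F'.
    move=> ev lv xv; rewrite rholds_or (rholds_and _ (RExactly 7 1)) (rholds_and _ (RExactly 8 1)).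
    rewrite !rholds_elt_label // (rholds_not _ (RChosen _ _)) !rholds_chosen.
    rewrite [scons v e 1]/= -hC // -xv lab0.
    rewrite [nform_holds _ _ _]/= [F'.2 \in _]/=; case: (F'.1); case: (F'.2 \in C) => /=;
      by split=> //; intuition.
  split=> [[v]|h].
    rewrite rholds_and rholds_elt_edge => -[[_ ev ed]].
    have := ed : elt_edge (elt_of (e 0)) (elt_of v); rewrite edge // => /andP[lv /eqP xv].
    exact: (proj1 (inner v ev lv xv)).
  (* The blocks cover all variables, so the variable of the literal is an element. *)
  have /flatten_mapP[b bin xb] : F'.2 \in flatten (map fst bs) by apply: vars; rewrite inE.
  have hi : index b bs < size bs by rewrite index_mem.
  have xe : ([::], (9 + index b bs, F'.2)) \in els.
    rewrite mem_cat; apply/orP; right; apply/var_eltsP; exists (index b bs).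
    by split=> //; rewrite nth_index.
  have [v ev hv] := elt_of_onto xe; exists v; rewrite rholds_and rholds_elt_edge.
  have lv : 9 <= elt_label (elt_of v) by rewrite hv.
  have xv : F'.2 = elt_var (elt_of v) by rewrite hv.
  split; last exact: (proj2 (inner v ev lv xv)).
  split=> //; rewrite -/(is_true _); change (elt_edge (elt_of (e 0)) (elt_of v)).
  by rewrite edge // lv xv /=.
have lab0 : elt_label (elt_of (e 0)) = l by rewrite top.
have p0 : (elt_of (e 0)).1 = p by rewrite top.
have subi i : i < size F' -> {subset nodes (nth (nform0 t') F' i) (i :: p) 6 <= nodes F' p l}.
  move=> iF x xi; rewrite [nodes F' p l]/= in_cons; apply/orP; right.
  by apply/flatten_mapP; exists i => //; rewrite mem_iota.
have step i v ex : i < size F' -> is_elt v ->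
    elt_of v = head elt0 (nodes (nth (nform0 t') F' i) (i :: p) 6) ->
    rholds (@adj G) (RMatrix t' ex o.+1 n) (scons v e) <->
    nform_holds [in C] ex (nth (nform0 t') F' i).
  move=> iF ev tv; apply: (IH _ (i :: p) 6) => //.
  - by move=> x /(subi _ iF) /sub.
  - move=> y q ye ly yq; have yn : y \in nodes F' p l.
      by apply: (complete _ (rcons q i)) => //; rewrite cat_rcons.
    by have [] := nodes_child yn yq.
  - move=> x xi; apply: vars; rewrite [nform_vars F']/=; apply/flattenP.
    exists (nform_vars (nth (nform0 t') F' i)) => //.
    by rewrite -(nth_map _ [::] (@nform_vars t')) //; apply: mem_nth; rewrite size_map.
have toi v : is_elt v -> elt_edge (elt_of (e 0)) (elt_of v) -> exists2 i, i < size F' &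
    elt_of v = head elt0 (nodes (nth (nform0 t') F' i) (i :: p) 6).
  move=> ev; rewrite /elt_edge lab0 p0; case: ifP => [_|lv]; first by lia.
  case/andP => /andP[_]; case E: (elt_of v).1 => [//|i s] _ /= /eqP sp; subst s.
  have yn : elt_of v \in nodes F' p l.
    by apply: (complete _ [:: i]) => //; [exact: elt_of_mem | lia].
  have [iF yi] := nodes_child yn (E : _ = [::] ++ i :: p).
  by exists i => //; apply: nodes_top yi E.
have ofi i : i < size F' -> exists2 v, is_elt v & elt_edge (elt_of (e 0)) (elt_of v) /\
    elt_of v = head elt0 (nodes (nth (nform0 t') F' i) (i :: p) 6).
  move=> iF; set x := head _ _.
  have xi : x \in nodes (nth (nform0 t') F' i) (i :: p) 6 by rewrite nodes_head inE eqxx.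
  have [v ev hv] := elt_of_onto (sub _ (subi _ iF _ xi)); exists v => //; split=> //.
  have xp : x.1 = i :: p by rewrite /x; case: (t') (nth _ _ _).
  rewrite hv /elt_edge lab0 p0 xp /= eqxx; have := nodes_label (l := 6) isT xi.
  by case: ifP; lia.
rewrite [RMatrix _ _ _ _]/= [nform_holds _ _ _]/=; case: conj.
  rewrite rholds_all; split=> [h|/(all_nthP (nform0 t')) h v].
    apply/(all_nthP (nform0 t')) => i iF; have [v ev [ed hv]] := ofi i iF.
    have := h v; rewrite rholds_imp rholds_elt_edge => /(_ (And3 e0 ev ed)).
    by move/(step i v false iF ev hv).
  rewrite rholds_imp rholds_elt_edge => -[_ ev /(toi _ ev)[i iF hv]].
  exact/(step i v false iF ev hv)/h.
rewrite rholds_ex; split=> [[v]|/(has_nthP (nform0 t'))[i iF h]].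
  rewrite rholds_and rholds_elt_edge => -[[_ ev /(toi _ ev)[i iF hv]]].
  by move/(step i v true iF ev hv) => h; apply/(has_nthP (nform0 t')); exists i.
have [v ev [ed hv]] := ofi i iF; exists v; rewrite rholds_and rholds_elt_edge.
by split=> //; apply/(step i v true iF ev hv).
Qed.

Lemma rholds_root n e :
  (forall b, b < n -> is_elt (e b) /\ 9 <= elt_label (elt_of (e b))) ->
  rholds (@adj G) (RRoot t n) e <->
  nform_holds [in [seq elt_var (elt_of (e b)) | b <- iota 0 n]] true F.
Proof.
move=> he; set C := map _ _.
have main v : is_elt v -> elt_of v = head elt0 (nodes F [::] 5) ->
    rholds (@adj G) (RMatrix t true 1 n) (scons v e) <-> nform_holds [in C] true F.
  move=> ev tv; apply: (rholds_matrix (p := [::]) (l := 5)) => //.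
  - by move=> x xn; rewrite mem_cat xn.
  - by move=> y q ye ly _; apply: elts_node ye ly.
  - move=> w ew lw; split=> [/mapP[b]|[b bn hb]].
      rewrite mem_iota => bn E; have [eb lb] := he b bn; exists b => //.
      apply/elt_of_inj => //; apply: (var_elt_inj bs_uniq (F := F)) => //; exact: elt_of_mem.
    have [eb lb] := he b bn; apply/mapP; exists b; first by rewrite mem_iota.
    by move: hb => /(elt_of_inj ew eb) /= ->.
rewrite /RRoot rholds_ex; split=> [[v]|h].
  rewrite rholds_and rholds_elt_label // => -[[ev lv] h]; apply: (proj1 (main v ev _) h).
  have lv' : elt_label (elt_of v) = 5 := lv.
  have := elts_node (elt_of_mem ev); rewrite lv' => /(_ isT).
  (* As [0 < t], the root is an inner node with label 5, and no other node has this label. *)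
  case: t t_gt0 F main => // t' _ F' _; rewrite [nodes _ _ _]/= inE => /predU1P[-> //|].
  by case/flatten_mapP => i _ /nodes_root_label; rewrite lv'.
have xe : head elt0 (nodes F [::] 5) \in els by rewrite mem_cat nodes_head inE eqxx.
have [v ev hv] := elt_of_onto xe; exists v; rewrite rholds_and rholds_elt_label //.
split; last exact: (proj2 (main v ev hv) h).
split=> //; change (elt_label (elt_of v) = 5).
by rewrite hv; case: t t_gt0 F {main h xe hv}.
Qed.

(** The structural form of [RPicks], suited to induction; the fold over indexed entries is the form
    for which a program is built. *)
Fixpoint RPicksFrom (qs : seq (bool * nat)) (n : nat) : rfo :=
  if qs is q :: qs' then RPick (q, n) (RPicksFrom qs' n.+1) else RRoot t n.

Lemma RPicksE qs : RPicks t qs = RPicksFrom qs 0.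
Proof.
suff gen n : foldr RPick (RRoot t (n + size qs))
    [seq (nth (false, 0) qs i, n + i) | i <- iota 0 (size qs)] = RPicksFrom qs n.
  by have := gen 0.
elim: qs n => [|q qs IH] n; first by rewrite /= addn0.
have -> : [seq (nth (false, 0) (q :: qs) i, n + i) | i <- iota 0 (size (q :: qs))] =
    (q, n) :: [seq (nth (false, 0) qs i, n.+1 + i) | i <- iota 0 (size qs)].
  rewrite /= addn0 (iotaDl 1 0) -map_comp; congr (_ :: _).
  by apply: eq_map => i /=; rewrite addnS.
by rewrite [foldr _ _ _]/= [RPicksFrom _ _]/= -IH addSnnS.
Qed.

Lemma rholds_picks qs n e :
  (forall b, b < n -> is_elt (e b) /\ 9 <= elt_label (elt_of (e b))) ->
  (forall q, q \in qs -> 9 <= q.2 < 9 + size bs) ->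
  rholds (@adj G) (RPicksFrom qs n) e <->
  pick_game (block_of bs) (fun C => nform_holds [in C] true F) qs
    [seq elt_var (elt_of (e b)) | b <- iota 0 n].
Proof.
elim: qs n e => [|[ex lab] qs IH] n e he hq; first exact: rholds_root.
have hqs q : q \in qs -> 9 <= q.2 < 9 + size bs by move=> qq; apply: hq; rewrite inE qq orbT.
have [lab9 labN] : 9 <= lab /\ lab - 9 < size bs.
  by have := hq (ex, lab); rewrite inE eqxx => /(_ isT) /=; lia.
set C := map _ _.
have guard v : rholds (@adj G) (RGuard lab n) (scons v e) <->
    [/\ is_elt v, elt_label (elt_of v) = lab & elt_var (elt_of v) \notin C].
  rewrite /RGuard rholds_and rholds_elt_label ?rholds_bigand; last by lia.
  rewrite [scons v e 0]/=; split=> [[[ev lv] h]|[ev lv nC]].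
    split=> //; apply/mapP => -[b]; rewrite mem_iota => bn E.
    have := h b; rewrite mem_iota => /(_ bn); rewrite rholds_not; apply.
    apply/rholds_elt_twin; have [eb lb] := he b bn.
    apply/elt_of_inj => //; apply: (var_elt_inj bs_uniq (F := F)) => //; try exact: elt_of_mem.
    by rewrite lv.
  split=> // b; rewrite mem_iota rholds_not => bn /rholds_elt_twin /=.
  have [eb lb] := he b bn; move/(elt_of_inj ev eb) => E; case/negP: nC.
  by apply/mapP; exists b; rewrite ?mem_iota // E.
have next v : is_elt v -> elt_label (elt_of v) = lab ->
    rholds (@adj G) (RPicksFrom qs n.+1) (scons v e) <->
    pick_game (block_of bs) (fun C => nform_holds [in C] true F) qs
       (elt_var (elt_of v) :: C).
  move=> ev lv; rewrite IH //; last by case=> [|b] bn /=; [rewrite lv | apply: he].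
  by rewrite [iota 0 n.+1]/= (iotaDl 1 0) map_cons -map_comp.
have toblk v : is_elt v -> elt_label (elt_of v) = lab -> elt_var (elt_of v) \in block_of bs lab.
  move=> ev lv; have : 9 <= elt_label (elt_of v) by rewrite lv.
  move/(elts_var (elt_of_mem ev))/var_eltsP=> [i [hi _ li hx]].
  by rewrite /block_of -lv li addKn.
have ofblk x : x \in block_of bs lab ->
    exists v, [/\ is_elt v, elt_label (elt_of v) = lab & elt_var (elt_of v) = x].
  move=> hx; have xe : ([::], (lab, x)) \in els.
    rewrite mem_cat; apply/orP; right; apply/var_eltsP; exists (lab - 9).
    by split=> //; rewrite /elt_label /=; lia.
  by have [v ev hv] := elt_of_onto xe; exists v; rewrite hv.
rewrite [RPicksFrom _ _]/= [pick_game _ _ _ _]/= /RPick [_.1.1]/= [_.1.2]/= [_.2]/=.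
case: ex {hq}; rewrite ?rholds_ex ?rholds_all.
- split=> [[v]|[x [/ofblk[v [ev lv <-]] xC h]]].
    rewrite rholds_and guard => -[[ev lv nC] /(next v ev lv) h].
    by exists (elt_var (elt_of v)); split=> //; apply: toblk.
  by exists v; rewrite rholds_and guard; split=> //; apply/(next v ev lv).
- split=> [h x /ofblk[v [ev lv <-]] xC|h v].
    by have := h v; rewrite rholds_imp guard => /(_ (And3 ev lv xC)) /(next v ev lv).
  rewrite rholds_imp guard => -[ev lv nC]; apply/(next v ev lv)/h => //.
  exact: toblk.
Qed.

End Semantics.

(** * Weighted blocks as sequences of picks *)

Fixpoint raw_nform (m t : nat) : nform 'I_m t -> nform nat t :=
  match t return nform 'I_m t -> nform nat t with
  | 0 => fun F => (F.1, val F.2)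
  | t'.+1 => fun F => map (@raw_nform m t') F
  end.

Definition raw_blocks m (bs : seq ({set 'I_m} * nat)) : seq (seq nat * nat) :=
  [seq (map val (enum (a.1 : {set 'I_m})), a.2) | a : {set 'I_m} * nat <- bs].

Lemma enc_raw_nform m t (F : nform 'I_m t) :
  enc_nform (fun x : 'I_m => enc_nat x) F = enc_nform enc_nat (raw_nform F).
Proof. by elim: t F => //= t IH; elim=> //= a F ->; rewrite IH. Qed.

Lemma nform_holds_raw m (T : {set 'I_m}) conj t (F : nform 'I_m t) (C : seq nat) :
  (forall y : 'I_m, (y \in T) = (val y \in C)) ->
  nform_sat T conj F = nform_holds [in C] conj (raw_nform F).
Proof.
move=> TC; elim: t conj F => [|t IH] conj F /=; first by rewrite TC.
by case: conj; elim: F => //= a F ->; rewrite IH.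
Qed.

Fixpoint picks_from (i : nat) (ex : bool) (bs : seq (seq nat * nat)) : seq (bool * nat) :=
  if bs is b :: bs' then nseq b.2 (ex, 9 + i) ++ picks_from i.+1 (~~ ex) bs' else [::].

Lemma picksE bs : picks bs = picks_from 0 true bs.
Proof.
suff gen k : flatten [seq nseq (nth ([::], 0) bs i).2 (~~ odd (k + i), 9 + (k + i)) |
    i <- iota 0 (size bs)] = picks_from k (~~ odd k) bs by exact: gen 0.
elim: bs k => //= b bs IH k; rewrite addn0 -[~~ ~~ odd k]/(~~ odd k.+1) -IH.
rewrite (iotaDl 1 0) -map_comp; congr (_ ++ flatten _); apply: eq_map => i /=.
by rewrite addnS addSn.
Qed.

Section Game.
Variables (m : nat) (blk : nat -> seq nat) (M' : seq nat -> Prop).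
Implicit Types (s T U : {set 'I_m}) (C : seq nat).

Definition agree T C := forall y : 'I_m, (y \in T) = (val y \in C).

Lemma agree_cons T C x : agree T C -> agree (x |: T) (val x :: C).
Proof. by move=> TC y; rewrite !inE TC. Qed.

Definition is_block lab s := blk lab = map val (enum s).

Lemma mem_block lab s x
    : is_block lab s -> x \in blk lab -> exists2 y, y \in s & x = val y.
Proof. by move=> -> /mapP[y]; rewrite mem_enum => ys ->; exists y. Qed.

Lemma block_mem lab s (y : 'I_m) : is_block lab s -> (val y \in blk lab) = (y \in s).
Proof. by move=> ->; rewrite mem_map ?mem_enum //; apply: val_inj. Qed.

(** A set of size [k] is picked element by element. The hypothesis on [Q] is limited to sets between
    [T] and [T :|: s]: play inside the block reaches nothing else, and later blocks stay disjoint
    from such sets. *)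
Lemma pick_game_ex lab s k qs T C (Q : {set 'I_m} -> Prop) :
  is_block lab s -> agree T C ->
  (forall T' C', agree T' C' -> T \subset T' -> T' \subset T :|: s ->
     Q T' <-> pick_game blk M' qs C') ->
  (exists U, [/\ U \subset s :\: T, #|U| = k & Q (T :|: U)]) <->
  pick_game blk M' (nseq k (true, lab) ++ qs) C.
Proof.
move=> ls; elim: k T C => [|k IH] T C TC hQ /=.
  rewrite -(hQ T C) ?subxx ?subsetUl //; split=> [[U [_ /eqP]]|QT].
    by rewrite cards_eq0 => /eqP->; rewrite setU0.
  by exists set0; rewrite sub0set cards0 setU0.
have hQ' x : x \in s -> forall T' C', agree T' C' -> x |: T \subset T' ->
    T' \subset (x |: T) :|: s -> Q T' <-> pick_game blk M' qs C'.
  move=> xs T' C' TC' sub sub'; apply: hQ => //.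
    by apply: subset_trans sub; apply: subsetUr.
  apply: subset_trans sub' _; rewrite -setUA subUset subxx andbT sub1set.
  by rewrite inE xs orbT.
split=> [[U [sub cU QU]]|[_ [/(mem_block ls)[x xs ->] xC h]]].
  have /card_gt0P[x xU] : 0 < #|U| by rewrite cU.
  have := subsetP sub x xU; rewrite inE => /andP[xT xs].
  exists (val x); rewrite (block_mem _ ls) xs -TC xT; split=> //.
  apply/(IH (x |: T)); [exact: agree_cons | exact: hQ' |].
  exists (U :\ x); split.
  - apply/subsetP => y; rewrite !inE => /andP[yx yU]; rewrite (negbTE yx) /=.
    by have := subsetP sub y yU; rewrite inE.
  - by have := cardsD1 x U; rewrite xU cU => -[].
  - by rewrite -setUA setUCA setD1K // ; move: QU; rewrite setUC [in X in _ -> X]setUC.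
rewrite -TC in xC; move/(IH (x |: T)): h => [||U [sub cU QU]]; [exact: agree_cons | exact: hQ' |].
have xU : x \notin U by apply/negP => /(subsetP sub); rewrite !inE eqxx.
exists (x |: U); split.
- apply/subsetP => y; rewrite in_setU1 => /predU1P[->|/(subsetP sub)].
    by rewrite inE xC.
  by rewrite !inE negb_or -andbA => /and3P[_ -> ->].
- by rewrite cardsU1 xU cU.
- by rewrite setUCA setUA.
Qed.

Lemma pick_game_all lab s k qs T C (Q : {set 'I_m} -> Prop) :
  is_block lab s -> agree T C ->
  (forall T' C', agree T' C' -> T \subset T' -> T' \subset T :|: s ->
     Q T' <-> pick_game blk M' qs C') ->
  (forall U, U \subset s :\: T -> #|U| = k -> Q (T :|: U)) <->
  pick_game blk M' (nseq k (false, lab) ++ qs) C.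
Proof.
move=> ls; elim: k T C => [|k IH] T C TC hQ /=.
  rewrite -(hQ T C) ?subxx ?subsetUl //; split=> [h|QT U _ /eqP].
    by have := h set0; rewrite sub0set cards0 setU0; apply.
  by rewrite cards_eq0 => /eqP->; rewrite setU0.
have hQ' x : x \in s -> forall T' C', agree T' C' -> x |: T \subset T' ->
    T' \subset (x |: T) :|: s -> Q T' <-> pick_game blk M' qs C'.
  move=> xs T' C' TC' sub sub'; apply: hQ => //.
    by apply: subset_trans sub; apply: subsetUr.
  apply: subset_trans sub' _; rewrite -setUA subUset subxx andbT sub1set.
  by rewrite inE xs orbT.
split=> [h _ /(mem_block ls)[x xs ->] xC|h U sub cU].
  rewrite -TC in xC; apply/(IH (x |: T)); [exact: agree_cons | exact: hQ' |].
  move=> U sub cU; have xU : x \notin U by apply/negP => /(subsetP sub); rewrite !inE eqxx.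
  rewrite -setUA setUCA; apply: h; last by rewrite cardsU1 xU cU.
  apply/subsetP => y; rewrite in_setU1 => /predU1P[->|/(subsetP sub)].
    by rewrite inE xC.
  by rewrite !inE negb_or -andbA => /and3P[_ -> ->].
(* Any element of [U] may serve as the first pick of the opponent. *)
have /card_gt0P[x xU] : 0 < #|U| by rewrite cU.
have := subsetP sub x xU; rewrite inE => /andP[xT xs].
have hx : val x \in blk lab by rewrite (block_mem _ ls).
have xC : val x \notin C by rewrite -TC.
have := h _ hx xC; move/(IH (x |: T)) => /(_ (agree_cons x TC) (hQ' x xs) (U :\ x)) H.
rewrite -(setD1K xU) setUCA setUA; apply: H.
  apply/subsetP => y; rewrite !inE => /andP[yx yU]; rewrite (negbTE yx) /=.
  by have := subsetP sub y yU; rewrite inE.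
by have := cardsD1 x U; rewrite xU cU => -[].
Qed.

Lemma qblocks_game M bs i ex T C :
  (forall j, j < size bs -> is_block (9 + (i + j)) (nth (set0, 0) bs j).1) ->
  pairwise (fun A B : {set 'I_m} => [disjoint A & B]) (map fst bs) ->
  (forall A, A \in map fst bs -> [disjoint A & T]) ->
  (forall T C, agree T C -> M T <-> M' C) -> agree T C ->
  qblocks_sat M ex bs T <-> pick_game blk M' (picks_from i ex (raw_blocks bs)) C.
Proof.
move=> + + + hM; elim: bs i ex T C => [|[s k] bs IH] i ex T C hblk; first by move=> _ _; apply: hM.
rewrite [pairwise _ _]/= => /andP[/allP ds pw] dT TC.
have ls : is_block (9 + i) s by have := hblk 0 isT; rewrite addn0.
have sT : s :\: T = s.
  by apply/setDidPl; apply: dT; rewrite inE eqxx.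
have next T' C' : agree T' C' -> T \subset T' -> T' \subset T :|: s ->
    qblocks_sat M (~~ ex) bs T' <->
    pick_game blk M' (picks_from i.+1 (~~ ex) (raw_blocks bs)) C'.
  move=> TC' _ sub; apply: IH => // [j jb|A Abs].
    by have := hblk j.+1; rewrite /= ltnS addnS -addSn; apply.
  apply: disjointWr sub _; rewrite -setI_eq0 setIUr setU_eq0 !setI_eq0 dT ?inE ?Abs ?orbT //=.
  by rewrite disjoint_sym; apply: ds.
case: ex next => next.
  by have := pick_game_ex k ls TC next; rewrite sT => <-.
by have := pick_game_all k ls TC next; rewrite sT => <-.
Qed.

End Game.

(** * Well-scopedness of the sentence *)

Lemma scoped_bigand n s f : (forall b, b \in s -> scoped n (f b)) -> scoped n
    (RBigAnd s f).
Proof.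
elim: s => //= a s IH h; rewrite h ?inE ?eqxx //= IH // => b bs.
by rewrite h // inE bs orbT.
Qed.

Lemma scoped_twin n i j : i < n -> j < n -> scoped n (RTwin i j).
Proof. by move=> hi hj; rewrite /= !ltnS hi hj. Qed.

Lemma scoped_atleast n m i : i < n -> scoped n (RAtLeast m i).
Proof.
move=> hi; suff gen j : scoped (n + j) (foldr (RAtLeastStep i) RTrue (iota j m)).
  by have := gen 0; rewrite addn0.
elim: m j => // m IH j.
rewrite -[scoped _ _]/((scoped (n + j).+1 (RTwin 0 (i + j).+1) &&
  scoped (n + j).+1 (RBigAnd _ _)) &&
  scoped (n + j).+1 (foldr (RAtLeastStep i) RTrue (iota j.+1 m))).
rewrite -addnS IH andbT scoped_twin //=; [|lia..].
by apply: scoped_bigand => b; rewrite mem_iota /= => bj; lia.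
Qed.

Lemma scoped_exactly n m i : i < n -> scoped n (RExactly m i).
Proof.
by move=> hi; rewrite -[scoped _ _]/(scoped n (RAtLeast m i) && scoped n (RAtLeast m.+1 i))
  !scoped_atleast.
Qed.

Lemma scoped_same n m i j : i < n -> j < n -> scoped n (RSame m i j).
Proof.
move=> hi hj; rewrite -[scoped _ _]/(scoped n.+1 (RExactly m 0) && _) scoped_exactly //=.
by rewrite !ltnS hi hj.
Qed.

Lemma scoped_edge n i j : i < n -> j < n -> scoped n (REdge i j).
Proof.
move=> hi hj; rewrite -[scoped _ _]/((scoped n (RAtLeast 5 i) && scoped n (RAtLeast 5 j)) &&
  (scoped n.+1 (RExactly 4 0) && (scoped n.+1 (RSame 1 0 i.+1) && scoped n.+1 (RSame 2 0 j.+1)))).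
by rewrite !scoped_atleast // scoped_exactly // !scoped_same.
Qed.

Lemma scoped_chosen n o k : o + k < n -> scoped n (RChosen o k).
Proof.
move=> h; rewrite -[scoped _ _]/(scoped n (RBigAnd _ _)); apply: scoped_bigand => b.
rewrite mem_iota => bk; rewrite -[scoped _ _]/(scoped n (RTwin _ _)).
by apply: scoped_twin; lia.
Qed.

Lemma scoped_matrix t conj o k n : 0 < n -> o + k <= n -> scoped n (RMatrix t conj o k).
Proof.
elim: t conj o n => [|t IH] conj o n n0 h.
  rewrite -[scoped _ _]/(scoped n.+1 (REdge 1 0) &&
   ((scoped n.+1 (RExactly 7 1) && scoped n.+1 (RChosen o k)) &&
    (scoped n.+1 (RExactly 8 1) && scoped n.+1 (RChosen o k)))).
  by rewrite scoped_edge // !scoped_exactly // scoped_chosen.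
have IH' c : scoped n.+1 (RMatrix t c o.+1 k) by apply: IH; rewrite ?addSn.
case: conj.
  rewrite -[scoped _ _]/(scoped n.+1 (REdge 1 0) && scoped n.+1 (RMatrix t false o.+1 k)).
  by rewrite scoped_edge // IH'.
rewrite -[scoped _ _]/(scoped n.+1 (REdge 1 0) && scoped n.+1 (RMatrix t true o.+1 k)).
by rewrite scoped_edge // IH'.
Qed.

Lemma scoped_picks t qs n : scoped n (RPicksFrom t qs n).
Proof.
elim: qs n => [|[ex lab] qs IH] n.
  rewrite -[scoped _ _]/(scoped n.+1 (RExactly 5 0) && scoped n.+1 (RMatrix t true 1 n)).
  by rewrite scoped_exactly // scoped_matrix.
have hg : scoped n.+1 (RGuard lab n).
  rewrite -[scoped _ _]/(scoped n.+1 (RExactly lab 0) && scoped n.+1 (RBigAnd _ _)).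
  rewrite scoped_exactly //; apply: scoped_bigand => b; rewrite mem_iota => bn.
  by rewrite -[scoped _ _]/(scoped n.+1 (RTwin _ _)) scoped_twin.
by case: ex; rewrite -[scoped _ _]/(scoped n.+1 (RGuard lab n) &&
  scoped n.+1 (RPicksFrom t qs n.+1)) hg IH.
Qed.

Lemma picks_from_label bs i ex q :
  q \in picks_from i ex bs -> 9 + i <= q.2 < 9 + i + size bs.
Proof.
elim: bs i ex => // b bs IH i ex; rewrite mem_cat => /orP[|/IH /=]; last by lia.
by rewrite mem_nseq => /andP[_ /eqP->] /=; lia.
Qed.

Section Correct.
Variables (tau : seq bool) (t : nat) (I : qbf t).
Hypothesis t_gt0 : 0 < t.
Let bs := raw_blocks (qblocks I).
Let F := raw_nform (qmatrix I).

Lemma raw_blocks_uniq : uniq (flatten (map fst bs)).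
Proof.
have := qdisjoint I; rewrite /bs; elim: (qblocks I) => //= -[s k] l IH /andP[/allP ds pw].
rewrite cat_uniq IH // map_inj_uniq ?enum_uniq ?andbT /=; last exact: val_inj.
apply/hasPn => x /flatten_mapP[_ /mapP[[s' k'] sl ->] /= /mapP[y]].
rewrite mem_enum => ys ->; rewrite mem_map ?mem_enum; last exact: val_inj.
have /ds : s' \in map fst l by apply/mapP; exists (s', k').
by move=> d; rewrite (disjointFl d ys).
Qed.

Lemma raw_nform_vars : {subset nform_vars F <= flatten (map fst bs)}.
Proof.
have all_in (y : 'I_(qvars I)) : val y \in flatten (map fst bs).
  have : y \in \bigcup_(A <- map fst (qblocks I)) A by rewrite qcover inE.
  rewrite /bs; elim: (qblocks I) => /= [|[s k] l IH]; first by rewrite big_nil inE.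
  rewrite big_cons inE mem_cat => /orP[ys|/IH->]; last by rewrite orbT.
  by rewrite mem_map ?mem_enum ?ys //; apply: val_inj.
suff h : all [in flatten (map fst bs)] (nform_vars F) by move=> x; apply/allP: x.
rewrite /F; move: (flatten _) (qvars I) (qmatrix I) all_in => L v F0 all_in.
elim: t F0 => [|t' IH] F' /=; first by rewrite all_in.
by elim: F' => //= a F' IHF; rewrite all_cat IH.
Qed.

Lemma qbf_formula_correct (e : nat -> 'I_(order (qbf_graph tau F bs))) :
  rholds (@adj (qbf_graph tau F bs)) (RPicks t (picks bs)) e <-> qbf_sat I.
Proof.
rewrite RPicksE rholds_picks //; try exact: raw_blocks_uniq; try exact: raw_nform_vars.
  rewrite /qbf_sat picksE; symmetry; apply: qblocks_game => //.
  - move=> j js; rewrite /is_block /block_of addKn add0n (nth_map (set0, 0)) //.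
  - exact: qdisjoint.
  - by move=> A _; rewrite -setI_eq0 setI0.
  - by move=> T C TC; rewrite (nform_holds_raw _ _ TC).
  - by move=> y; rewrite !inE.
by move=> q; rewrite picksE => /picks_from_label; rewrite addn0.
Qed.

End Correct.

(** * Computing the graph and the sentence *)

Notation eF := enc_rfo.
Notation eElt := (eP (eL eN) (eP eN eN)).
Notation eDesc := (eP eN (eP eN eN)).
Notation eVertex := (eP eDesc eN).
Notation eBlocks := (eL (eP (eL eN) eN)).
Notation eNform := (enc_nform enc_nat).

Lemma pt_eq_desc X (eX : X -> tree) (f g : X -> desc) :
  pt eX eDesc f -> pt eX eDesc g -> pt eX eB (fun x => f x == g x).
Proof.
move=> pf pg.
have h : pt eX eB (fun x => ((f x).1 == (g x).1) &&
    (((f x).2.1 == (g x).2.1) && ((f x).2.2 == (g x).2.2))) by pt_tac.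
by apply: pt_ext h => x; case: (f x) (g x) => [? [? ?]] [? [? ?]]; rewrite !xpair_eqE.
Qed.

Lemma pt_eq_vertex X (eX : X -> tree) (f g : X -> vertex) :
  pt eX eVertex f -> pt eX eVertex g -> pt eX eB (fun x => f x == g x).
Proof.
move=> pf pg.
have h : pt eX eB (fun x => ((f x).1 == (g x).1) && ((f x).2 == (g x).2)).
  by apply: pt_and; [apply: pt_eq_desc|]; pt_tac.
by apply: pt_ext h => x; case: (f x) (g x) => [? ?] [? ?]; rewrite xpair_eqE.
Qed.

Lemma pt_pattern_adj X (eX : X -> tree) tau (u v : X -> desc) :
  pt eX eDesc u -> pt eX eDesc v -> pt eX eB (fun x => pattern_adj tau (u x) (v x)).
Proof.
by move=> pu pv; rewrite /pattern_adj /pattern_core /interval_adj /interval_mem; pt_tac.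
Qed.

Lemma pt_vertex_adj X (eX : X -> tree) tau (u v : X -> vertex) :
  pt eX eVertex u -> pt eX eVertex v -> pt eX eB (fun x => vertex_adj tau (u x) (v x)).
Proof.
move=> pu pv; rewrite /vertex_adj; apply: pt_and.
  by apply/pt_neg/pt_eq_vertex.
by apply: pt_or; [apply: pt_eq_desc | apply: pt_pattern_adj]; pt_tac.
Qed.

Lemma pt_bases X (eX : X -> tree) (N : X -> nat) : pt eX eN N -> pt eX (eL eDesc)
    (fun x => bases (N x)).
Proof. by move=> pN; rewrite /bases; pt_tac. Qed.

Lemma pt_elt_edge X (eX : X -> tree) (u v : X -> elt) :
  pt eX eElt u -> pt eX eElt v -> pt eX eB (fun x => elt_edge (u x) (v x)).
Proof. by move=> pu pv; rewrite /elt_edge /elt_label /elt_var; pt_tac. Qed.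

Ltac pt_user ::= simple eapply pt_elt_edge.

Lemma pt_multiplicity X (eX : X -> tree) (els : X -> seq elt) (d : X -> desc) :
  pt eX (eL eElt) els -> pt eX eDesc d ->
  pt eX eN (fun x => multiplicity elt0 (els x) elt_label elt_edge (d x)).
Proof.
move=> pe pd; rewrite /multiplicity /elt_label.
by pt_tac.
Qed.

Ltac pt_user ::= first
  [ simple eapply pt_elt_edge | simple eapply pt_multiplicity | simple eapply pt_bases
  | simple eapply pt_vertex_adj ].

Definition elt_vertices (els : seq elt) : seq vertex :=
  vertices (size els) (multiplicity elt0 els elt_label elt_edge).

Definition graph_rows tau (els : seq elt) : seq (seq bool) :=
  [seq [seq vertex_adj tau u v | v <- elt_vertices els] | u <- elt_vertices els].

Lemma pt_elt_vertices X (eX : X -> tree) (els : X -> seq elt) :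
  pt eX (eL eElt) els -> pt eX (eL eVertex) (fun x => elt_vertices (els x)).
Proof. by move=> pe; rewrite /elt_vertices /vertices; pt_tac. Qed.

Lemma pt_graph_rows X (eX : X -> tree) tau (els : X -> seq elt) :
  pt eX (eL eElt) els -> pt eX (eL (eL eB)) (fun x => graph_rows tau (els x)).
Proof.
move=> pe; rewrite /graph_rows.
by do ![simple eapply pt_elt_vertices | pt_step].
Qed.

Lemma pt_var_elts X (eX : X -> tree) (bs : X -> seq (seq nat * nat)) :
  pt eX eBlocks bs -> pt eX (eL eElt) (fun x => var_elts (bs x)).
Proof. by move=> pb; rewrite /var_elts; pt_tac. Qed.

Lemma pt_odd X (eX : X -> tree) (f : X -> nat) : pt eX eN f -> pt eX eB
    (fun x => odd (f x)).
Proof.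
move=> pf; have : pt eX eB (fun x => iter (f x) negb false).
  apply: (pt_iter (g := fun _ : X => negb) (q := fun=> 2) pf (pt_const _ _ false)).
  - by pt_tac.
  - exact: pb_const.
  - by move=> x [].
by apply: pt_ext => x; elim: (f x) => //= n ->.
Qed.

Lemma pt_nseq X (eX : X -> tree) A (eA : A -> tree) (f : X -> nat) (a : X -> A) :
  pt eX eN f -> pt eX eA a -> pt eX (eL eA) (fun x => nseq (f x) (a x)).
Proof.
move=> pf pa; have h : pt eX (eL eA) (fun x => [seq a x | _ <- iota 0 (f x)]).
  by pt_tac.
apply: pt_ext h => x; rewrite -{2}(size_iota 0 (f x)).
by elim: (iota _ _) => //= n s ->.
Qed.

(** The depth [t] is fixed, so the recursion is unrolled in the program. [X] is generalised because
    every level adds its loop variable to the input. *)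
Lemma pt_nodes t X (eX : X -> tree) (F : X -> nform nat t) (p : X -> seq nat)
    (l : X -> nat) :
  pt eX (@eNform t) F -> pt eX (eL eN) p -> pt eX eN l ->
  pt eX (eL eElt) (fun x => nodes (F x) (p x) (l x)).
Proof.
elim: t X eX F p l => [|t IH] X eX F p l pF pp pl.
  have pF' : pt eX (eP eB eN) F by [].
  by rewrite /nodes; pt_tac.
have pF' : pt eX (eL (@eNform t)) F by [].
rewrite [nodes]/=; apply: pt_cons; first by pt_tac.
apply: pt_flatten; apply: pt_map; first by pt_tac.
by apply: IH; pt_tac.
Qed.

Lemma pt_picks X (eX : X -> tree) (bs : X -> seq (seq nat * nat)) :
  pt eX eBlocks bs -> pt eX (eL (eP eB eN)) (fun x => picks (bs x)).
Proof.
move=> pb; rewrite /picks; apply: pt_flatten; apply: pt_map; first by pt_tac.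
apply: pt_nseq; first by pt_tac.
by apply: pt_pair; [apply/pt_neg/pt_odd|]; pt_tac.
Qed.

(** * Programs for the sentence *)

Lemma pt_RBinNat X (eX : X -> tree) (c : nat) (R : nat -> nat -> rfo) (f g : X -> nat) :
  (forall i j, eF (R i j) = Node (eN c) (Node (eN i) (eN j))) ->
  pt eX eN f -> pt eX eN g -> pt eX eF (fun x => R (f x) (g x)).
Proof.
move=> hR pf pg; apply: (pt_recode (u := id) _ _ (pt_pair (pt_const eX eN c) (pt_pair pf pg))).
  by [].
by move=> x; rewrite hR.
Qed.

Lemma pt_RUn X (eX : X -> tree) (c : nat) (R : rfo -> rfo) (f : X -> rfo) :
  (forall a, eF (R a) = Node (eN c) (eF a)) ->
  pt eX eF f -> pt eX eF (fun x => R (f x)).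
Proof.
move=> hR pf; apply: (pt_recode (u := id) _ _ (pt_pair (pt_const eX eN c) pf)).
  by [].
by move=> x; rewrite hR.
Qed.

Lemma pt_RBin X (eX : X -> tree) (c : nat) (R : rfo -> rfo -> rfo) (f g : X -> rfo) :
  (forall a b, eF (R a b) = Node (eN c) (Node (eF a) (eF b))) ->
  pt eX eF f -> pt eX eF g -> pt eX eF (fun x => R (f x) (g x)).
Proof.
move=> hR pf pg; apply: (pt_recode (u := id) _ _ (pt_pair (pt_const eX eN c) (pt_pair pf pg))).
  by [].
by move=> x; rewrite hR.
Qed.

Lemma pt_REq X (eX : X -> tree) (f g : X -> nat) :
  pt eX eN f -> pt eX eN g -> pt eX eF (fun x => REq (f x) (g x)).
Proof. exact: (pt_RBinNat (c := 0)). Qed.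

Lemma pt_RAdj X (eX : X -> tree) (f g : X -> nat) :
  pt eX eN f -> pt eX eN g -> pt eX eF (fun x => RAdj (f x) (g x)).
Proof. exact: (pt_RBinNat (c := 1)). Qed.

Lemma pt_RNot X (eX : X -> tree) (f : X -> rfo) : pt eX eF f -> pt eX eF
    (fun x => RNot (f x)).
Proof. exact: (pt_RUn (c := 2)). Qed.

Lemma pt_RAnd X (eX : X -> tree) (f g : X -> rfo) :
  pt eX eF f -> pt eX eF g -> pt eX eF (fun x => RAnd (f x) (g x)).
Proof. exact: (pt_RBin (c := 3)). Qed.

Lemma pt_ROr X (eX : X -> tree) (f g : X -> rfo) :
  pt eX eF f -> pt eX eF g -> pt eX eF (fun x => ROr (f x) (g x)).
Proof. exact: (pt_RBin (c := 4)). Qed.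

Lemma pt_REx X (eX : X -> tree) (f : X -> rfo) : pt eX eF f -> pt eX eF
    (fun x => REx (f x)).
Proof. exact: (pt_RUn (c := 5)). Qed.

Lemma pt_RAll X (eX : X -> tree) (f : X -> rfo) : pt eX eF f -> pt eX eF
    (fun x => RAll (f x)).
Proof. exact: (pt_RUn (c := 6)). Qed.

Lemma tsize_RNot a : tsize (eF (RNot a)) = tsize (eF a) + 6.
Proof. by rewrite /=; lia. Qed.

Lemma tsize_RAnd a b : tsize (eF (RAnd a b)) = tsize (eF a) + tsize (eF b) + 9.
Proof. by rewrite /=; lia. Qed.

Lemma tsize_ROr a b : tsize (eF (ROr a b)) = tsize (eF a) + tsize (eF b) + 11.
Proof. by rewrite /=; lia. Qed.

Lemma tsize_REx a : tsize (eF (REx a)) = tsize (eF a) + 12.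
Proof. by rewrite /=; lia. Qed.

Lemma tsize_RAll a : tsize (eF (RAll a)) = tsize (eF a) + 14.
Proof. by rewrite /=; lia. Qed.

Ltac pt_user ::= first
  [ simple eapply pt_REq | simple eapply pt_RAdj | simple eapply pt_RNot
  | simple eapply pt_RAnd | simple eapply pt_ROr | simple eapply pt_REx
  | simple eapply pt_RAll ].

Lemma pt_RTwin X (eX : X -> tree) (f g : X -> nat) :
  pt eX eN f -> pt eX eN g -> pt eX eF (fun x => RTwin (f x) (g x)).
Proof. by move=> pf pg; rewrite /RTwin /RIff; pt_tac. Qed.

Lemma pt_RBigAnd X (eX : X -> tree) (s : X -> seq nat) (f : X -> nat -> rfo) :
  pt eX (eL eN) s -> pt (eP eX eN) eF (fun p => f p.1 p.2) ->
  pt eX eF (fun x => RBigAnd (s x) (f x)).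
Proof.
move=> ps pf; rewrite /RBigAnd.
apply: (pt_foldr (g := fun x b r => RAnd (f x b) r)
   (q := fun p => tsize (eF (f p.1 p.2)) + 9) ps (pt_const _ _ RTrue)).
- apply: pt_RAnd; last by pt_tac.
  apply: (pt_comp (f := fun p => (p.1.1, p.2)) (g := fun p => f p.1 p.2) _ pf).
  by pt_tac.
- by apply: pb_add (pb_const _ _); apply: pt_pb.
- by move=> x a b /=; lia.
Qed.

Ltac pt_user ::= first
  [ simple eapply pt_REq | simple eapply pt_RAdj | simple eapply pt_RNot
  | simple eapply pt_RAnd | simple eapply pt_ROr | simple eapply pt_REx
  | simple eapply pt_RAll | simple eapply pt_RTwin | simple eapply pt_RBigAnd ].

Definition RTwinGuard i d :=
  RAnd (RTwin 0 (i + d).+1) (RBigAnd (iota 0 d) (fun b => RNot (REq 0 b.+1))).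

Lemma pt_RTwinGuard X (eX : X -> tree) (f g : X -> nat) :
  pt eX eN f -> pt eX eN g -> pt eX eF (fun x => RTwinGuard (f x) (g x)).
Proof. by move=> pf pg; rewrite /RTwinGuard; pt_tac. Qed.

Lemma pt_RAtLeast X (eX : X -> tree) (m i : X -> nat) :
  pt eX eN m -> pt eX eN i -> pt eX eF (fun x => RAtLeast (m x) (i x)).
Proof.
move=> pm pi; rewrite /RAtLeast.
have pi' : pt (eP eX eN) eF (fun p => RTwinGuard (i p.1) p.2).
  by apply: pt_RTwinGuard; pt_tac.
have ps : pt eX (eL eN) (fun x => iota 0 (m x)) by pt_tac.
(* 21 pays for the quantifier, 12, and the conjunction, 9, that each step adds. *)
apply: (pt_foldr (g := fun x d r => REx (RAnd (RTwinGuard (i x) d) r))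
   (q := fun p => tsize (eF (RTwinGuard (i p.1) p.2)) + 21) ps (pt_const _ _ RTrue)).
- by do ![simple eapply pt_RTwinGuard | pt_step].
- by apply: pb_add (pb_const _ _); apply: pt_pb.
- by move=> x a b; rewrite tsize_REx tsize_RAnd; cbn [fst snd]; lia.
Qed.

Lemma pt_RChosen X (eX : X -> tree) (o n : X -> nat) :
  pt eX eN o -> pt eX eN n -> pt eX eF (fun x => RChosen (o x) (n x)).
Proof. by move=> po pn; rewrite /RChosen; pt_tac. Qed.

Ltac pt_user ::= first
  [ simple eapply pt_RAtLeast | simple eapply pt_RChosen
  | simple eapply pt_REq | simple eapply pt_RAdj | simple eapply pt_RNot
  | simple eapply pt_RAnd | simple eapply pt_ROr | simple eapply pt_REx
  | simple eapply pt_RAll | simple eapply pt_RTwin | simple eapply pt_RBigAnd ].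

Lemma pt_RMatrix X (eX : X -> tree) t conj o (n : X -> nat) :
  pt eX eN n -> pt eX eF (fun x => RMatrix t conj o (n x)).
Proof.
move=> pn; elim: t conj o => [|t IH] conj o; cbn [RMatrix]; first by pt_tac.
have := IH false o.+1; have := IH true o.+1 => p1 p2.
by case: conj; rewrite /RImp; pt_tac.
Qed.

Lemma pt_RRoot X (eX : X -> tree) t (n : X -> nat) :
  pt eX eN n -> pt eX eF (fun x => RRoot t (n x)).
Proof. by move=> pn; have := pt_RMatrix t true 1 pn; rewrite /RRoot => ?; pt_tac. Qed.

Lemma pt_RGuard X (eX : X -> tree) (lab n : X -> nat) :
  pt eX eN lab -> pt eX eN n -> pt eX eF (fun x => RGuard (lab x) (n x)).
Proof. by move=> pl pn; rewrite /RGuard /RExactly; pt_tac. Qed.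

Lemma pt_RPicks t X (eX : X -> tree) (qs : X -> seq (bool * nat)) :
  pt eX (eL (eP eB eN)) qs -> pt eX eF (fun x => RPicks t (qs x)).
Proof.
move=> pq; rewrite /RPicks.
have ps : pt eX (eL (eP (eP eB eN) eN))
   (fun x => [seq (nth (false, 0) (qs x) i, i) | i <- iota 0 (size (qs x))]) by pt_tac.
have pz : pt eX eF (fun x => RRoot t (size (qs x))) by apply: pt_RRoot; pt_tac.
have pg : pt (eP eX (eP (eP eB eN) eN)) eF (fun p => RGuard p.2.1.2 p.2.2).
  by apply: pt_RGuard; pt_tac.
(* 40 exceeds the cost of both kinds of quantifier, 12 + 9 and 14 + 11 + 6. *)
apply: (pt_foldr (g := fun _ => RPick)
   (q := fun p => tsize (eF (RGuard p.2.1.2 p.2.2)) + 40) ps pz).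
- rewrite /RPick /RImp.
  by do ![simple eapply pt_RGuard | pt_step].
- by apply: pb_add (pb_const _ _); apply: pt_pb.
- move=> x [[[] lab] n] b.
    by rewrite -[RPick _ _]/(REx (RAnd (RGuard lab n) b)) tsize_REx tsize_RAnd; cbn [fst snd]; lia.
  rewrite -[RPick _ _]/(RAll (ROr (RNot (RGuard lab n)) b)) tsize_RAll tsize_ROr.
  rewrite tsize_RNot; cbn [fst snd].
  by lia.
Qed.

Definition reduce_rows tau t (q : seq (seq nat * nat) * nform nat t) : seq (seq bool) :=
  graph_rows tau (elts q.2 q.1).

Definition reduce_formula t (q : seq (seq nat * nat) * nform nat t) : rfo :=
  RPicks t (picks q.1).

Lemma pt_reduce tau t :
  pt (eP eBlocks (@eNform t)) (eP (eL (eL eB)) eF)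
     (fun q => (reduce_rows tau q, reduce_formula q)).
Proof.
apply: pt_pair.
  apply: pt_graph_rows; rewrite /elts; apply: pt_cat.
    by apply: pt_nodes; pt_tac.
  by apply: pt_var_elts; pt_tac.
by apply: pt_RPicks; apply: pt_picks; pt_tac.
Qed.

(** * Reductions *)

Lemma computable_pt f h : computable f -> pt eN eN h -> computable (fun n => h (f n)).
Proof.
move=> [p hp] [q [k [T [_ hq]]]]; exists (Seq p q) => n.
have [t [s [e1 s0]]] := hp n; have [s' [t' [e2 s0' _ _]]] := hq (f n) s s0.
by exists (t + t'), s'; split=> //; apply: ExSeq e1 e2.
Qed.

Lemma computable_id : computable id.
Proof.
exists (Assign 0 (EVar 0)) => n; eexists; eexists; split; first exact: ExAssign.
by [].
Qed.

Lemma leq_exp_base m n c : m <= n -> m ^ c <= n ^ c.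
Proof. by case: c => // c mn; rewrite leq_exp2r. Qed.

Lemma fpt_refl P : fpt_reducible P P.
Proof.
exists (Assign 0 (EVar 0)), (fun=> 2), id, 1; split.
- exact: (computable_pt computable_id (pt_const _ _ 2)).
- exact: computable_id.
- move=> x; exists x, (tsize (enc x)).+1; split=> //; last first.
    by have := tsize_gt0 (enc x); rewrite expn1; lia.
  exists (upd (upd (fun=> Leaf) 0 (enc x)) 0 (enc x)); split; last by rewrite /upd eqxx.
  exact: (ExAssign 0 (EVar 0) (upd (fun=> Leaf) 0 (enc x))).
Qed.

(** The parameter of the intermediate instance is only bounded by that of the first one, which is
    why [g] has to be monotone. *)
Lemma fpt_comp_pt (P Q R : pproblem) (y : inst Q -> inst R) (g : nat -> nat) :
  pt (@enc Q) (@enc R) y -> pt eN eN g -> {homo g : m n / m <= n} ->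
  (forall q, par (y q) <= g (par q)) -> (forall q, yes q <-> yes (y q)) ->
  fpt_reducible P Q -> fpt_reducible P R.
Proof.
move=> [q [k [T [[d pT] hq]]]] pg mg hpar hyes [p [f [g1 [c [cf cg hp]]]]].
exists (Seq p q), (fun n => f n + (f n + 2) ^ d), (fun n => g (g1 n)), (c.+1 * d + c).
split.
- apply: (computable_pt (h := fun m => m + (m + 2) ^ d) cf).
  apply: pt_addn; first by pt_tac.
  by apply: pt_exp; pt_tac.
- exact: computable_pt cg pg.
- move=> x; have [z [t [[s [e1 s0]] ht hg eqv]]] := hp x.
  have [s' [t' [e2 s0' _ ht']]] := hq z s s0.
  exists (y z), (t + t'); split.
  + by exists s'; split=> //; apply: ExSeq e1 e2.
  + have n1 := tsize_gt0 (enc x); set n := tsize (enc x) in ht n1 *.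
    have := exec_size e1 0; rewrite s0 updE eqxx -/n => sz.
    set a := f (par x) in ht *.
    have nc1 e : 0 < n ^ e by rewrite expn_gt0 n1.
    (* The intermediate instance is no larger than the input or the time spent on it, whichever is
       greater; the extra factor [n] and the summand 2 absorb the input and the successor. *)
    have sz' : (tsize (enc z)).+1 <= (a + 2) * n ^ c.+1.
      have : n <= n ^ c.+1 by rewrite -{1}(expn1 n) leq_pexp2l.
      have : n ^ c <= n ^ c.+1 by rewrite leq_pexp2l.
      move: (n ^ c) (n ^ c.+1) (nc1 c.+1) ht => N1 N2 N2p ht h1 h2.
      have : a * N1 <= a * N2 by rewrite leq_mul2l h1 orbT.
      by rewrite mulnDl; lia.
    have : t' <= (a + 2) ^ d * n ^ (c.+1 * d).
      apply: leq_trans ht' (leq_trans (pT z) _).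
      by rewrite expnM -expnMn; apply: leq_exp_base.
    rewrite mulnDl => h2; apply: leq_add.
      by apply: leq_trans ht _; rewrite leq_mul2l leq_pexp2l ?orbT //; lia.
    by apply: leq_trans h2 _; rewrite leq_mul2l leq_pexp2l ?orbT //; lia.
  + by apply: leq_trans (hpar z) (mg _ _ hg).
  + by rewrite eqv.
Qed.

Definition raw_qbf t (I : qbf t) : seq (seq nat * nat) * nform nat t :=
  (raw_blocks (qblocks I), raw_nform (qmatrix I)).

Lemma enc_qbf_raw t (I : qbf t) :
  enc_qbf I = eP eBlocks (@eNform t) (raw_qbf I).
Proof.
rewrite /enc_qbf /eP enc_raw_nform; congr (Node _ _).
rewrite /raw_qbf /raw_blocks /enc_seq foldr_map /=.
elim: (qblocks I) => //= -[s k] l ->; congr (Node (Node _ _) _) => /=.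
by rewrite foldr_map.
Qed.

Lemma size_picks_from i ex bs : size (picks_from i ex bs) = sumn (map snd bs).
Proof. by elim: bs i ex => //= b bs IH i ex; rewrite size_cat size_nseq IH. Qed.

(** There are at most [p] picks, and each takes at most [2 * r + 25], since the labels are at most
    [9 + r]. *)
Lemma tsize_picks t (I : qbf t) (p := qbf_par I) :
  tsize (eL (eP eB eN) (picks (raw_blocks (qblocks I)))) <= p * (2 * p + 25) + 1.
Proof.
set bs := raw_blocks _; pose r := size (qblocks I).
have szbs : size bs = r by rewrite size_map.
have sm : sumn (map snd bs) = sumn (map snd (qblocks I)).
  by rewrite /bs /raw_blocks -map_comp; congr sumn; apply: eq_map.
have bound s : (forall q : bool * nat, q \in s -> q.2 <= 9 + r) ->
    tsize (eL (eP eB eN) s) <= size s * (2 * r + 25) + 1.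
  elim: s => //= q s IH h; have := h q; rewrite inE eqxx => /(_ isT) hq.
  have {}IH : tsize (eL (eP eB eN) s) <= size s * (2 * r + 25) + 1.
    by apply: IH => q' hq'; apply: h; rewrite inE hq' orbT.
  by rewrite tsize_nat mulSn; case: q.1 => /=; lia.
apply: leq_trans (bound _ _) _.
  move=> q; rewrite picksE => /picks_from_label; rewrite szbs.
  by rewrite addn0 => /andP[_ /ltnW].
rewrite picksE size_picks_from sm leq_add2r /p /qbf_par -/r.
by apply: leq_mul; lia.
Qed.

(** * Hardness of model checking for AW[*] *)

Section Hardness.
Variable C : graph -> Prop.
Hypothesis hC : closed_isomorphism C.
Hypothesis hrep : consecutive_representation_property C.
Hypothesis hind : closed_induced_subgraph C.
Hypothesis hdup : closed_duplication C.

Lemma qbf_graph_closed tau t (I : qbf t) :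
  (forall N, exists2 G, C G & has_pattern tau N G) ->
  C (qbf_graph tau (raw_nform (qmatrix I)) (raw_blocks (qblocks I))).
Proof.
move=> pat; set els := elts (raw_nform (qmatrix I)) (raw_blocks (qblocks I)).
(* The halves run from 0 to [size els], hence the successor. *)
have [G0 CG0 pat0] := pat (size els).+1.
apply: list_graph_closed hC hind hdup CG0 pat0 (uniq_vertices _ _) _.
by move=> [x c]; rewrite mem_vertices => /andP[/base_valid].
Qed.

Lemma qbf_instance tau t (I : qbf t) : 0 < t ->
  (forall N, exists2 G, C G & has_pattern tau N G) ->
  exists z : inst (FO_model_checking C),
   [/\ enc z = eP (eL (eL eB)) eF (reduce_rows tau (raw_qbf I), reduce_formula (raw_qbf I)),
       par z <= tsize (eF (reduce_formula (raw_qbf I))) & qbf_sat I <-> yes z].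
Proof.
move=> t0 pat; have CG := qbf_graph_closed I pat.
have sc : scoped 0 (reduce_formula (raw_qbf I)).
  by rewrite /reduce_formula RPicksE; apply: scoped_picks.
have [phi [Ephi sz hphi]] := fo_of_scoped sc.
exists (exist _ _ CG, phi); split=> //=.
  by rewrite enc_list_graph Ephi.
rewrite /models; set G := qbf_graph _ _ _.
have G0 : 0 < order G.
  have els0 := mem_nth elt0 (elts_gt0 (raw_nform (qmatrix I)) (raw_blocks (qblocks I))).
  have [u _ _] := elt_of_onto tau (raw_blocks_uniq I) els0.
  exact: leq_ltn_trans (leq0n u) (ltn_ord u).
rewrite (hphi G _ (fun=> Ordinal G0)); last by case.
by rewrite (qbf_formula_correct t0).
Qed.

Lemma fo_model_checking_hard Q : in_AWstar Q -> fpt_reducible Q (FO_model_checking C).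
Proof.
move=> [t [t0 red]]; have [tau pat] := class_has_pattern hrep.
(* Membership in the class is a proof and not data, so the target instance is obtained by choice;
   the program only produces its encoding. *)
have [y hy] := choice _ (fun I : qbf t => qbf_instance I t0 pat).
(* The sentence is computed from the list of picks alone, so its size is polynomial in that of the
   list, which the parameter bounds. *)
have [c hc] := pt_pb (pt_RPicks t (pt_idE (eL (eP eB eN)))).
apply: (@fpt_comp_pt Q (QBFSAT t) (FO_model_checking C) y
  (fun p => (p * (2 * p + 25) + 2) ^ c)) red.
- apply: (pt_recode (u := @raw_qbf t) _ _ (pt_reduce tau t)) => I.
    exact: enc_qbf_raw.
  by have [] := hy I.
- by apply: pt_exp; pt_tac.
- move=> m n mn; apply: leq_exp_base; rewrite leq_add2r.
  by apply: leq_mul => //; lia.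
- move=> I; have [_ h _] := hy I; apply: leq_trans h _.
  apply: leq_trans (hc _) _; apply: leq_exp_base.
  by have := tsize_picks I; rewrite /raw_qbf /=; lia.
- by move=> I; have [_ _] := hy I.
Qed.

End Hardness.

(** * From sentences to quantified propositional formulas *)

Notation lit := (bool * nat)%type.
Notation clause := (seq (seq lit)).
Notation quants := (seq (bool * (nat * nat))).

(** A clause is a disjunction of conjunctions, so the literals of a path enter it one by one, each
    as an excuse that makes the clause true. *)
Definition single (path : seq lit) : clause := [seq [:: l] | l <- path].

(* [n] vertices: variables [b], .., [b + n - 1] say which vertex is the value of
   the quantified variable; [b + n] stands for no vertex at all, so that the
   ranges are never empty. *)
Definition atom_lits (n : nat) (w : nat -> nat -> bool) (b b' : nat) : clause :=
  flatten [seq flatten [seq if w u v then [:: [:: (true, b + u); (true, b' + v)]] else [::]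
    | v <- iota 0 n] | u <- iota 0 n].

Definition width (qs : quants) : nat := sumn [seq q.2.2 | q <- qs].

Definition adj_entry (M : seq (seq bool)) u v : bool := nth false (nth [::] M u) v.

(** [pol] pushes negations to the atoms, [env] gives the first propositional variable of each bound
    vertex, [path] collects the excuses for not checking an atom, and [c] is the next free variable.
    Quantifiers of the second subformula follow those of the first, which makes the result prenex.
    An existential choice of no vertex is punished by a clause of its own, a universal one by an
    excuse on the path. *)
Fixpoint compile (M : seq (seq bool)) (r : rfo) (pol : bool) (env : seq nat)
    (path : seq lit) (c : nat) : quants * seq clause :=
  let n := size M in
  let both p1 p2 c0 a b :=
    let A := compile M a pol env p1 c0 in
    let B := compile M b pol env p2 (c0 + width A.1) in (A.1 ++ B.1, A.2 ++ B.2) in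
  let split a b :=
    let AB := both ((false, c) :: path) ((false, c.+1) :: path) c.+2 a b in
    ((true, (c, 2)) :: AB.1, AB.2) in
  let choose (ex : bool) a :=
    if ex then
      let A := compile M a pol (c :: env) path (c + n.+1) in
      ((true, (c, n.+1)) :: A.1, (single path ++ [:: [:: (false, c + n)]]) :: A.2)
    else
      let A := compile M a pol (c :: env) ((true, c + n) :: path) (c + n.+1) in
      ((false, (c, n.+1)) :: A.1, A.2) in
  match r with
  | REq i j => ([::],
      [:: single path ++ atom_lits n (fun u v => (u == v) == pol) (nth 0 env i) (nth 0 env j)])
  | RAdj i j => ([::],
      [:: single path ++
          atom_lits n (fun u v => adj_entry M u v == pol) (nth 0 env i) (nth 0 env j)])
  | RNot a => compile M a (~~ pol) env path c
  | RAnd a b => if pol then both path path c a b else split a b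
  | ROr a b => if pol then split a b else both path path c a b
  | REx a => choose pol a
  | RAll a => choose (~~ pol) a
  end.

Definition lit_true (C : seq nat) (l : lit) : bool := (l.2 \in C) == l.1.
Definition clause_true (C : seq nat) (cl : clause) : bool := has (all (lit_true C)) cl.

Fixpoint gsat (K : seq nat -> Prop) (qs : quants) (C : seq nat) : Prop :=
  match qs with
  | [::] => K C
  | (ex, (b, s)) :: qs' =>
      if ex then exists2 v, b <= v < b + s & gsat K qs' (v :: C)
      else forall v, b <= v < b + s -> gsat K qs' (v :: C)
  end.

Fixpoint chain (c : nat) (qs : quants) : Prop :=
  if qs is (_, (b, s)) :: qs' then [/\ b = c, 0 < s & chain (c + s) qs'] else True.

Definition extension (c d : nat) (C C' : seq nat) : Prop :=
  exists2 D, C' = D ++ C & all (fun x => c <= x < d) D.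

Lemma chain_cat c qs qs' : chain c qs -> chain (c + width qs) qs' -> chain c (qs ++ qs').
Proof.
elim: qs c => [|[ex [b s]] qs IH] c /=; first by rewrite addn0.
by move=> [-> s0 ch]; rewrite addnA => ch'; split=> //; apply: IH.
Qed.

Lemma width_cat qs qs' : width (qs ++ qs') = width qs + width qs'.
Proof. by rewrite /width map_cat sumn_cat. Qed.

Lemma widthS c ex c0 n qs : c + width ((ex, (c0, n)) :: qs) = c + n + width qs.
Proof. by rewrite /width /= addnA. Qed.

Lemma compile_chain M r pol env path c : chain c (compile M r pol env path c).1.
Proof.
elim: r pol env path c => [i j|i j|a IH|a IHa b IHb|a IHa b IHb|a IH|a IH] pol env path c //=.
- by case: ifP => _ /=; first exact: chain_cat; split=> //; rewrite addn2; apply: chain_cat.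
- by case: ifP => _ /=; last exact: chain_cat; split=> //; rewrite addn2; apply: chain_cat.
- by case: ifP => _ /=; split.
- by case: ifP => _ /=; split.
Qed.

Lemma gsat_cat K qs qs' C : gsat K (qs ++ qs') C <-> gsat (gsat K qs') qs C.
Proof.
elim: qs C => [|[ex [b s]] qs IH] C //=; case: ex.
  by split=> -[v hv h]; exists v => //; apply/IH.
by split=> h v hv; apply/IH/h.
Qed.

Lemma extension_cons c s d v C C' : c <= v < c + s -> extension (c + s) (c + s + d)
    (v :: C) C' ->
  extension c (c + (s + d)) C C'.
Proof.
move=> hv [D -> hD]; exists (rcons D v); first by rewrite cat_rcons.
rewrite all_rcons addnA; apply/andP; split; first by lia.
by apply: sub_all hD => x /=; lia.
Qed.

Lemma gsat_imp K K' c qs C : chain c qs ->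
  (forall C', extension c (c + width qs) C C' -> K C' -> K' C') ->
  gsat K qs C -> gsat K' qs C.
Proof.
elim: qs c C => [|[ex [b s]] qs IH] c C /=.
  by move=> _ h; apply: h; exists [::].
move=> [-> s0 ch] h; have next v : c <= v < c + s -> gsat K qs (v :: C) -> gsat K' qs (v :: C).
  move=> hv; apply: (IH (c + s)) => // C' ext; apply: h.
  exact: extension_cons hv ext.
case: ex {h}; first by case=> v hv /(next v hv); exists v.
by move=> hh v hv; apply/next/hh.
Qed.

Lemma gsat_ext K K' c qs C : chain c qs ->
  (forall C', extension c (c + width qs) C C' -> (K C' <-> K' C')) ->
  gsat K qs C <-> gsat K' qs C.
Proof. by move=> ch h; split; apply: (gsat_imp ch) => C' /h[]. Qed.

(** Every range offers a move, so quantifiers that do not matter leave the truth value alone. The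
    additional variable in each range of vertices ensures this even for the empty graph. *)
Lemma gsat_const c qs C (P : Prop) : chain c qs -> gsat (fun=> P) qs C <-> P.
Proof.
elim: qs c C => [|[ex [b s]] qs IH] c C //= [-> s0 /IH{}IH].
have c0 : c <= c < c + s by lia.
case: ex; first by split=> [[v _ /IH]|p] //; exists c => //; apply/IH.
by split=> [/(_ c c0)/IH|p v _] //; apply/IH.
Qed.

(** Conditions on the variables below [c] are untouched by moves in later ranges, so they can be
    carried past the quantifiers of another subformula. *)
Definition stable (c : nat) (K : seq nat -> Prop) : Prop :=
  forall C C', (forall x, x < c -> (x \in C) = (x \in C')) -> K C <-> K C'.

Lemma extension_mem c d C C' : extension c d C C' -> forall x, x < c -> (x \in C') =
    (x \in C).
Proof.
move=> [D -> /allP hD] x xc; rewrite mem_cat; case: (boolP (x \in D)) => // /hD.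
by lia.
Qed.

Lemma gsat_stable K c qs C : chain c qs -> stable c K -> gsat K qs C <-> K C.
Proof.
move=> ch st; rewrite -(gsat_const C (K C) ch); apply: (gsat_ext ch) => C' ext.
by apply: st; apply: extension_mem ext.
Qed.

Lemma gsat_weaken K K' c qs C : chain c qs -> stable c K' ->
  gsat (fun C' => K C' /\ K' C') qs C -> K' C.
Proof.
move=> ch st h; apply/(gsat_stable _ ch st); apply: (gsat_imp ch) h.
by move=> C' _ [].
Qed.

(** Hence one true literal on the path settles all clauses of the subformula. *)
Lemma compile_path M r pol env path c cl l :
  cl \in (compile M r pol env path c).2 -> l \in path -> [:: l] \in cl.
Proof.
have sing p (cl' : clause) : l \in p -> [:: l] \in single p ++ cl'.
  by move=> lp; rewrite mem_cat (map_f (fun l => [:: l])).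
elim: r pol env path c => [i j|i j|a IH|a IHa b IHb|a IHa b IHb|a IH|a IH] pol env path c /=.
- by rewrite inE => /eqP-> /sing.
- by rewrite inE => /eqP-> /sing.
- exact: IH.
- case: ifP => _ /=; rewrite mem_cat => /orP[h|h] lp.
  + exact: IHa h lp.
  + exact: IHb h lp.
  + by apply: IHa h _; rewrite inE lp orbT.
  + by apply: IHb h _; rewrite inE lp orbT.
- case: ifP => _ /=; rewrite mem_cat => /orP[h|h] lp.
  + by apply: IHa h _; rewrite inE lp orbT.
  + by apply: IHb h _; rewrite inE lp orbT.
  + exact: IHa h lp.
  + exact: IHb h lp.
- case: ifP => _ /=; first by rewrite inE => /predU1P[-> /sing|h] //; apply: IH h.
  by move=> h lp; apply: IH h _; rewrite inE lp orbT.
- case: ifP => _ /=; first by rewrite inE => /predU1P[-> /sing|h] //; apply: IH h.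
  by move=> h lp; apply: IH h _; rewrite inE lp orbT.
Qed.

Definition clause_below (c : nat) (cl : clause) : bool := all (all (fun l => l.2 < c)) cl.

Lemma clause_below_le c d cl : c <= d -> clause_below c cl -> clause_below d cl.
Proof.
by move=> cd; apply: sub_all => s; apply: sub_all => l h; apply: leq_trans h cd.
Qed.

Lemma clause_below_single c path : clause_below c (single path) = all
    (fun l => l.2 < c) path.
Proof.
by rewrite /clause_below all_map; apply: eq_all => l /=; rewrite andbT.
Qed.

Lemma clause_below_atom c n w b b' : b + n <= c -> b' + n <= c ->
  clause_below c (atom_lits n w b b').
Proof.
move=> hb hb'; apply/allP => s /flatten_mapP[u]; rewrite mem_iota => hu.
case/flatten_mapP=> v; rewrite mem_iota => hv; case: ifP => // _.
by rewrite inE => /eqP->; rewrite /= andbT; lia.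
Qed.

(** This makes the clauses of one subformula independent of the moves made for the next. *)
Lemma compile_below M r pol env path c : scoped (size env) r ->
  all (fun b => b + size M < c) env -> all (fun l => l.2 < c) path ->
  all (clause_below (c + width (compile M r pol env path c).1)) (compile M r pol env path c).2.
Proof.
have below_le c' d' (cls : seq clause) : c' <= d' ->
    all (clause_below c') cls -> all (clause_below d') cls.
  by move=> h; apply: sub_all => cl; apply: clause_below_le.
have env_le c' d' (env' : seq nat) : c' <= d' -> all (fun b => b + size M < c') env' ->
    all (fun b => b + size M < d') env'.
  by move=> h; apply: sub_all => b; lia.
have path_le c' d' (p : seq lit) : c' <= d' -> all (fun l => l.2 < c') p ->
    all (fun l => l.2 < d') p.
  by move=> h; apply: sub_all => l /=; lia.
have atom w i j env' path' c' : (i < size env') && (j < size env') ->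
    all (fun b => b + size M < c') env' -> all (fun l => l.2 < c') path' ->
    clause_below c' (single path' ++ atom_lits (size M) w (nth 0 env' i) (nth 0 env' j)).
  move=> /andP[hi hj] he hp; rewrite /clause_below all_cat -/(clause_below _ _).
  rewrite clause_below_single hp.
  by apply: clause_below_atom; apply/ltnW; apply: (allP he); apply: mem_nth.
pose below r := forall pol env path c, scoped (size env) r ->
  all (fun b => b + size M < c) env -> all (fun l => l.2 < c) path ->
  all (clause_below (c + width (compile M r pol env path c).1)) (compile M r pol env path c).2.
have both a b pol' env' p1 p2 c0 : below a -> below b ->
    scoped (size env') a && scoped (size env') b -> all (fun b => b + size M < c0) env' ->
    all (fun l => l.2 < c0) p1 -> all (fun l => l.2 < c0) p2 ->
    let A := compile M a pol' env' p1 c0 in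
    let B := compile M b pol' env' p2 (c0 + width A.1) in
    all (clause_below (c0 + width (A.1 ++ B.1))) (A.2 ++ B.2).
  move=> ha hb /andP[sa sb] he h1 h2 /=; rewrite all_cat width_cat addnA; apply/andP; split.
    by apply: below_le (ha pol' env' p1 c0 sa he h1); rewrite leq_addr.
  apply: hb => //; first by apply: env_le he; rewrite leq_addr.
  by apply: path_le h2; rewrite leq_addr.
have split2 a b pol' env' p c0 : below a -> below b ->
    scoped (size env') a && scoped (size env') b -> all (fun b => b + size M < c0) env' ->
    all (fun l => l.2 < c0) p ->
    let A := compile M a pol' env' ((false, c0) :: p) c0.+2 in
    let B := compile M b pol' env' ((false, c0.+1) :: p) (c0.+2 + width A.1) in
    all (clause_below (c0 + width ((true, (c0, 2)) :: A.1 ++ B.1))) (A.2 ++ B.2).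
  move=> ha hb sc he hp; cbv zeta.
  set A := compile M a _ _ _ _; set B := compile M b _ _ _ _.
  rewrite widthS addn2.
  apply: (both a b pol' env' _ _ c0.+2 ha hb sc); first by apply: env_le he; lia.
    by apply/andP; split; [by rewrite /=; lia | apply: path_le hp; lia].
  by apply/andP; split; [by rewrite /=; lia | apply: path_le hp; lia].
have chooseT a pol' env' p c0 : below a -> scoped (size env').+1 a ->
    all (fun b => b + size M < c0) env' -> all (fun l => l.2 < c0) p ->
    let A := compile M a pol' (c0 :: env') p (c0 + (size M).+1) in
    all (clause_below (c0 + width ((true, (c0, (size M).+1)) :: A.1)))
      ((single p ++ [:: [:: (false, c0 + size M)]]) :: A.2).
  move=> ha sc he hp; cbv zeta; rewrite widthS; apply/andP; split.
    rewrite /clause_below all_cat -/(clause_below _ _) clause_below_single /= andbT.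
    by apply/andP; split; [apply: path_le hp; lia | lia].
  apply: ha => //; last by apply: path_le hp; lia.
  by apply/andP; split; [by rewrite /=; lia | apply: env_le he; lia].
have chooseF a pol' env' p c0 : below a -> scoped (size env').+1 a ->
    all (fun b => b + size M < c0) env' -> all (fun l => l.2 < c0) p ->
    let A := compile M a pol' (c0 :: env') ((true, c0 + size M) :: p) (c0 + (size M).+1) in
    all (clause_below (c0 + width ((false, (c0, (size M).+1)) :: A.1))) A.2.
  move=> ha sc he hp; cbv zeta; rewrite widthS; apply: ha => //.
    by apply/andP; split; [by rewrite /=; lia | apply: env_le he; lia].
  by apply/andP; split; [rewrite /=; lia | apply: path_le hp; lia].
elim: r pol env path c => [i j|i j|a IH|a IHa b IHb|a IHa b IHb|a IH|a IH] pol env path c.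
- by move=> sc he hp; rewrite /= addn0 andbT; apply: atom.
- by move=> sc he hp; rewrite /= addn0 andbT; apply: atom.
- exact: IH.
- move=> sc he hp; rewrite /=; case: pol.
    exact: (both a b _ env path path c IHa IHb sc he hp hp).
  exact: (split2 a b _ env path c IHa IHb sc he hp).
- move=> sc he hp; rewrite /=; case: pol.
    exact: (split2 a b _ env path c IHa IHb sc he hp).
  exact: (both a b _ env path path c IHa IHb sc he hp hp).
- move=> sc he hp; rewrite /=; case: pol.
    exact: (chooseT a true env path c IH sc he hp).
  exact: (chooseF a false env path c IH sc he hp).
- move=> sc he hp; rewrite /=; case: pol.
    exact: (chooseF a true env path c IH sc he hp).
  exact: (chooseT a false env path c IH sc he hp).
Qed.

Fixpoint erase (n : nat) (phi : fo n) : rfo :=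
  match phi with
  | FEq i j => REq i j
  | FAdj i j => RAdj i j
  | FNot a => RNot (erase a)
  | FAnd a b => RAnd (erase a) (erase b)
  | FOr a b => ROr (erase a) (erase b)
  | FEx a => REx (erase a)
  | FAll a => RAll (erase a)
  end.

Lemma enc_erase n (phi : fo n) : enc_rfo (erase phi) = enc_fo phi.
Proof. by elim: phi => //= {}n => [a ->|a -> b ->|a -> b ->|a ->|a ->]. Qed.

Lemma scoped_erase n (phi : fo n) : scoped n (erase phi).
Proof. by elim: phi => //= {}n => [i j|i j|a -> b ->|a -> b ->] //; rewrite !ltn_ord. Qed.

Lemma compile_size M n (phi : fo n) pol env path c :
  size (compile M (erase phi) pol env path c).1 <= fo_size phi.
Proof.
elim: phi pol env path c => //= {}n => [a IH|a IHa b IHb|a IHa b IHb|a IH|a IH] pol env path c.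
- exact: leqW.
- by case: ifP => _; rewrite /= size_cat ?ltnS; [apply: leqW|]; apply: leq_add.
- by case: ifP => _; rewrite /= size_cat ?ltnS; [|apply: leqW]; apply: leq_add.
- by case: ifP => _ /=; rewrite ltnS.
- by case: ifP => _ /=; rewrite ltnS.
Qed.

(** * Soundness of the translation *)

Section Soundness.
Variable G : graph.
Let V := 'I_(order G).

Definition matrix_of : seq (seq bool) :=
  [seq [seq adj x y | y <- enum 'I_(order G)] | x <- enum 'I_(order G)].

Lemma size_matrix_of : size matrix_of = order G.
Proof. by rewrite size_map size_enum_ord. Qed.

Lemma adj_entry_matrix (x y : V) : adj_entry matrix_of x y = adj x y.
Proof.
rewrite /adj_entry /matrix_of (nth_map x) ?size_enum_ord // (nth_map y) ?size_enum_ord //.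
by rewrite !nth_ord_enum.
Qed.

Definition valid_env k (env : seq nat) (e : 'I_k -> V) (C : seq nat) : Prop :=
  forall (i : 'I_k) v, v < order G -> (nth 0 env i + v \in C) = (v == e i).

Lemma clause_true_path C path cl :
  (forall l, l \in path -> [:: l] \in cl) -> has (lit_true C) path -> clause_true C cl.
Proof.
move=> h /hasP[l lp lC]; apply/hasP; exists [:: l]; first exact: h.
by rewrite /= lC.
Qed.

Lemma clause_true_single C path cl : ~~ has (lit_true C) path ->
  clause_true C (single path ++ cl) = clause_true C cl.
Proof.
move=> h; rewrite /clause_true has_cat has_map (@eq_has _ _ (lit_true C)) ?(negbTE h) // => l /=.
by rewrite andbT.
Qed.

Lemma clause_true_atom C k (env : seq nat) (e : 'I_k -> V) w (i j : 'I_k)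
    : valid_env env e C ->
  clause_true C (atom_lits (order G) w (nth 0 env i) (nth 0 env j)) = w (e i) (e j).
Proof.
move=> ve; apply/hasP/idP => [[s /flatten_mapP[u]]|hw].
  rewrite mem_iota => hu /flatten_mapP[v]; rewrite mem_iota => hv.
  case: ifP => // hw; rewrite inE => /eqP-> /=; rewrite /lit_true /= !eqb_id andbT.
  by rewrite !ve // => /andP[/eqP<- /eqP<-].
exists [:: (true, nth 0 env i + e i); (true, nth 0 env j + e j)].
  apply/flatten_mapP; exists (nat_of_ord (e i)); first by rewrite mem_iota /=.
  apply/flatten_mapP; exists (nat_of_ord (e j)); first by rewrite mem_iota /=.
  by rewrite hw inE.
by rewrite /= /lit_true /= !ve ?ltn_ord // !eqxx.
Qed.

Lemma has_path_ext c d C C' path : extension c d C C' -> all (fun l => l.2 < c) path ->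
  has (lit_true C') path = has (lit_true C) path.
Proof.
move=> ext hp; apply: eq_in_has => l /(allP hp) lc.
by rewrite /lit_true (extension_mem ext).
Qed.

Lemma clause_true_stable c C C' cls : all (clause_below c) cls ->
  (forall x, x < c -> (x \in C) = (x \in C')) ->
  all (clause_true C) cls = all (clause_true C') cls.
Proof.
move=> hb h; apply: eq_in_all => cl /(allP hb) hcl; apply: eq_in_has => s /(allP hcl) hs.
by apply: eq_in_all => l /(allP hs) lc; rewrite /lit_true h.
Qed.

Definition sat_clauses cls (K : seq nat -> Prop) C : Prop := all
    (clause_true C) cls /\ K C.

Lemma stable_le c d K : c <= d -> stable c K -> stable d K.
Proof. by move=> cd st C C' h; apply: st => x xc; apply: h; apply: leq_trans xc cd. Qed.

Lemma clause_stable c cls : all (clause_below c) cls ->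
  stable c (fun C => all (clause_true C) cls).
Proof. by move=> h C C' hC; rewrite (clause_true_stable h hC). Qed.

Lemma stable_and c K K' : stable c K -> stable c K' -> stable c (fun C => K C /\ K' C).
Proof. by move=> s s' C C' h; rewrite (s C C' h) (s' C C' h). Qed.

Lemma compile_path_true r pol env path c C K :
  all (fun l => l.2 < c) path -> stable c K -> has (lit_true C) path ->
  gsat (sat_clauses (compile matrix_of r pol env path c).2 K)
    (compile matrix_of r pol env path c).1 C <-> K C.
Proof.
move=> hp st hC; have ch := compile_chain matrix_of r pol env path c.
rewrite -(gsat_const C (K C) ch); apply: (gsat_ext ch) => C' ext.
have KC : K C' <-> K C by apply: st; apply: extension_mem ext.
rewrite -KC /sat_clauses; split=> [[]|] // KC'; split=> //; apply/allP => cl hcl.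
apply: (@clause_true_path _ path) => [l lp|]; first exact: compile_path hcl lp.
by rewrite (has_path_ext ext).
Qed.

Definition truth (pol : bool) (P : Prop) : Prop := if pol then P else ~ P.

Lemma mem_cons (C : seq nat) c x : c <= x -> forall y, y < c -> (y \in x :: C) =
    (y \in C).
Proof. by move=> cx y yc; rewrite inE ltn_eqF // (leq_trans yc cx). Qed.

Lemma has_path_cons C c x path : c <= x -> all (fun l => l.2 < c) path ->
  ~~ has (lit_true C) path -> ~~ has (lit_true (x :: C)) path.
Proof.
move=> cx hp; apply: contra; rewrite (@eq_in_has _ _ (lit_true C)) // => l /(allP hp) lc.
by rewrite /lit_true (mem_cons C cx).
Qed.

Definition good k env (e : 'I_k -> V) (path : seq lit) c C K : Prop :=
  [/\ size env = k, all (fun b => b + order G < c) env, valid_env env e C,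
      all (fun x => x < c) C
    & [/\ all (fun l => l.2 < c) path, ~~ has (lit_true C) path & stable c K]].

Definition sound k (phi : fo k) : Prop := forall (e : 'I_k -> V) pol env path c C K,
  size env = k -> all (fun b => b + order G < c) env -> valid_env env e C ->
  all (fun x => x < c) C -> all (fun l => l.2 < c) path -> ~~ has (lit_true C) path ->
  stable c K ->
  gsat (sat_clauses (compile matrix_of (erase phi) pol env path c).2 K)
    (compile matrix_of (erase phi) pol env path c).1 C <->
  truth pol (fo_holds phi e) /\ K C.

(** [K] stands for whatever else has to hold at the end of the play, such as the clauses of the
    other conjunct. It only looks at earlier variables and so survives the moves in between. As no
    literal of the path is true, nothing is excused yet. *)
Lemma compile_sound k (phi : fo k) : sound phi.
Proof.
have env_le c' d' (env' : seq nat) : c' <= d' -> all (fun b => b + order G < c') env' ->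
    all (fun b => b + order G < d') env'.
  by move=> h; apply: sub_all => b /=; lia.
have path_le c' d' (p : seq lit) : c' <= d' -> all (fun l => l.2 < c') p ->
    all (fun l => l.2 < d') p.
  by move=> h; apply: sub_all => l /=; lia.
have C_le c' d' (D : seq nat) : c' <= d' -> all (fun x => x < c') D -> all (fun x => x < d') D.
  by move=> h; apply: sub_all => x /=; lia.
have C_ext c' d' D D' : c' <= d' -> extension c' d' D D' -> all (fun x => x < c') D ->
    all (fun x => x < d') D'.
  move=> cd [D0 -> h0] h; rewrite all_cat; apply/andP; split; last exact: C_le h.
  by apply: sub_all h0 => x /=; lia.
have valid_ext c' (D D' : seq nat) k' env' (e' : 'I_k' -> V) : size env' = k' ->
    all (fun b => b + order G < c') env' -> (forall x, x < c' -> (x \in D') = (x \in D)) ->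
    valid_env env' e' D -> valid_env env' e' D'.
  move=> sz he hD ve i v hv; rewrite hD ?ve //.
  have := allP he (nth 0 env' i); rewrite mem_nth ?sz // => /(_ isT) /=; lia.
(* Clauses of the first conjunct are constants for the variables of the second. *)
have seqn k' (a b : fo k') pol' env' p1 p2 c' D K' (PA PB : Prop) :
    size env' = k' -> all (fun b => b + order G < c') env' ->
    all (fun l => l.2 < c') p1 -> stable c' K' ->
    let A := compile matrix_of (erase a) pol' env' p1 c' in
    let B := compile matrix_of (erase b) pol' env' p2 (c' + width A.1) in
    (forall K'', stable (c' + width A.1) K'' -> forall D', extension c' (c' + width A.1) D D' ->
       gsat (sat_clauses B.2 K'') B.1 D' <-> PB /\ K'' D') ->
    (forall K'', stable c' K'' -> gsat (sat_clauses A.2 K'') A.1 D <-> PA /\ K'' D) ->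
    gsat (sat_clauses (A.2 ++ B.2) K') (A.1 ++ B.1) D <-> PA /\ PB /\ K' D.
  move=> sz he hp st A B hB hA; rewrite gsat_cat.
  have belowA : all (clause_below (c' + width A.1)) A.2.
    by apply: compile_below => //; rewrite ?size_matrix_of // sz scoped_erase.
  have stK : stable (c' + width A.1) (sat_clauses A.2 K').
    apply: stable_and; first exact: clause_stable.
    by apply: stable_le st; rewrite leq_addr.
  have stP : stable c' (fun D' => PB /\ K' D').
    by apply: stable_and => // D1 D2.
  rewrite -(hA _ stP); apply: (gsat_ext (compile_chain _ _ _ _ _ _)) => D' ext.
  rewrite -/A; have ext' : extension c' (c' + width A.1) D D' by exact: ext.
  transitivity (gsat (sat_clauses B.2 (sat_clauses A.2 K')) B.1 D').
    apply: (gsat_ext (compile_chain _ _ _ _ _ _)) => D'' _.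
    by rewrite /sat_clauses all_cat; split=> [[/andP[]]|[? []]] // *; split=> //; apply/andP.
  by rewrite hB // /sat_clauses; tauto.
have notin D x c' : all (fun x => x < c') D -> c' <= x -> (x \in D) = false.
  by move=> h hx; apply/negP => /(allP h) /=; lia.
have conjn k' (a b : fo k') : sound a -> sound b -> forall e pol env path c C K,
    good env e path c C K ->
    let A := compile matrix_of (erase a) pol env path c in
    let B := compile matrix_of (erase b) pol env path (c + width A.1) in
    gsat (sat_clauses (A.2 ++ B.2) K) (A.1 ++ B.1) C <->
    truth pol (fo_holds a e) /\ truth pol (fo_holds b e) /\ K C.
  move=> ha hb e0 pol0 env0 path0 c0 C0 K0 [sz he ve hC [hp np st]] A B.
  apply: (seqn _ a b pol0 env0 path0 path0 c0) => // [K1 st1 D' ext|K1 st1]; last exact: ha.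
  apply: hb => //.
  - by apply: env_le he; rewrite leq_addr.
  - by apply: valid_ext ve => //; [exact: he | exact: extension_mem ext].
  - by apply: C_ext ext hC; rewrite leq_addr.
  - by apply: path_le hp; rewrite leq_addr.
  - by rewrite (has_path_ext ext).
have splitn k' (a b : fo k') : sound a -> sound b -> forall e pol env path c C K,
    good env e path c C K ->
    let A := compile matrix_of (erase a) pol env ((false, c) :: path) c.+2 in
    let B := compile matrix_of (erase b) pol env ((false, c.+1) :: path) (c.+2 + width A.1) in
    gsat (sat_clauses (A.2 ++ B.2) K) ((true, (c, 2)) :: A.1 ++ B.1) C <->
    (truth pol (fo_holds a e) \/ truth pol (fo_holds b e)) /\ K C.
  move=> ha hb e0 pol0 env0 path0 c0 C0 K0 [sz he ve hC [hp np st]] A B.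
  have st2 : stable c0.+2 K0 by apply: stable_le st; lia.
  have he2 : all (fun b => b + order G < c0.+2) env0 by apply: env_le he; lia.
  have hp2 : all (fun l => l.2 < c0.+2) path0 by apply: path_le hp; lia.
  have hp3 x : x < c0.+2 -> all (fun l => l.2 < c0.+2) ((false, x) :: path0).
    by move=> hx; rewrite /= hx.
  have hC2 x : x < c0.+2 -> all (fun x => x < c0.+2) (x :: C0).
    by move=> hx; rewrite /= hx; apply: C_le hC; lia.
  have mem2 x (hx : c0 <= x) := mem_cons C0 hx.
  have ve2 x : c0 <= x -> valid_env env0 e0 (x :: C0).
    by move=> hx; apply: valid_ext ve => //; [exact: he | exact: mem2].
  have np2 x (hx : c0 <= x) := has_path_cons hx hp np.
  have K2 x (hx : c0 <= x) : K0 (x :: C0) <-> K0 C0 := st _ _ (mem2 x hx).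
  (* After the move [c0] the literal [(false, c0.+1)] is true, so the clauses of [b] are excused and
     only those of [a] count. *)
  have first : gsat (sat_clauses (A.2 ++ B.2) K0) (A.1 ++ B.1) (c0 :: C0) <->
      truth pol0 (fo_holds a e0) /\ True /\ K0 (c0 :: C0).
    apply: (seqn _ a b pol0 env0 _ _ c0.+2) => //; first by apply: hp3; lia.
      move=> K1 st1 D' ext; rewrite compile_path_true //; first by tauto.
        by apply: path_le (hp3 c0.+1 _); rewrite ?leq_addr.
      rewrite /= /lit_true /= (extension_mem ext) // inE (notin _ _ c0) //.
      by rewrite gtn_eqF.
    move=> K1 st1; apply: ha => //; [exact: ve2|by apply: hC2; lia|by apply: hp3; lia|].
    by rewrite /= negb_or np2 // /lit_true /= inE eqxx.
  have second : gsat (sat_clauses (A.2 ++ B.2) K0) (A.1 ++ B.1) (c0.+1 :: C0) <->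
      True /\ truth pol0 (fo_holds b e0) /\ K0 (c0.+1 :: C0).
    apply: (seqn _ a b pol0 env0 _ _ c0.+2) => //; first by apply: hp3; lia.
      move=> K1 st1 D' ext; apply: hb => //.
      - by apply: env_le he2; rewrite leq_addr.
      - apply: (valid_ext c0.+2 (c0.+1 :: C0)) => //; first exact: extension_mem ext.
        by apply: ve2; lia.
      - by apply: C_ext ext (hC2 _ _); rewrite ?leq_addr.
      - by apply: path_le (hp3 c0.+1 _); rewrite ?leq_addr.
      - rewrite (has_path_ext ext); last by apply: hp3; lia.
        by rewrite /= negb_or np2 // /lit_true /= inE eqxx.
    move=> K1 st1; rewrite compile_path_true //; first by tauto.
      by apply: hp3; lia.
    rewrite /= /lit_true /= inE (notin _ _ c0) //.
    by rewrite ltn_eqF.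
  split=> [[v hv h]|[[h|h] KC]].
  - have [vc|vc] : v = c0 \/ v = c0.+1 by lia.
      by subst v; have := proj1 first h; rewrite K2 //; tauto.
    by subst v; have := proj1 second h; rewrite K2 //; tauto.
  - by exists c0; [lia | apply/first; rewrite K2].
  - by exists c0.+1; [lia | apply/second; rewrite K2].
have cons_env k' (a : fo k'.+1) (e0 : 'I_k' -> V) env0 c0 C0 (u : V) :
    size env0 = k' -> all (fun b => b + order G < c0) env0 -> valid_env env0 e0 C0 ->
    all (fun x => x < c0) C0 -> valid_env (c0 :: env0) (env_cons u e0) (c0 + u :: C0).
  move=> sz he ve hC i v hv; rewrite inE /env_cons; case: unliftP => [j|] -> /=.
    rewrite ve //; case: eqP => // E.
    have := allP he (nth 0 env0 j); rewrite mem_nth ?sz // => /(_ isT) /=; rewrite add0n in E; lia.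
  by rewrite eqn_add2l (notin _ _ c0) ?leq_addr // orbF.
have quantn k' (a : fo k'.+1) : sound a -> forall e pol env path c C K (ex : bool),
    good env e path c C K ->
    let n := order G in
    let p := if ex then path else (true, c + n) :: path in
    let A := compile matrix_of (erase a) pol (c :: env) p (c + n.+1) in
    let cl := if ex then [:: single path ++ [:: [:: (false, c + n)]]] else [::] in
    gsat (sat_clauses (cl ++ A.2) K) ((ex, (c, n.+1)) :: A.1) C <->
    (if ex then exists v, truth pol (fo_holds a (env_cons v e))
     else forall v, truth pol (fo_holds a (env_cons v e))) /\ K C.
  move=> ha e0 pol0 env0 path0 c0 C0 K0 ex [sz he ve hC [hp np st]] n p A cl.
  have mem2 x (hx : c0 <= x) := mem_cons C0 hx.
  have np2 x (hx : c0 <= x) := has_path_cons hx hp np.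
  have K2 x (hx : c0 <= x) : K0 (x :: C0) <-> K0 C0 := st _ _ (mem2 x hx).
  have hpn : all (fun l => l.2 < c0 + n.+1) p.
    have h : all (fun l => l.2 < c0 + n.+1) path0 by apply: path_le hp; lia.
    by rewrite /p; case: (ex) => //=; rewrite h andbT; lia.
  (* The extra clause concerns variables up to the move just made, so it can join the
     continuation. *)
  have stcl : stable (c0 + n.+1) (sat_clauses cl K0).
    apply: stable_and; last by apply: stable_le st; lia.
    apply: clause_stable; rewrite /cl; case: (ex) => //=; rewrite andbT /clause_below all_cat.
    rewrite -/(clause_below _ _) clause_below_single /= !andbT; apply/andP; split; last by lia.
    by apply: path_le hp; lia.
  have E D : gsat (sat_clauses (cl ++ A.2) K0) A.1 D <->
      gsat (sat_clauses A.2 (sat_clauses cl K0)) A.1 D.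
    apply: (gsat_ext (compile_chain _ _ _ _ _ _)) => D' _; rewrite /sat_clauses all_cat.
    by split=> [[/andP[]]|[? []]] // *; split=> //; apply/andP.
  have clE x : c0 <= x -> all (clause_true (x :: C0)) cl = ~~ ex || (x != c0 + n).
    move=> hx; rewrite /cl; case: (ex) => //=; rewrite andbT clause_true_single ?np2 //.
    rewrite /clause_true /= /lit_true /= inE (notin _ _ c0) ?leq_addr // !orbF andbT.
    by rewrite [c0 + n == x]eq_sym eqbF_neg.
  have inner (u : V) : gsat (sat_clauses (cl ++ A.2) K0) A.1 (c0 + u :: C0) <->
      truth pol0 (fo_holds a (env_cons u e0)) /\ K0 C0.
    have un := ltn_ord u; have cu : c0 <= c0 + u by rewrite leq_addr.
    rewrite E (ha (env_cons u e0)) //; last 1 first.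
    - have : ~~ has (lit_true (c0 + u :: C0)) path0 by apply: np2.
      rewrite /p; case: (ex) => //= h; rewrite negb_or h andbT /lit_true /= inE.
      by rewrite (notin _ _ c0) ?leq_addr // orbF eqn_add2l gtn_eqF.
    - rewrite /sat_clauses clE // K2 //.
      have -> : c0 + u != c0 + n by rewrite eqn_add2l ltn_eqF.
      by rewrite orbT; split=> [[h [_ KC]]|[h KC]].
    - by rewrite /= sz.
    - by apply/andP; split; [lia | apply: env_le he; lia].
    - exact: cons_env.
    - by apply/andP; split; [lia | apply: C_le hC; lia].
  have split_range v : c0 <= v < c0 + n.+1 -> v = c0 + n \/ exists u : V, v = c0 + u.
    move=> hv; have [vn|vn] := eqVneq v (c0 + n); first by left.
    have un : v - c0 < order G by rewrite -/n; lia.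
    by right; exists (Ordinal un) => /=; lia.
  have c0n : c0 <= c0 + n by rewrite leq_addr.
  case: ex @p @A @cl hpn stcl E clE inner => p A cl hpn stcl E clE inner.
  - split=> [[v /split_range[->|[u ->]]]|[[u hu] KC]].
    (* Choosing no vertex violates the extra clause. *)
    + move/E/(gsat_weaken (compile_chain _ _ _ _ _ _) stcl) => [].
      by rewrite clE // eqxx.
    + by move/inner => [hu KC]; split=> //; exists u.
    + exists (c0 + u); last exact/inner.
      by have := ltn_ord u; rewrite -/n; lia.
  (* Choosing no vertex makes a path literal true, so the opponent gains nothing by it. *)
  - have last : gsat (sat_clauses (cl ++ A.2) K0) A.1 (c0 + n :: C0) <-> K0 C0.
      rewrite compile_path_true //; first exact: K2.
        by apply: stable_le st; lia.
      by rewrite /= /lit_true /= inE eqxx.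
    split=> [h|[h KC] v /split_range[->|[u ->]]]; last first.
    + exact/inner.
    + exact/last.
    + have KC : K0 C0 by apply/last/h; lia.
      split=> // u; apply: (proj1 (proj1 (inner u) _)).
      by apply: h; have := ltn_ord u; rewrite -/n; lia.
have atom k' (i j : 'I_k') (w : nat -> nat -> bool) (e0 : 'I_k' -> V) pol0 env0 path0 C0 K0
    (P : Prop) : valid_env env0 e0 C0 ->
    ~~ has (lit_true C0) path0 -> (truth pol0 P <-> w (e0 i) (e0 j)) ->
    gsat (sat_clauses [:: single path0 ++
      atom_lits (size matrix_of) w (nth 0 env0 i) (nth 0 env0 j)] K0) [::] C0
    <-> truth pol0 P /\ K0 C0.
  move=> ve np hP; rewrite /= /sat_clauses /= andbT clause_true_single // size_matrix_of.
  by rewrite (clause_true_atom _ _ _ ve) hP.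
elim: phi => {}k => [i j|i j|a IH|a IHa b IHb|a IHa b IHb|a IH|a IH];
  move=> e pol0 env path0 c0 C0 K0 sz he ve hC hp np st;
  have gd : good env e path0 c0 C0 K0 by [].
- have hP : truth pol0 (e i = e j) <-> (e i == e j :> nat) == pol0.
    have -> : (e i == e j :> nat) = (e i == e j) by [].
    by rewrite /truth; case: (pol0); case: (e i =P e j) => h; split.
  exact (atom _ i j (fun u v => (u == v) == pol0) e pol0 env path0 C0 K0 (e i = e j) ve np hP).
- have hP : truth pol0 (adj (e i) (e j)) <-> adj_entry matrix_of (e i) (e j) == pol0.
    by rewrite /truth adj_entry_matrix; case: (pol0); case: (adj _ _); split=> // h; case: h.
  exact (atom _ i j (fun u v => adj_entry matrix_of u v == pol0) e pol0 env path0 C0 K0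
    (adj (e i) (e j)) ve np hP).
- rewrite -[compile _ _ _ _ _ _]/(compile matrix_of (erase a) (~~ pol0) env path0 c0) (IH e) //.
  by rewrite /truth /=; have := classic (fo_holds a e); case: pol0 {np}; tauto.
- have h1 := conjn _ a b IHa IHb e pol0 _ _ _ _ _ gd.
  have h2 := splitn _ a b IHa IHb e pol0 _ _ _ _ _ gd.
  case: pol0 h1 h2 => h1 h2; first by apply: iff_trans h1 _; rewrite /truth /=; tauto.
  apply: iff_trans h2 _; rewrite /truth /=.
  by have := classic (fo_holds a e); have := classic (fo_holds b e); tauto.
- have h1 := conjn _ a b IHa IHb e pol0 _ _ _ _ _ gd.
  have h2 := splitn _ a b IHa IHb e pol0 _ _ _ _ _ gd.
  case: pol0 h1 h2 => h1 h2; first by apply: iff_trans h2 _; rewrite /truth /=; tauto.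
  by apply: iff_trans h1 _; rewrite /truth /=; tauto.
- have h ex := quantn _ a IH e pol0 env path0 c0 C0 K0 ex gd.
  rewrite -size_matrix_of in h; case: pol0 h => h.
    exact: (h true).
  apply: iff_trans (h false) _; rewrite /truth /=; split=> -[h1 KC]; split=> //.
    by case=> v; apply: h1.
  by move=> v hv; apply: h1; exists v.
- have h ex := quantn _ a IH e pol0 env path0 c0 C0 K0 ex gd.
  rewrite -size_matrix_of in h; case: pol0 h => h.
    exact: (h false).
  apply: iff_trans (h true) _; rewrite /truth /=; split=> -[h1 KC]; split=> //.
    by case: h1 => v hv h2; apply: hv.
  by apply: NNPP => no; apply: h1 => v; apply: NNPP => hv; apply: no; exists v.
Qed.

End Soundness.

(** * The quantified propositional formula of a sentence *)

Lemma lift_nform m t (F : nform nat t) : all (fun x => x < m) (nform_vars F) ->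
  exists F' : nform 'I_m t, raw_nform F' = F.
Proof.
elim: t F => [|t IH] F /=.
  by rewrite andbT; case: F => b x /= xm; exists (b, Ordinal xm).
elim: F => [|a F IHF] /=; first by exists [::].
rewrite all_cat => /andP[/IH[a' <-] /IHF[F' <-]].
by exists (a' :: F').
Qed.

(** Blocks must alternate, starting with an existential one, so each quantifier takes a pair of
    blocks: its own of weight 1, and an empty one of weight 0 for the other player. *)
Definition raw_quant (q : bool * (nat * nat)) : seq (seq nat * nat) :=
  if q.1 then [:: (iota q.2.1 q.2.2, 1); ([::], 0)] else [:: ([::], 0); (iota q.2.1 q.2.2, 1)].

Section QbfOfQuants.
Variable m : nat.

Definition interval_set b s : {set 'I_m} := [set x : 'I_m | b <= x < b + s].

Definition set_quant (q : bool * (nat * nat)) : seq ({set 'I_m} * nat) :=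
  if q.1 then [:: (interval_set q.2.1 q.2.2, 1); (set0, 0)]
  else [:: (set0, 0); (interval_set q.2.1 q.2.2, 1)].

Lemma enum_interval_set b s : b + s <= m -> map val (enum (interval_set b s)) = iota b s.
Proof.
move=> h; apply: (irr_sorted_eq ltn_trans ltnn); last 1 first.
- move=> x; rewrite mem_iota; apply/mapP/idP => [[y]|hx].
    by rewrite mem_enum inE => hy ->.
  have xm : x < m by lia.
  by exists (Ordinal xm); rewrite ?mem_enum ?inE.
- have E : enum (interval_set b s) = filter [in interval_set b s] (enum 'I_m) by rewrite enumT.
  have sub : subseq (map val (enum (interval_set b s))) (iota 0 m).
    by rewrite -val_enum_ord E; apply: map_subseq; apply: filter_subseq.
  by apply: subseq_sorted sub (iota_ltn_sorted _ _); apply: ltn_trans.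
- exact: iota_ltn_sorted.
Qed.

Lemma raw_blocks_quants c qs : chain c qs -> c + width qs <= m ->
  raw_blocks (flatten (map set_quant qs)) = flatten (map raw_quant qs).
Proof.
elim: qs c => [|[ex [b s]] qs IH] c //= [-> s0 ch] le.
have le' : c + s + width qs <= m by rewrite widthS in le.
rewrite {1}/raw_blocks map_cat; congr (_ ++ _); last exact: IH ch le'.
have cs : c + s <= m by move: le'; lia.
rewrite /set_quant /raw_quant; case: (ex) => /=; rewrite enum_interval_set // enum_set0 //.
Qed.

Lemma quants_above c qs A x : chain c qs ->
  A \in map fst (flatten (map set_quant qs)) -> x \in A -> c <= x.
Proof.
elim: qs c => [|[ex [b s]] qs IH] c //= [-> s0 ch].
rewrite map_cat mem_cat => /orP[|/(IH _ ch) h /h]; last by lia.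
rewrite /set_quant; case: ex; rewrite !inE => /orP[]/eqP->; rewrite !inE //; by case/andP.
Qed.

Lemma quants_disjoint c qs : chain c qs ->
  pairwise (fun A B : {set 'I_m} => [disjoint A & B]) (map fst (flatten (map set_quant qs))).
Proof.
elim: qs c => [|[ex [b s]] qs IH] c //= [-> s0 ch].
have pw := IH _ ch.
have d0 (B : {set 'I_m}) : [disjoint set0 & B] by rewrite -setI_eq0 set0I.
have d1 : all (fun B : {set 'I_m} => [disjoint interval_set c s & B])
    (map fst (flatten (map set_quant qs))).
  apply/allP => B hB; rewrite -setI_eq0; apply/eqP/setP => x; rewrite !inE.
  apply/negP => /andP[h1 h2]; have := quants_above ch hB h2; lia.
have d0s : all (fun B : {set 'I_m} => [disjoint set0 & B]) (map fst (flatten (map set_quant qs))).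
  by apply/allP.
by rewrite map_cat /set_quant; case: ex; rewrite /= ?d0 ?d1 ?d0s pw ?andbT // disjoint_sym d0.
Qed.

Lemma quants_cover c qs : chain c qs -> forall x : 'I_m, c <= x < c + width qs ->
  x \in \bigcup_(A <- map fst (flatten (map set_quant qs))) A.
Proof.
elim: qs c => [|[ex [b s]] qs IH] c /=; first by move=> _ x; rewrite /width /=; lia.
move=> [-> s0 ch] x hx; have {}hx : c <= x < c + s + width qs by move: hx; rewrite /width /= addnA.
rewrite map_cat big_cat inE; case: (ltnP x (c + s)) => h; last first.
  by rewrite (IH _ ch) ?orbT //; lia.
apply/orP; left; rewrite /set_quant; case: ex; rewrite /= !big_cons big_nil !inE; lia.
Qed.

Lemma gsat_qblocks (M : {set 'I_m} -> Prop) K qs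
    : forall c T C, chain c qs -> c + width qs <= m ->
  agree T C -> (forall T C, agree T C -> M T <-> K C) ->
  qblocks_sat M true (flatten (map set_quant qs)) T <-> gsat K qs C.
Proof.
elim: qs => [|[ex [b s]] qs IH] c T C /=; first by move=> _ _ TC h; apply: h.
move=> [-> s0 ch] le TC hM.
have le' : c + s + width qs <= m by rewrite widthS in le.
have next (x : 'I_m) : qblocks_sat M true (flatten (map set_quant qs)) (x |: T) <->
    gsat K qs (val x :: C).
  by apply: (IH (c + s)) => //; apply: agree_cons.
have one (U : {set 'I_m}) : U \subset interval_set c s -> #|U| = 1 ->
    exists2 x : 'I_m, c <= x < c + s & U = [set x].
  move=> sub /eqP/cards1P[x Ux]; exists x => //.
  by have := subsetP sub x; rewrite Ux !inE eqxx => /(_ isT).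
have sub1 (x : 'I_m) : c <= x < c + s -> [set x] \subset interval_set c s.
  by move=> hx; rewrite sub1set inE.
rewrite /set_quant; case: ex {le} => /=.
- split=> [[U [sub cU h]]|[v hv h]].
    have [x hx Ux] := one U sub cU; exists (val x) => //; apply/next.
    by have := h set0 (sub0set _) (cards0 _); rewrite setU0 Ux setUC.
  have vm : v < m by lia.
  exists [set Ordinal vm]; split; [exact: sub1 | exact: cards1 |].
  move=> U _ /eqP; rewrite cards_eq0 => /eqP->; rewrite setU0 setUC.
  exact/next.
- split=> [[U [_ /eqP]]|h].
    rewrite cards_eq0 => /eqP-> h v hv; have vm : v < m by lia.
    apply/(next (Ordinal vm)); have := h _ (sub1 (Ordinal vm) hv) (cards1 _).
    by rewrite setU0 setUC.
  exists set0; split; [exact: sub0set | exact: cards0 | move=> U sub cU].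
  have [x hx Ux] := one U sub cU; rewrite setU0 Ux setUC.
  exact/next/h.
Qed.

End QbfOfQuants.

Definition compile_sentence (M : seq (seq bool)) (r : rfo) : quants * seq clause :=
  compile M r true [::] [::] 0.

Lemma nform_vars3 (cls : nform nat 3) m :
  all (clause_below m) cls -> all (fun x => x < m) (nform_vars cls).
Proof.
move=> h; have E (T : Type) (f : T -> seq nat) (P : pred T) (s : seq T) :
    (forall x, P x -> all (fun x => x < m) (f x)) -> all P s ->
    all (fun x => x < m) (flatten (map f s)).
  by move=> hf; elim: s => //= a s IH /andP[/hf ha /IH hs]; rewrite all_cat ha.
apply: (E _ _ _ _ _ h) => cl; apply: (E) => s; apply: (E) => l /=; by rewrite andbT.
Qed.

Lemma compile_instance (G : graph) (phi : sentence) : exists I : qbf 3,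
  [/\ enc_qbf I = eP eBlocks (@eNform 3)
        (flatten (map raw_quant (compile_sentence (matrix_of G) (erase phi)).1),
         (compile_sentence (matrix_of G) (erase phi)).2),
      qbf_par I <= 3 * fo_size phi & models G phi <-> qbf_sat I].
Proof.
set cq := compile_sentence _ _; pose m := width cq.1.
have ch : chain 0 cq.1 by apply: compile_chain.
have below : all (clause_below m) cq.2.
  by apply: (@compile_below (matrix_of G) (erase phi) true [::] [::] 0) => //; apply: scoped_erase.
have [F hF] := lift_nform (t := 3) (nform_vars3 below).
have cover : \bigcup_(A <- map fst (flatten (map (@set_quant m) cq.1))) A = setT.
  by apply/setP => x; rewrite inE (quants_cover ch) //=; apply: ltn_ord.
pose I := @QBF 3 m (flatten (map (@set_quant m) cq.1)) F (quants_disjoint m ch) cover.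
exists I; split.
- by rewrite enc_qbf_raw -hF -(raw_blocks_quants (m := m) ch).
- rewrite /qbf_par /=; have := compile_size (matrix_of G) phi true [::] [::] 0.
  rewrite -/(compile_sentence _ _) -/cq.
  (* Each quantifier contributes two blocks and weight 1. *)
  suff -> : size (flatten (map (@set_quant m) cq.1)) +
     sumn (map snd (flatten (map (@set_quant m) cq.1))) = 3 * size cq.1 by rewrite leq_mul2l.
  elim: (cq.1) => //= -[[] [b s]] qs IH; rewrite map_cat size_cat sumn_cat /= ?mulnS; lia.
- have agree0 : agree (set0 : {set 'I_m}) [::] by move=> y; rewrite !inE.
  have sem := @gsat_qblocks m (fun T => nform_sat T true F) (sat_clauses cq.2 (fun=> True))
    cq.1 0 set0 [::] ch (leqnn _) agree0.
  apply: iff_trans (iff_sym (sem _)).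
    apply: iff_trans (iff_sym (@compile_sound G 0 phi (@env_nil _) true [::] [::] 0 [::]
      (fun=> True) _ _ _ _ _ _ _)) => //; last by case.
    by rewrite /truth /models; tauto.
  move=> T C TC; rewrite (nform_holds_raw _ _ TC) hF /sat_clauses.
  by split=> [|[]].
Qed.

(** * Running the compilation with a worklist *)

Definition rtag (r : rfo) : nat :=
  match r with
  | REq _ _ => 0 | RAdj _ _ => 1 | RNot _ => 2 | RAnd _ _ => 3 | ROr _ _ => 4
  | REx _ => 5 | RAll _ => 6
  end.

Definition ratomic (r : rfo) := rtag r <= 1.
Definition rbinary (r : rfo) := (rtag r == 3) || (rtag r == 4).
Definition rvar1 (r : rfo) := match r with REq i _ | RAdj i _ => i | _ => 0 end.
Definition rvar2 (r : rfo) := match r with REq _ j | RAdj _ j => j | _ => 0 end.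
Definition rbody (r : rfo)
    := match r with RNot a | REx a | RAll a => a | _ => REq 0 0 end.
Definition rleft (r : rfo) := match r with RAnd a _ | ROr a _ => a | _ => REq 0 0 end.
Definition rright (r : rfo) := match r with RAnd _ a | ROr _ a => a | _ => REq 0 0 end.

Lemma pt_rtag X (eX : X -> tree) (r : X -> rfo) (pr : pt eX eF r) : pt eX eN
    (fun x => rtag (r x)).
Proof.
apply: (pt_comp pr); apply: (@pt_proj _ _ _ _ (EHd (EVar 0))) => //.
by move=> [] > /= ->.
Qed.

(** On formulas outside [P] the projection could return an unrelated subtree; the branch replaces it
    by a fixed default. *)
Lemma pt_destruct X (eX : X -> tree) (r : X -> rfo) Y (eY : Y -> tree)
    (P : rfo -> bool) (e : expr) (y0 : Y) (f : rfo -> Y) (pr : pt eX eF r) :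
  pt eF eB P -> projection e ->
  (forall a s, P a -> s 0 = eF a -> eval e s = eY (f a)) ->
  (forall a, ~~ P a -> f a = y0) -> pt eX eY (fun x => f (r x)).
Proof.
move=> pP pe he hy; apply: (pt_comp pr); apply: (pt_case pP).
  by apply: (@pt_proj _ _ _ _ e) => // -[a Pa] s; apply: he.
by apply: pt_ext (pt_const _ _ y0) => -[a Pa] /=; rewrite hy.
Qed.

Lemma pt_ratomic X (eX : X -> tree) (r : X -> rfo) (pr : pt eX eF r) : pt eX eB
    (fun x => ratomic (r x)).
Proof. by have := pt_rtag pr => ?; rewrite /ratomic; pt_tac. Qed.

Lemma pt_rbinary X (eX : X -> tree) (r : X -> rfo) (pr : pt eX eF r) : pt eX eB
    (fun x => rbinary (r x)).
Proof. by have := pt_rtag pr => ?; rewrite /rbinary; pt_tac. Qed.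

Lemma pt_rvar1 X (eX : X -> tree) (r : X -> rfo) (pr : pt eX eF r) : pt eX eN
    (fun x => rvar1 (r x)).
Proof.
apply: (pt_destruct pr (P := ratomic) (e := EHd (ETl (EVar 0))) (y0 := 0)) => //.
- exact: pt_ratomic (pt_idE _).
- by move=> [] // > _ /= ->.
- by case.
Qed.

Lemma pt_rvar2 X (eX : X -> tree) (r : X -> rfo) (pr : pt eX eF r) : pt eX eN
    (fun x => rvar2 (r x)).
Proof.
apply: (pt_destruct pr (P := ratomic) (e := ETl (ETl (EVar 0))) (y0 := 0)) => //.
- exact: pt_ratomic (pt_idE _).
- by move=> [] // > _ /= ->.
- by case.
Qed.

Lemma pt_rleft X (eX : X -> tree) (r : X -> rfo) (pr : pt eX eF r) : pt eX eF
    (fun x => rleft (r x)).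
Proof.
apply: (pt_destruct pr (P := rbinary) (e := EHd (ETl (EVar 0))) (y0 := REq 0 0)) => //.
- exact: pt_rbinary (pt_idE _).
- by move=> [] // > _ /= ->.
- by case.
Qed.

Lemma pt_rright X (eX : X -> tree) (r : X -> rfo) (pr : pt eX eF r) : pt eX eF
    (fun x => rright (r x)).
Proof.
apply: (pt_destruct pr (P := rbinary) (e := ETl (ETl (EVar 0))) (y0 := REq 0 0)) => //.
- exact: pt_rbinary (pt_idE _).
- by move=> [] // > _ /= ->.
- by case.
Qed.

Lemma pt_rbody X (eX : X -> tree) (r : X -> rfo) (pr : pt eX eF r) : pt eX eF
    (fun x => rbody (r x)).
Proof.
apply: (pt_destruct pr (P := fun a => ~~ ratomic a && ~~ rbinary a)
  (e := ETl (EVar 0)) (y0 := REq 0 0)) => //.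
- apply: pt_and; apply: pt_neg; [apply: pt_ratomic | apply: pt_rbinary]; exact: pt_idE.
- by move=> [] // > _ /= ->.
- by case.
Qed.

Definition item : Type := rfo * (bool * (seq nat * seq lit)).
Notation eLit := (eP eB eN).
Notation eClause := (eL (eL eLit)).
Notation eItem := (eP eF (eP eB (eP (eL eN) (eL eLit)))).
Notation eQuants := (eL (eP eB (eP eN eN))).
Notation eMatrix := (eL (eL eB)).

(** One layer of [compile] without the recursive calls. Quantifiers and clauses of a layer precede
    those of its subformulas, so a depth-first worklist emits them in the order of [compile]. *)
Definition expand (M : seq (seq bool)) (it : item) (c : nat) :
    seq item * (quants * seq clause) :=
  let r := it.1 in let pol := it.2.1 in let env := it.2.2.1 in let path := it.2.2.2 in
  let n := size M in
  if ratomic r then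
    ([::], ([::], [:: single path ++
       atom_lits n (fun u v => (if rtag r == 0 then u == v else adj_entry M u v) == pol)
         (nth 0 env (rvar1 r)) (nth 0 env (rvar2 r))]))
  else if rbinary r then
    if (rtag r == 3) == pol then
      ([:: (rleft r, (pol, (env, path))); (rright r, (pol, (env, path)))], ([::], [::]))
    else
      ([:: (rleft r, (pol, (env, (false, c) :: path)));
           (rright r, (pol, (env, (false, c.+1) :: path)))], ([:: (true, (c, 2))], [::]))
  else if rtag r == 2 then ([:: (rbody r, (~~ pol, (env, path)))], ([::], [::]))
  else if (rtag r == 5) == pol then
    ([:: (rbody r, (pol, (c :: env, path)))],
      ([:: (true, (c, n.+1))], [:: single path ++ [:: [:: (false, c + n)]]]))
  else ([:: (rbody r, (pol, (c :: env, (true, c + n) :: path)))],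
      ([:: (false, (c, n.+1))], [::])).

Definition wstate : Type := seq item * (nat * (quants * seq clause)).

Definition wstep (M : seq (seq bool)) (st : wstate) : wstate :=
  if st.1 is it :: wl then
    let E := expand M it st.2.1 in
    (E.1 ++ wl, (st.2.1 + width E.2.1, (st.2.2.1 ++ E.2.1, st.2.2.2 ++ E.2.2)))
  else st.

Fixpoint rnodes (r : rfo) : nat :=
  match r with
  | REq _ _ | RAdj _ _ => 1
  | RNot a | REx a | RAll a => (rnodes a).+1
  | RAnd a b | ROr a b => (rnodes a + rnodes b).+1
  end.

(** The items stemming from [r] are finished before [wl] is touched, after one step for each node of
    [r]. *)
Lemma wstep_run M r pol env path wl c qs cls :
  iter (rnodes r) (wstep M) ((r, (pol, (env, path))) :: wl, (c, (qs, cls))) =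
  (wl, (c + width (compile M r pol env path c).1,
     (qs ++ (compile M r pol env path c).1, cls ++ (compile M r pol env path c).2))).
Proof.
elim: r pol env path wl c qs cls => [i j|i j|a IH|a IHa b IHb|a IHa b IHb|a IH|a IH]
  pol env path wl c qs cls.
- by [].
- by [].
- by rewrite iterSr [wstep _ _]/= IH /width /= addn0 !cats0.
- rewrite iterSr addnC iterD; case: pol.
    rewrite [wstep _ _]/= [iter (rnodes a) _ _]IHa IHb /= !width_cat !cats0 /width /=.
    by rewrite addn0 !addnA !catA.
  rewrite (_ : wstep M _ = ([:: (a, (false, (env, (false, c) :: path)));
    (b, (false, (env, (false, c.+1) :: path)))] ++ wl,
    (c.+2, (qs ++ [:: (true, (c, 2))], cls))));
    last by rewrite /wstep /= /width /= addn0 addn2 cats0.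
  by rewrite [cat _ _]/= IHa IHb /= widthS width_cat addn2 addnA -!catA.
- rewrite iterSr addnC iterD; case: pol.
    rewrite (_ : wstep M _ = ([:: (a, (true, (env, (false, c) :: path)));
      (b, (true, (env, (false, c.+1) :: path)))] ++ wl,
      (c.+2, (qs ++ [:: (true, (c, 2))], cls))));
    last by rewrite /wstep /= /width /= addn0 addn2 cats0.
    by rewrite [cat _ _]/= IHa IHb /= widthS width_cat addn2 addnA -!catA.
  rewrite [wstep _ _]/= [iter (rnodes a) _ _]IHa IHb /= !width_cat !cats0 /width /=.
  by rewrite addn0 !addnA !catA.
- by rewrite iterSr; case: pol;
    rewrite [wstep _ _]/= IH /= ?widthS /width /= addn0 -!catA.
- by rewrite iterSr; case: pol;
    rewrite [wstep _ _]/= IH /= ?widthS /width /= addn0 -!catA.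
Qed.

(** * Running time of the worklist *)

Ltac pt_user ::= first
  [ simple eapply pt_rtag | simple eapply pt_ratomic | simple eapply pt_rbinary
  | simple eapply pt_rvar1 | simple eapply pt_rvar2 | simple eapply pt_rleft
  | simple eapply pt_rright | simple eapply pt_rbody ].

Lemma pt_single X (eX : X -> tree) (p : X -> seq lit) : pt eX
    (eL eLit) p -> pt eX eClause (fun x => single (p x)).
Proof. by move=> pp; rewrite /single; pt_tac. Qed.

Lemma pt_expand X (eX : X -> tree) (M : X -> seq (seq bool)) (it : X -> item)
    (c : X -> nat) :
  pt eX eMatrix M -> pt eX eItem it -> pt eX eN c ->
  pt eX (eP (eL eItem) (eP eQuants (eL eClause))) (fun x => expand (M x) (it x) (c x)).
Proof.
move=> pM pi pc; rewrite /expand /atom_lits /adj_entry.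
by do ![simple eapply pt_single | pt_step].
Qed.

Lemma pt_width X (eX : X -> tree) (qs : X -> quants) : pt eX eQuants qs -> pt eX eN
    (fun x => width (qs x)).
Proof.
move=> pq; have : pt eX eN (fun x => foldr (fun (q : bool * (nat * nat)) n => q.2.2 + n) 0 (qs x)).
  apply: (pt_foldr (g := fun _ q n => q.2.2 + n) (q := fun p => tsize (eN p.2.2.2)) pq
    (pt_const _ _ 0)).
  - by pt_tac.
  - by apply: pt_pb; pt_tac.
  - by move=> x a b; rewrite !tsize_nat /=; lia.
by apply: pt_ext => x; rewrite /width; elim: (qs x) => //= q s ->.
Qed.

Notation eState := (eP (eL eItem) (eP eN (eP eQuants (eL eClause)))).
Notation eExpansion := (eP (eL eItem) (eP eQuants (eL eClause))).

Definition item0 : item := (REq 0 0, (true, ([::], [::]))).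

Lemma pt_wstep : pt (eP eMatrix eState) (eP eMatrix eState)
    (fun z => (z.1, wstep z.1 z.2)).
Proof.
have h : pt (eP eMatrix eState) (eP eMatrix eState) (fun z =>
    if nilp z.2.1 then z else (z.1,
      ((expand z.1 (head item0 z.2.1) z.2.2.1).1 ++ behead z.2.1,
       (z.2.2.1 + width (expand z.1 (head item0 z.2.1) z.2.2.1).2.1,
        (z.2.2.2.1 ++ (expand z.1 (head item0 z.2.1) z.2.2.1).2.1,
         z.2.2.2.2 ++ (expand z.1 (head item0 z.2.1) z.2.2.1).2.2))))).
  by do ![simple eapply pt_width | simple eapply pt_expand | simple eapply pt_head | pt_step].
by apply: pt_ext h => -[M [[|it wl] [c [qs cls]]]].
Qed.

Lemma expand_width M it c : width (expand M it c).2.1 <= size M + 2.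
Proof.
by rewrite /expand; do ![case: ifP => _]; rewrite /width /=; lia.
Qed.

Lemma tsize_item r pol env path : tsize (eItem (r, (pol, (env, path)))) =
  tsize (eF r) + tsize (eB pol) + tsize (eL eN env) + tsize (eL eLit path) + 3.
Proof. by rewrite /eP /=; lia. Qed.

(** A step adds at most one entry of size [2 * c + 2] to [env] and one of size at most
    [2 * (c + n) + 6] to [path], where [n] is the number of rows of [M]; the rest of the constant
    also covers a flip of polarity. *)
Lemma expand_items M it c : all (fun it' => tsize (eItem it') <=
  tsize (eItem it) + (4 * c + 2 * size M + 12)) (expand M it c).1.
Proof.
have hb r : ratomic r = false -> tsize (eF (rbody r)) <= tsize (eF r).
  by case: r => //= *; lia.
have hl r : rbinary r -> tsize (eF (rleft r)) <= tsize (eF r).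
  by case: r => * //=; lia.
have hr r : rbinary r -> tsize (eF (rright r)) <= tsize (eF r).
  by case: r => * //=; lia.
have eBs b : 0 < tsize (eB b) <= 3 by case: b.
have eNs x (env : seq nat) : tsize (eL eN (x :: env)) = 2 * x + 2 + tsize (eL eN env).
  by rewrite /= tsize_nat; lia.
have eLs (l : lit) path : tsize (eL eLit (l :: path)) <= 2 * l.2 + 6 + tsize (eL eLit path).
  by have := eBs l.1; rewrite /= tsize_nat; lia.
case: it => [r [pol [env path]]]; rewrite /expand; cbn [fst snd].
have [p1 p2] := (eBs pol, eBs (~~ pol)).
case: ifP => [//|/hb {}hb]; case: ifP => [br|_].
  have := hl _ br; have := hr _ br => h1 h2.
  case: ifP => _; rewrite [(_, _).1]/= /all !tsize_item; first by lia.
  have := eLs (false, c) path; have := eLs (false, c.+1) path.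
  by rewrite [_.2]/= [X in _ -> X]/=; lia.
case: ifP => _; first by rewrite [(_, _).1]/= /all !tsize_item; lia.
case: ifP => _; rewrite [(_, _).1]/= /all !tsize_item !eNs; first by lia.
by have := eLs (true, c + size M) path; rewrite [_.2]/=; lia.
Qed.

Lemma rnodes_le r : rnodes r <= tsize (eF r).
Proof. by elim: r => //= *; lia. Qed.

(** A loop rule needs the first stopping time, while only some time [k] at which the work is done is
    known. As finished states are fixed, both give the same state. *)
Lemma iter_idle (T : Type) (go : T -> bool) (f : T -> T) z k :
  (forall z, ~~ go z -> f z = z) -> ~~ go (iter k f z) ->
  exists2 m, m <= k & iter k f z = iter m f z /\ ~~ go (iter m f z) /\
    forall i, i < m -> go (iter i f z).
Proof.
move=> idle nk; have ex : exists m, ~~ go (iter m f z) by exists k.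
case: (ex_minnP ex) => m nm mmin; have mk := mmin k nk; exists m => //.
split; last by split=> // i im; apply: contraTT im => /mmin; rewrite -leqNgt.
rewrite -(subnK mk) iterD; elim: (k - m) => //= j ->; exact: idle.
Qed.

Lemma tsize_expansion its qs cls : tsize (eExpansion (its, (qs, cls))) =
  tsize (eL eItem its) + tsize (eQuants qs) + tsize (eL eClause cls) + 2.
Proof. by rewrite /eP /=; lia. Qed.

Lemma tsize_state wl c qs cls : tsize (eState (wl, (c, (qs, cls)))) =
  tsize (eL eItem wl) + 2 * c + tsize (eQuants qs) + tsize (eL eClause cls) + 4.
Proof. by rewrite /eP /= tsize_nat; lia. Qed.

Section Bounds.
Variables (M : seq (seq bool)) (K I0 Q : nat).
Let n := size M.
Let D := 4 * (K * (n + 2)) + 2 * n + 12.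
Hypothesis hQ : forall it c, tsize (eItem it) <= I0 + K * D -> c <= K * (n + 2) ->
  tsize (eExpansion (expand M it c)) <= Q.

(** All growth is additive: the counter gains at most [n + 2] per step, so within [K] steps an item
    gains at most [D] per step, which in turn keeps each expansion below [Q]. *)
Lemma wstep_bounds st k : k <= K ->
  all (fun it => tsize (eItem it) <= I0) st.1 -> st.2.1 = 0 ->
  let st' := iter k (wstep M) st in
  [/\ all (fun it => tsize (eItem it) <= I0 + k * D) st'.1, st'.2.1 <= k * (n + 2)
    & tsize (eState st') <= tsize (eState st) + k * (Q + 2 * (n + 2))].
Proof.
move=> kK h1 h2; elim: k kK => [|k IH] kK.
  split=> /=; [|by rewrite h2|by lia].
  by apply: sub_all h1 => it /=; rewrite mul0n addn0.
have [] := IH (ltnW kK); rewrite iterS; move: (iter k _ st) => -[[|it wl] [c [qs cls]]].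
  by rewrite /= => _ ? ?; split=> //; lia.
have -> : wstep M (it :: wl, (c, (qs, cls))) = let E := expand M it c in
  (E.1 ++ wl, (c + width E.2.1, (qs ++ E.2.1, cls ++ E.2.2))) by [].
cbv zeta; rewrite [_.1]/= => /andP[hit hwl] hc hs.
have {}hc : c <= k * (n + 2) := hc.
have kD : k * D + D <= K * D by rewrite -mulSnr leq_mul2r kK orbT.
have kn : k * (n + 2) + (n + 2) <= K * (n + 2) by rewrite -mulSnr leq_mul2r kK orbT.
have hE := hQ (it := it) (c := c); have hw := expand_width M it c.
have hi := expand_items M it c.
split.
- have cK : c <= K * (n + 2) := leq_trans hc (leq_trans (leq_addr _ _) kn).
  have cD : 4 * c + 2 * n + 12 <= D by rewrite /D !leq_add2r leq_mul2l cK.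
  rewrite [_.1]/= all_cat mulSn; apply/andP; split.
    apply: sub_all hi => it' h; apply: leq_trans h _; rewrite addnCA addnC -/n.
    by move: hit cD; clearbody D; move: (k * D) => P; lia.
  by apply: sub_all hwl => it' h; apply: leq_trans h _; rewrite leq_add2l leq_addl.
- by rewrite [_.2.1]/= mulSn addnC; apply: leq_add.
- have {}hE : tsize (eExpansion (expand M it c)) <= Q.
    apply: hE; last by apply: leq_trans hc (leq_trans (leq_addr _ _) kn).
    by apply: leq_trans hit _; rewrite leq_add2l; apply: leq_trans (leq_addr _ _) kD.
  rewrite mulSn; move: (k * _) hs => P; rewrite !tsize_state => hs.
  move: hE hw; rewrite (surjective_pairing (expand _ _ _)) (surjective_pairing (expand _ _ _).2).
  rewrite tsize_expansion [(_, _).1]/= [(_, _).2.1]/= [(_, _).2.2]/= -/n => hE hw.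
  rewrite !enc_seq_cat; move: hs; rewrite [eL eItem (it :: wl)]/= [tsize (Node _ _)]/=; lia.
Qed.

End Bounds.

Lemma pt_compile : pt (eP eMatrix eF) (eP eQuants (eL eClause))
  (fun x => compile_sentence x.1 x.2).
Proof.
pose eX := eP eMatrix eF.
pose init (x : seq (seq bool) * rfo) : seq (seq bool) * wstate :=
  (x.1, ([:: (x.2, (true, ([::], [::])))], (0, ([::], [::])))).
pose go (z : seq (seq bool) * wstate) := ~~ nilp z.2.1.
pose step (z : seq (seq bool) * wstate) := (z.1, wstep z.1 z.2).
pose f (x : seq (seq bool) * rfo) : seq (seq bool) * wstate :=
  (x.1, ([::], (width (compile_sentence x.1 x.2).1, compile_sentence x.1 x.2))).
suff pf : pt eX (eP eMatrix eState) f by apply: pt_snd (pt_snd (pt_snd pf)).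
have pM := pt_pb (pt_fst (pt_idE eX)).
have pF := pt_pb (pt_snd (pt_idE eX)).
pose N (x : seq (seq bool) * rfo) := size x.1.
have pN : pb eX N by apply: pb_le pM => x; apply: ltnW (enc_seq_size _ _).
pose K (x : seq (seq bool) * rfo) := tsize (eF x.2).
pose I0 (x : seq (seq bool) * rfo) := tsize (eF x.2) + 8.
pose D x := 4 * (K x * (N x + 2)) + 2 * N x + 12.
have pD : pb eX D by rewrite /D /K; pb_tac.
have pexp : pt (eP (eP eMatrix eItem) eN) eExpansion (fun z => expand z.1.1 z.1.2 z.2).
  by apply: pt_expand; pt_tac.
pose S0 x := tsize (eMatrix x.1) + (I0 x + K x * D x) + 2 * (K x * (N x + 2)) + 3.
have pS0 : pb eX S0 by rewrite /S0 /I0 /K; pb_tac.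
(* [Q] bounds the output of one expansion; it is available because [S0] already bounds every item
   and the counter. *)
have [Q pQ hQ] := pb_index pS0 (pt_pb pexp).
have itE x i : iter i step (init x) = (x.1, iter i (wstep x.1) (init x).2).
  by elim: i => //= i ->.
apply: (@pt_while _ _ eX (eP eMatrix eState) go step init f K
  (fun x => tsize (eMatrix x.1) + (tsize (eF x.2) + 20) + K x * (Q x + 2 * (N x + 2)) + 1)).
- by rewrite /go; pt_tac.
- exact: pt_wstep.
- by rewrite /init /eX; pt_tac.
- exact: pF.
- by rewrite /K; pb_tac.
- move=> x i iK; rewrite itE.
  have hE it c : tsize (eItem it) <= I0 x + K x * D x -> c <= K x * (N x + 2) ->
      tsize (eExpansion (expand x.1 it c)) <= Q x.
    move=> hi hc; apply: (hQ x (x.1, it, c)).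
    by move: hi hc; rewrite /S0 /eP /= tsize_nat; lia.
  have [] := @wstep_bounds x.1 (K x) (I0 x) (Q x) hE (init x).2 i iK _ _ => //.
    by rewrite /= andbT /I0; lia.
  move=> _ _ h; rewrite -[X in X <= _]/(tsize (eMatrix x.1) +
    tsize (eState (iter i (wstep x.1) (init x).2))).+1; move: h.
  have -> : tsize (eState (init x).2) = tsize (eF x.2) + 16.
    by rewrite /init [(_, _).2]/= tsize_state /=; lia.
  have : i * (Q x + 2 * (N x + 2)) <= K x * (Q x + 2 * (N x + 2)) by rewrite leq_mul2r iK orbT.
  rewrite -/(N x); move: (i * _) (K x * _) (tsize (eState _)) => P P' T; lia.
- move=> x; have run : iter (rnodes x.2) step (init x) = f x.
    by rewrite itE /init [(_, _).2]/= wstep_run /f /compile_sentence; case: (compile _ _ _ _ _ _).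
  have [||m mK [E [nm gm]]] := @iter_idle _ go step (init x) (rnodes x.2).
  + by move=> [M' [[|it wl] st]].
  + by rewrite run.
  + exists m; first exact: leq_trans mK (rnodes_le _).
    by rewrite -E run.
Qed.

(** * Membership of model checking in AW[*] *)

Lemma enc_graph_matrix (G : graph) : enc_graph G = eL (eL eB) (matrix_of G).
Proof.
rewrite /enc_graph /matrix_of.
have enc_map (S T : Type) (h : S -> T) (f : T -> tree) s :
    enc_seq f (map h s) = enc_seq (fun x => f (h x)) s by rewrite /enc_seq foldr_map.
rewrite enc_map; elim: {2 4}(enum 'I_(order G)) => //= x s ->.
by rewrite enc_map.
Qed.

Lemma pt_raw_quants X (eX : X -> tree) (qs : X -> quants) :
  pt eX eQuants qs -> pt eX eBlocks (fun x => flatten (map raw_quant (qs x))).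
Proof.
move=> pq; apply: pt_flatten; apply: (pt_map (g := fun _ => raw_quant) pq).
by rewrite /raw_quant; pt_tac.
Qed.

Lemma fo_model_checking_in (C : graph -> Prop) : in_AWstar (FO_model_checking C).
Proof.
exists 3; split=> //.
have [y hy] := choice _ (fun x : inst (FO_model_checking C) => compile_instance (sval x.1) x.2).
(* A polynomial-time translation becomes a reduction by composition with the identity. *)
apply: (@fpt_comp_pt _ (FO_model_checking C) (QBFSAT 3) y (fun n => 3 * n)) (fpt_refl _).
- pose f (x : seq (seq bool) * rfo) : seq (seq nat * nat) * nform nat 3 :=
    (flatten (map raw_quant (compile_sentence x.1 x.2).1), (compile_sentence x.1 x.2).2).
  have pf : pt (eP eMatrix eF) (eP eBlocks (@eNform 3)) f.
    apply: pt_pair; first by apply: pt_raw_quants; apply: pt_fst pt_compile.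
    exact: pt_snd pt_compile.
  apply: (pt_recode (u := fun x : inst (FO_model_checking C) =>
     (matrix_of (sval x.1), erase x.2)) _ _ pf) => x.
    by rewrite /eP /= enc_erase -enc_graph_matrix.
  by have [] := hy x.
- by pt_tac.
- by move=> m n mn; rewrite leq_mul2l mn orbT.
- by move=> x; have [] := hy x.
- by move=> x; have [] := hy x.
Qed.

Theorem theorem15 (C : graph -> Prop)
  (hC : closed_isomorphism C)
  (hrep : consecutive_representation_property C)
  (hind : closed_induced_subgraph C)
  (hdup : closed_duplication C) :
  AWstar_complete (FO_model_checking C).
Proof.
split; first exact: fo_model_checking_in.
by move=> Q; apply: fo_model_checking_hard.
Qed.
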